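(* Let $Y\subset\mathbb{R}^2$ be the union of the circle arc $\{(x,y): x^2+y^2=1,\ y\leq 0\}$, the horizontal segment $[-1,1]\times\{0\}$, and the vertical segments $\{-1+\frac{2}{n}\}\times[0,\frac1n]$ for all integers $n\geq 1$. Then there is a $G_\delta$ conjugacy class which is dense in $\mathcal{H}(Y)$ and whose members have the shadowing property. In particular, the shadowing property is generic in $\mathcal{H}(Y)$, that is, it holds on a residual subset of $\mathcal{H}(Y)$.
   Context: For a compact metric space $(X,\mathrm{dist})$, $\mathcal{H}(X)$ denotes the space of homeomorphisms $f\colon X\to X$ with the $C^0$ distance $\mathrm{dist}_{C^0}(f,g)=\sup\{\mathrm{dist}(f(x),g(x)),\ \mathrm{dist}(f^{-1}(x),g^{-1}(x)) : x\in X\}$. Here $Y$ carries the metric induced from $\mathbb{R}^2$. Two homeomorphisms $f,g\in\mathcal{H}(X)$ are conjugate if there is $h\in\mathcal{H}(X)$ with $f\circ h=h\circ g$; the conjugacy class of $f$ is the set of all homeomorphisms conjugate to $f$. A set is $G_\delta$ if it is a countable intersection of open sets, and residual if it contains a dense $G_\delta$ subset. A sequence $\{x_i\}_{i\in\mathbb{Z}}$ in $X$ is a $\delta$-pseudo orbit of $f$ if $\mathrm{dist}(f(x_i),x_{i+1})<\delta$ for all $i\in\mathbb{Z}$. A homeomorphism $f\in\mathcal{H}(X)$ has the shadowing property if for all $\varepsilon>0$ there is $\delta>0$ such that if $\{x_i\}_{i\in\mathbb{Z}}$ is a $\delta$-pseudo orbit then there is $y\in X$ such that $\mathrm{dist}(f^i(y),x_i)<\varepsilon$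 for all $i\in\mathbb{Z}$. *)

(* Defs.v *)
From HB Require Import structures.
From mathcomp Require Import all_boot all_order all_algebra.
From mathcomp Require Import all_classical all_reals all_analysis.
From mathcomp Require Import borel_hierarchy.
From mathcomp Require Import ring lra.

Set Implicit Arguments.
Unset Strict Implicit.
Unset Printing Implicit Defensive.

Import Order.TTheory GRing.Theory Num.Theory.
Import numFieldNormedType.Exports.
Import metricType_numDomainType.

Local Open Scope classical_set_scope.
Local Open Scope ring_scope.

HB.mixin Record Metric_isCompact (R : realType) T & Metric R T := {
  compact_setT : compact [set: T]
}.

#[short(type="compactMetricType")]
HB.structure Definition CompactMetric (R : realType) :=
  { T of Metric R T & Metric_isCompact R T }.

Record homeo (R : realType) (X : compactMetricType R) := Homeo {
  homeo_fun :> X -> X;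
  homeo_inv : X -> X;
  homeo_funK : cancel homeo_fun homeo_inv;
  homeo_invK : cancel homeo_inv homeo_fun;
  homeo_fun_continuous : continuous homeo_fun;
  homeo_inv_continuous : continuous homeo_inv
}.

HB.instance Definition _ (R : realType) (X : compactMetricType R) :=
  gen_eqMixin (homeo X).
HB.instance Definition _ (R : realType) (X : compactMetricType R) :=
  gen_choiceMixin (homeo X).

Section C0_distance.
Context {R : realType} {X : compactMetricType R}.
Implicit Types f g h : homeo X.

(* The supremum is over a set bounded by the diameter of the compact space X;
   it takes the default value 0 when X is empty. *)
Definition dist_C0 f g : R :=
  sup [set d | exists x, d = mdist (f x) (g x) \/
                         d = mdist (homeo_inv f x) (homeo_inv g x)].

Lemma compact_diam : exists M : R, forall x y : X, mdist x y <= M.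
Proof.
have [[x0 _]|X0] := pselect (exists x : X, True); last first.
  by exists 0 => x; exfalso; apply: X0; exists x.
have [M hM] : exists M : R, forall y : X, mdist x0 y <= M.
  have /compact_near_coveringP := @compact_setT R X.
  move=> /(_ R +oo%R (fun M y => mdist x0 y <= M) _) [].
    move=> x _; exists (ball x 1, [set M | mdist x0 x + 1 < M]) => /=.
      by split; [exact: nbhsx_ballx|exact: nbhs_pinfty_gt (num_real _)].
    move=> [y M] /= [+ /ltW]; rewrite ballEmdist /= => /ltW xy.
    by apply: le_trans; rewrite (le_trans (metric_triangle _ x _))// lerD2l.
  move=> M [_ /(_ (M + 1))]; rewrite ltrDl ltr01 => /(_ isT) H.
  by exists (M + 1) => y; exact: H.
exists (M + M) => x y.
by rewrite (le_trans (metric_triangle _ x0 _))// lerD// metric_sym.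
Qed.

Lemma homeo_eq f g : f =1 g -> f = g.
Proof.
move=> fg; have Ef : homeo_fun f = homeo_fun g by exact/funext.
have Ei : homeo_inv f = homeo_inv g.
  by apply/funext => x; rewrite -{1}(homeo_invK g x) -fg homeo_funK.
case: f g {fg} Ef Ei => [f fi a b c d] [g gi a' b' c' d'] /= Ef Ei.
by subst; congr Homeo; exact: Prop_irrelevance.
Qed.

Lemma dist_C0_has_ubound f g :
  has_ubound [set d | exists x, d = mdist (f x) (g x) \/
                         d = mdist (homeo_inv f x) (homeo_inv g x)].
Proof. by have [M hM] := compact_diam; exists M => d [x [->|->]]. Qed.

Lemma dist_C0_fun f g x : mdist (f x) (g x) <= dist_C0 f g.
Proof. by apply: ub_le_sup; [exact: dist_C0_has_ubound|exists x; left]. Qed.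

Lemma dist_C0_inv f g x :
  mdist (homeo_inv f x) (homeo_inv g x) <= dist_C0 f g.
Proof. by apply: ub_le_sup; [exact: dist_C0_has_ubound|exists x; right]. Qed.

Lemma dist_C0_le f g (M : R) : 0 <= M ->
  (forall x, mdist (f x) (g x) <= M) ->
  (forall x, mdist (homeo_inv f x) (homeo_inv g x) <= M) ->
  dist_C0 f g <= M.
Proof.
move=> M0 fM iM; rewrite /dist_C0; set D := (X in sup X).
have [->|/set0P D0] := eqVneq D set0; first by rewrite sup0.
by apply: ge_sup => // d [x [->|->]].
Qed.

Lemma dist_C0_ge0 f g : 0 <= dist_C0 f g.
Proof.
have [[x0 _]|X0] := pselect (exists x : X, True).
  exact: le_trans (mdist_ge0 _ _) (dist_C0_fun f g x0).
rewrite /dist_C0 (_ : [set _ | _] = set0) ?sup0//.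
by rewrite -subset0 => d [x _]; apply: X0; exists x.
Qed.

Lemma dist_C0xx f : dist_C0 f f = 0.
Proof.
apply/eqP; rewrite eq_le dist_C0_ge0 andbT.
by apply: dist_C0_le => // x; rewrite mdistxx.
Qed.

Lemma dist_C0_eq0 f g : dist_C0 f g = 0 -> f = g.
Proof.
move=> fg0; apply: homeo_eq => x; apply: (@mdist_positivity R).
by apply/eqP; rewrite eq_le mdist_ge0 andbT -fg0 dist_C0_fun.
Qed.

Lemma dist_C0_sym f g : dist_C0 f g = dist_C0 g f.
Proof.
by rewrite /dist_C0; congr sup; apply/funext => d /=; apply/propext;
  split=> -[x H]; exists x; rewrite metric_sym [X in _ \/ _ = X]metric_sym.
Qed.

Lemma dist_C0_triangle g f h : dist_C0 f h <= dist_C0 f g + dist_C0 g h.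
Proof.
apply: dist_C0_le => [|x|x]; first by rewrite addr_ge0// dist_C0_ge0.
  by rewrite (le_trans (metric_triangle _ (g x) _))// lerD// dist_C0_fun.
rewrite (le_trans (metric_triangle _ (homeo_inv g x) _))//.
by rewrite lerD// dist_C0_inv.
Qed.

End C0_distance.

HB.instance Definition _ (R : realType) (X : compactMetricType R) :=
  @isMetric.Build R (homeo X) dist_C0 dist_C0xx dist_C0_eq0 dist_C0_sym
    dist_C0_triangle.

Section dynamics.
Context {R : realType} {X : compactMetricType R}.
Implicit Types f g h : homeo X.

Definition homeo_iter f (i : int) : X -> X :=
  match i with
  | Posz n => iter n f
  | Negz n => iter n.+1 (homeo_inv f)
  end.

Definition conjugate f g := exists h, f \o h = h \o g.

Definition conjugacy_class f : set (homeo X) := [set g | conjugate f g].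

Definition pseudo_orbit f (delta : R) (x : int -> X) :=
  forall i : int, mdist (f (x i)) (x (i + 1)) < delta.

Definition shadowing f :=
  forall eps : R, 0 < eps -> exists2 delta : R, 0 < delta &
    forall x : int -> X, pseudo_orbit f delta x ->
      exists y : X, forall i : int, mdist (homeo_iter f i y) (x i) < eps.

End dynamics.

Definition residual (T : topologicalType) (A : set T) :=
  exists B : set T, [/\ Gdelta B, dense B & B `<=` A].

(* The library's instances on R * R carry the sup distance; [plane R] is an
   alias carrying the Euclidean one. *)
Definition plane (R : realType) : Type := (R * R)%type.

HB.instance Definition _ (R : realType) := Choice.on (plane R).

Section plane_metric.
Context {R : realType}.
Implicit Types p q r : plane R.

Definition dist2 p q : R :=
  Num.sqrt ((p.1 - q.1) ^+ 2 + (p.2 - q.2) ^+ 2).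

Lemma dist2xx p : dist2 p p = 0.
Proof. by rewrite /dist2 !subrr expr0n addr0 sqrtr0. Qed.

Lemma dist2_eq0 p q : dist2 p q = 0 -> p = q.
Proof.
move/eqP; rewrite sqrtr_eq0 => h.
have : (p.1 - q.1) ^+ 2 + (p.2 - q.2) ^+ 2 == 0.
  by rewrite eq_le h addr_ge0// sqr_ge0.
rewrite paddr_eq0 ?sqr_ge0// !sqrf_eq0 !subr_eq0.
by case: p q {h} => [a b] [c d] /= /andP[/eqP-> /eqP->].
Qed.

Lemma dist2_sym p q : dist2 p q = dist2 q p.
Proof. by rewrite /dist2 -sqrrN opprB -[X in _ + X]sqrrN opprB. Qed.

Lemma dist2_triangle q p r : dist2 p r <= dist2 p q + dist2 q r.
Proof.
rewrite /dist2.
set a := p.1 - q.1; set b := p.2 - q.2; set c := q.1 - r.1; set d := q.2 - r.2.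
have -> : p.1 - r.1 = a + c by rewrite /a /c; ring.
have -> : p.2 - r.2 = b + d by rewrite /b /d; ring.
have ab0 : 0 <= a ^+ 2 + b ^+ 2 by rewrite addr_ge0// sqr_ge0.
have cd0 : 0 <= c ^+ 2 + d ^+ 2 by rewrite addr_ge0// sqr_ge0.
set u := Num.sqrt (a ^+ 2 + b ^+ 2); set v := Num.sqrt (c ^+ 2 + d ^+ 2).
have u0 : 0 <= u by exact: sqrtr_ge0.
have v0 : 0 <= v by exact: sqrtr_ge0.
have cs : a * c + b * d <= u * v.
  rewrite /u /v -sqrtrM// (le_trans (ler_norm _))// -sqrtr_sqr ler_wsqrtr//.
  have := sqr_ge0 (a * d - b * c); nra.
rewrite -[leRHS]ger0_norm ?addr_ge0// -sqrtr_sqr ler_wsqrtr//.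
rewrite [leRHS]sqrrD !sqr_sqrtr//.
by move: cs; rewrite -mulr_natr; nra.
Qed.

End plane_metric.

HB.instance Definition _ (R : realType) :=
  @isMetric.Build R (plane R) dist2 dist2xx dist2_eq0 dist2_sym dist2_triangle.

Section subspace_metric.
Context {R : realType} {X : metricType R} (A : set X).

Let sub_dist (x y : A) : R := mdist (\val x) (\val y).

Let sub_dist_ge0 x y : 0 <= sub_dist x y.
Proof. exact: mdist_ge0. Qed.

Let sub_dist_eq0 x y : sub_dist x y = 0 -> x = y.
Proof. by move/mdist_positivity/val_inj. Qed.

Let ballE (x : A) (d : R) : ball x d = [set y | sub_dist x y < d].
Proof.
apply/funext => y; have := @ballEmdist R X (\val x) d.
by move=> /(congr1 (fun B => B (\val y))).
Qed.

HB.instance Definition _ :=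
  @PseudoMetric_isMetric.Build R (set_type A) sub_dist
    sub_dist_ge0 sub_dist_eq0 ballE.

End subspace_metric.

Lemma compact_set_type (X : topologicalType) (A : set X) :
  compact A -> compact [set: A].
Proof.
move=> cA F FF _.
have [|p [Ap cp]] := cA (fmap (\val : A -> X) F) _.
  by apply: (@filterS _ F _ setT) filterT => x _; exact: set_mem (valP x).
exists (exist _ p (mem_set Ap)); split => // B U FB.
move=> [_ [[W oW <-] /= Wp] WU].
have [||q [[x Bx <-] Wx]] := cp (\val @` B) W.
- by apply: (@filterS _ F _ B) FB => x Bx; exists x.
- by move: oW; rewrite openE; exact.
by exists x; split=> //; exact: WU.
Qed.

Section example_space.
Variable R : realType.

Definition arc : set (plane R) :=
  [set p | p.1 ^+ 2 + p.2 ^+ 2 = 1 /\ p.2 <= 0].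

Definition base : set (plane R) := `[-1, 1] `*` [set 0].

Definition tooth (n : nat) : set (plane R) :=
  [set -1 + 2 / n%:R] `*` `[0, 1 / n%:R].

Definition Yset : set (plane R) :=
  arc `|` base `|` \bigcup_(n in [set n | (1 <= n)%N]) tooth n.

Let box (N : nat) : set (R * R) := `[-1, 1] `*` `[0, N.+1%:R^-1].

Let YsetE : (Yset : set (R * R)) =
  \bigcap_N (arc `|` base `|`
    \bigcup_(n in [set n | (1 <= n <= N)%N]) tooth n `|` box N).
Proof.
apply/seteqP; split => [p [abp|[n n1 tp]] N _|p Yp].
- by do 2 left.
- have [nN|Nn] := leqP n N; first by left; right; exists n => //=; rewrite n1.
  right; case: tp => /= pE; rewrite in_itv/= => /andP[p0 p1].
  have n0 : 0 < n%:R :> R by rewrite ltr0n.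
  have n1' : n%:R^-1 <= 1 :> R by rewrite invf_le1// ler1n.
  have i0 : 0 <= n%:R^-1 :> R by rewrite invr_ge0 ltW.
  split; rewrite /= in_itv/=; first by rewrite pE; apply/andP; split; lra.
  rewrite p0 (le_trans p1)// div1r lef_pV2 ?posrE ?ltr0n//.
  by rewrite ler_nat.
have [Yp'|nYp] := pselect (Yset p) => //.
have bp N : box N p.
  have [[abp|[n /andP[n1 _] tp]]|//] := Yp N I; exfalso; apply: nYp.
    by left.
  by right; exists n.
left; right; have := bp 0%N => -[p1]; rewrite /= in_itv/= => /andP[p0 _].
split => //=; apply/eqP; rewrite eq_le p0 andbT.
apply/ler_addgt0Pl => e e0; rewrite addr0.
have [N] := ltr_add_invr e0; rewrite add0r => Ne.
by have [_] := bp N; rewrite /= in_itv/= => /andP[_ /le_trans]; apply; exact: ltW.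
Qed.

Let closed_arc : closed (arc : set (R * R)).
Proof.
apply: closedI.
  apply: (@preimage_closed _ _ (fun p : R * R => p.1 ^+ 2 + p.2 ^+ 2) [set 1]).
    by move=> p _; apply: cvgD; apply: cvgM; (exact: cvg_fst || exact: cvg_snd).
  exact: closed_eq.
apply: (@preimage_closed _ _ snd [set x : R | x <= 0]); last exact: closed_le.
by move=> p _; exact: cvg_snd.
Qed.

Let closed_setX (A B : set R) : closed A -> closed B -> closed (A `*` B).
Proof.
move=> cA cB; apply: closedI.
  by apply: (@preimage_closed _ _ (@fst R R) A) => // p _; exact: cvg_fst.
by apply: (@preimage_closed _ _ (@snd R R) B) => // p _; exact: cvg_snd.
Qed.

Let compact_Yset' : compact (Yset : set (R * R)).
Proof.
pose B : set (R * R) := `[-1, 1] `*` `[-1, 1].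
apply: (@subclosed_compact (R * R)%type Yset B).
- rewrite YsetE; apply: closed_bigI => N _.
  apply: closedU; last by apply: closed_setX; exact: itv_closed.
  apply: closedU.
    apply: closedU; first exact: closed_arc.
    by apply: closed_setX; [exact: itv_closed|exact: closed_eq].
  apply: closed_bigcup.
    by apply: (sub_finite_set _ (finite_II N.+1)) => n /= /andP[].
  move=> n _; apply: closed_setX; [exact: closed_eq|exact: itv_closed].
- by apply: compact_setX; exact: segment_compact.
move=> [x y] [[[/= xy1 y0]|[/= x1 ->]]|[n n1 [/= ->]]]; rewrite /B /= !in_itv/=.
- by split; apply/andP; split; nra.
- by split => //; rewrite lerN10 ler01.
have n0 : 0 < n%:R :> R by rewrite ltr0n.
have n1' : n%:R^-1 <= 1 :> R by rewrite invf_le1// ler1n.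
have i0 : 0 <= n%:R^-1 :> R by rewrite invr_ge0 ltW.
by move=> /andP[y0 yn]; split; apply/andP; split; lra.
Qed.

Lemma compact_Yset : compact Yset.
Proof.
rewrite -(image_id Yset).
apply: (@continuous_compact (R * R)%type (plane R) id) compact_Yset'.
apply: continuous_subspaceT => p; apply/cvgrPdist_lt => e e0.
have e2 : 0 < e / 2 by rewrite divr_gt0.
have pe : nbhs (p : R * R) (ball (p : R * R) (e / 2)).
  exact: (@nbhsx_ballx R (R * R)%type p (e / 2) e2).
apply: filterS pe => q [q1 q2]; rewrite /ball/= in q1 q2.
change (dist2 p q < e).
rewrite /dist2 -[ltRHS]gtr0_norm// -sqrtr_sqr ltr_sqrt ?exprn_gt0//.
by rewrite -[X in X + _]real_normK ?num_real// -[X in _ + X]real_normK ?num_real//;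
  have := normr_ge0 (p.1 - q.1); have := normr_ge0 (p.2 - q.2); nra.
Qed.

Definition Y : Type := Yset.

HB.instance Definition _ := Metric.on Y.
HB.instance Definition _ :=
  Metric_isCompact.Build R Y (compact_set_type compact_Yset).

End example_space.

(* Main.v *)
Require Import Defs.
From mathcomp Require Import all_boot all_order all_algebra.
From mathcomp Require Import all_classical all_reals all_analysis.
From mathcomp Require Import borel_hierarchy.
From mathcomp Require Import ring lra zify.

Set Implicit Arguments.
Unset Strict Implicit.
Unset Printing Implicit Defensive.

Import Order.TTheory GRing.Theory Num.Theory.
Import numFieldNormedType.Exports.
Import metricType_numDomainType.

Local Open Scope classical_set_scope.
Local Open Scope ring_scope.

(** A homeomorphism of Y permutes the points where three arcs meet, because a
    triod does not embed in the line; these points accumulate only at (-1, 0),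
    so they are all fixed and each arc between them is mapped to itself.  A
    homeomorphism of Y is thus an arbitrary family of increasing homeomorphisms
    of [0, 1], one for each arc.  The generic class consists of the families in
    which the displacement changes sign arbitrarily close to every fixed point,
    with the pattern + - + -.  This is a countable intersection of open
    conditions; it is dense because a map whose displacement has a
    Cantor-like sign pattern, but the sign of [F - id] where [F] is far from the
    identity, can be clamped between [F - eta] and [F + eta]; and two members
    are conjugate by a back-and-forth construction on orbits.  For such a
    homeomorphism every fixed point has a small closed neighborhood that is
    mapped into its own interior by the map or by its inverse, and every orbit
    converges to a fixed point, whence shadowing: up to uniformly bounded time
    a pseudo-orbit stays in one such repelling neighborhood and ends up in an
    attracting one. *)

(** * Increasing homeomorphisms of the interval *)

(** A conjugacy can be read off from moved points alone: they are dense, so the fixed sets, which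
    may be wild, are never matched directly. A finite partial conjugacy records the order of
    complete orbits, and a new point outside the range of all known orbits must be sent between two
    of them with a prescribed sign of displacement. Near a fixed point, consecutive signs + - form a
    wall: an orbit starting below the + stays below the -, in both time directions, and
    symmetrically from above. One wall on each side gives + - + -, and the two inner points supply
    one target for each sign; hence the length four. At an end of an edge both signs occur
    arbitrarily close on the inner side, so the end can always be made attracting. This is what
    makes vertices tractable: all edges that meet at a vertex must push in the same direction at
    once. Inside an edge, one side of a fixed point may carry a single sign, which then decides
    between attraction and repulsion. *)

Section interval_homeo.
Context {R : realType}.

(* Increasing homeomorphisms of [0, 1], extended by the identity to the line. *)
Record uhomeo := Uhomeo {
  ufun :> R -> R;
  uinv : R -> R;
  ufunK : cancel ufun uinv;
  uinvK : cancel uinv ufun;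
  ufun_homo : {homo ufun : x y / x < y};
  ufun_out : forall t, t <= 0 \/ 1 <= t -> ufun t = t
}.

Implicit Types (F G H : uhomeo).

Lemma ltu F : {mono F : x y / x < y}.
Proof. by apply: leW_mono; apply: le_mono; exact: ufun_homo. Qed.

Lemma leu F : {mono F : x y / x <= y}.
Proof. by apply: le_mono; exact: ufun_homo. Qed.

Lemma uinv_homo F : {homo uinv F : x y / x < y}.
Proof. by move=> x y; rewrite -{1}(uinvK F x) -{1}(uinvK F y) ltu. Qed.

Lemma uinv_out F t : t <= 0 \/ 1 <= t -> uinv F t = t.
Proof. by move=> /(ufun_out F) {1}<-; rewrite ufunK. Qed.

Definition uV F : uhomeo :=
  Uhomeo (uinvK F) (ufunK F) (@uinv_homo F) (@uinv_out F).

Definition uid : uhomeo :=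
  @Uhomeo id id (fun=> erefl) (fun=> erefl) (fun _ _ => id) (fun _ _ => erefl).

Lemma u0 F : F 0 = 0. Proof. by apply: ufun_out; left. Qed.

Lemma u1 F : F 1 = 1. Proof. by apply: ufun_out; right. Qed.

Lemma u_itv F t : (0 <= F t <= 1) = (0 <= t <= 1).
Proof. by rewrite -{1}(u0 F) -{1}(u1 F) !leu. Qed.

Lemma u_in F t : F t != t -> 0 < t < 1.
Proof.
by apply: contraNT; rewrite negb_and -!leNgt => /orP Ft; apply/eqP/ufun_out.
Qed.

Lemma u_up_in F t : t < F t -> 0 < t < 1.
Proof. by move=> tF; apply: (@u_in F); rewrite neq_lt tF orbT. Qed.

Lemma u_down_in F t : F t < t -> 0 < t < 1.
Proof. by move=> tF; apply: (@u_in F); rewrite neq_lt tF. Qed.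

Lemma ltuV F x y : (x < uinv F y) = (F x < y).
Proof. by rewrite -(ltu F) uinvK. Qed.

Lemma ltVu F x y : (uinv F x < y) = (x < F y).
Proof. by rewrite -(ltu F) uinvK. Qed.

Definition zit F (n : int) (x : R) : R :=
  match n with
  | Posz n => iter n F x
  | Negz n => iter n.+1 (uinv F) x
  end.

Lemma zitS F n x : zit F (n + 1) x = F (zit F n x).
Proof.
case: n => n; first by rewrite -PoszD addn1.
case: n => [|n]; first by rewrite /= uinvK.
by rewrite (_ : Negz n.+1 + 1 = Negz n) ?NegzE//= ?uinvK//; lia.
Qed.

Lemma zitP F n x : zit F (n - 1) x = uinv F (zit F n x).
Proof. by rewrite -[in RHS](subrK 1 n) zitS ufunK. Qed.

Lemma zitV F n x : zit (uV F) n x = zit F (- n) x.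
Proof.
by case: n => [[|n]|n].
Qed.

Lemma zitD F m n x : zit F (m + n) x = zit F m (zit F n x).
Proof.
elim: m => [|m IH|m IH]; first by rewrite add0r.
  by rewrite -addn1 PoszD addrAC !zitS IH.
by rewrite -addn1 PoszD opprD addrAC !zitP IH.
Qed.

Lemma ltzit F n : {mono zit F n : x y / x < y}.
Proof.
elim: n => [|n IH|n IH] x y //.
  by rewrite -addn1 PoszD !zitS ltu IH.
by rewrite -addn1 PoszD opprD !zitP (ltu (uV F)) IH.
Qed.

Lemma zitNlt F n x y : (zit F n x < y) = (x < zit F (- n) y).
Proof. by rewrite -(ltzit F n x) -zitD subrr. Qed.

Lemma zit_up F x m n : x < F x -> (zit F m x < zit F n x) = (m < n).
Proof.
move=> xF; have H (k : nat) p : zit F p x < zit F (p + k.+1%:Z) x.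
  rewrite zitD ltzit; elim: k => //= k IH.
  by rewrite (lt_trans xF)// ltu.
have W p q : p < q -> zit F p x < zit F q x.
  by move=> pq; rewrite (_ : q = p + (`|(q - p)%R|.-1).+1%:Z) ?H//; lia.
apply/idP/idP; last exact: W.
by apply: contraTT; rewrite -!leNgt le_eqVlt => /orP[/eqP->//|/W/ltW].
Qed.

(** The four points lie in (0, 1) automatically, because maps are the identity elsewhere. The
    condition therefore makes sense at [p = 0] and [p = 1], where it is one-sided. *)
Definition osc_near F (p eta : R) := exists z1 z2 z3 z4,
  [/\ p - eta < z1, z1 < z2, z2 < z3, z3 < z4 & z4 < p + eta] /\
  [/\ z1 < F z1, F z2 < z2, z3 < F z3 & F z4 < z4].

(* Oscillation at every fixed point characterizes the generic conjugacy class. *)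
Definition osc F := forall p, 0 <= p <= 1 -> F p = p ->
  forall eta, 0 < eta -> osc_near F p eta.

End interval_homeo.
Arguments uhomeo R : clear implicits.

(** * Conjugacy of oscillating interval homeomorphisms *)

Section back_and_forth.
Context {R : realType}.
Implicit Types (F G H : uhomeo R) (s : seq (R * R)).

(** An increasing orbit that stayed below [y] would have its supremum in [x, y], and this supremum
    would be a fixed point. *)
Lemma reach F x y : x < F x -> (forall z, x <= z <= y -> F z != z) ->
  exists n : nat, y < zit F n x.
Proof.
move=> xF nfix; apply: contrapT => /forallNP H.
have {}H n : zit F (Posz n) x <= y by rewrite leNgt; exact/negP/H.
pose A := range (fun n : nat => zit F n x).
have supA : has_sup A.
  by split; [exists x, 0%N|exists y => _ [n _ <-]].
have up n : zit F (Posz n) x <= sup A by apply: sup_upper_bound => //; exists n.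
have xs : x <= sup A := up 0%N.
have sy : sup A <= y by apply: ge_sup => [|_ [n _ <-] //]; exists x, 0%N.
have := nfix (sup A); rewrite xs sy => /(_ isT); rewrite neq_lt => /orP[].
  move=> /sup_gt[|_ [n _ <-]]; first by exists x, 0%N.
  rewrite ltNge => /negP; apply; rewrite (le_trans _ (_ : F (zit F n x) <= _))//.
    by rewrite -zitS [leLHS]/= -[leLHS]/(zit F n x) ltW// zit_up// ltrDl.
  by rewrite leu.
rewrite -ltVu => /sup_gt[|_ [n _ <-]]; first by exists x, 0%N.
by rewrite ltVu -zitS -PoszD addn1 ltNge up.
Qed.

Lemma u_neqV F x : (uV F x != x) = (F x != x).
Proof. by rewrite -(inj_eq (can_inj (ufunK F))) /= uinvK eq_sym. Qed.

(* [s] is a finite partial conjugacy: the [F]-orbits of the first components are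
   ordered like the [G]-orbits of the second ones. *)
Definition good F G s := (forall p, p \in s -> F p.1 != p.1) /\
  forall p q, p \in s -> q \in s -> forall n,
    (p.1 < zit F n q.1) = (p.2 < zit G n q.2).

Lemma good_zit F G s p q m n : good F G s -> p \in s -> q \in s ->
  (zit F m p.1 < zit F n q.1) = (zit G m p.2 < zit G n q.2).
Proof. by move=> [_ gs] ps qs; rewrite !zitNlt -!zitD gs. Qed.

(** Reversing time reduces points that are moved down to points that are moved up. *)
Lemma good_V F G s : good F G s -> good (uV F) (uV G) s.
Proof.
move=> [nf gs]; split=> [p ps|p q ps qs n]; first by rewrite u_neqV nf.
by rewrite !zitV gs.
Qed.

Lemma good_up F G s p : good F G s -> p \in s -> (p.1 < F p.1) = (p.2 < G p.2).
Proof. by move=> [_ gs] ps; have := gs p p ps ps 1. Qed.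

Lemma good_down F G s p : good F G s -> p \in s ->
  (F p.1 < p.1) = (G p.2 < p.2).
Proof.
by move=> [_ gs] ps; have := gs p p ps ps (-1); rewrite /= !ltuV.
Qed.

Lemma good_neq F G s p : good F G s -> p \in s -> G p.2 != p.2.
Proof.
move=> gs ps; have := gs.1 _ ps; rewrite !neq_lt.
by rewrite (good_up gs ps) (good_down gs ps).
Qed.

Definition swap_pair (p : R * R) := (p.2, p.1).

(** By this symmetry, the back step of the back-and-forth is the forth step with the two maps
    exchanged. *)
Lemma good_swap F G s : good F G s -> good G F (map swap_pair s).
Proof.
move=> gs; split=> [_ /mapP[p ps ->]|_ _ /mapP[p ps ->] /mapP[q qs ->] n] /=.
  exact: good_neq gs ps.
by rewrite gs.2.
Qed.

Lemma zit_up0 F n x : x < F x -> (x < zit F n x) = (0 < n).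
Proof. exact: (@zit_up _ F x 0 n). Qed.

Lemma zit_up_le F x m n : x < F x -> (zit F m x <= zit F n x) = (m <= n).
Proof. by move=> xF; rewrite !leNgt zit_up. Qed.

(** The orbit of a moved point is strictly monotone in time, so the sign of the displacement is the
    only order invariant of a single orbit. *)
Lemma zit_color F G x y : F x != x ->
  (x < F x) = (y < G y) -> (F x < x) = (G y < y) ->
  forall n, (x < zit F n x) = (y < zit G n y).
Proof.
rewrite neq_lt orbC => /orP[xF|xF] up dn n.
  have yG : y < G y by rewrite -up.
  by rewrite !zit_up0.
have yG : y < uV G y by rewrite /= ltuV -dn.
have xF' : x < uV F x by rewrite /= ltuV.
rewrite -(opprK n) -(zitV F) -(zitV G).
by rewrite !zit_up0.
Qed.

Lemma good_cons F G s x y : good F G s -> F x != x ->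
  (x < F x) = (y < G y) -> (F x < x) = (G y < y) ->
  (forall p n, p \in s -> (x < zit F n p.1) = (y < zit G n p.2)) ->
  (forall p n, p \in s -> (zit F n p.1 < x) = (zit G n p.2 < y)) ->
  good F G ((x, y) :: s).
Proof.
move=> gs Fx up dn lt gt; split=> [p|p q].
  by rewrite inE => /predU1P[->//|/gs.1].
rewrite !inE => /predU1P[->|ps] /predU1P[->|qs] n /=.
- exact: zit_color.
- exact: lt.
- by rewrite -[n]opprK -!zitNlt; exact: gt.
- exact: gs.2.
Qed.

Lemma seq_bound (T : eqType) (s : seq T) (A : set R) (r : rel R)
    (P : T -> set R) : transitive r -> reflexive r -> total r -> A !=set0 ->
  (forall p, p \in s -> exists2 l, A l & forall z, P p z -> r z l) ->
  exists2 l, A l & forall p z, p \in s -> P p z -> r z l.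
Proof.
move=> tr rr tot [l0 Al0]; elim: s => [|p s IH] H; first by exists l0.
have [q qs|l Al ls] := IH; first by apply: H; rewrite inE qs orbT.
have [l' Al' l's] := H p (mem_head _ _).
case/orP: (tot l l') => ll'; [exists l'|exists l] => // q z.
  rewrite inE => /predU1P[->|qs]; first exact: l's.
  by move=> /ls-/(_ qs)/tr; exact.
rewrite inE => /predU1P[->|qs]; last exact: ls.
by move=> /l's/tr; exact.
Qed.

Lemma int_crossing (P : pred int) (n : nat) i :
  ~~ P i -> P (i + n%:Z) -> exists m, ~~ P m /\ P (m + 1).
Proof.
elim: n => [|n IH] in i *; first by rewrite addr0 => /negP.
have [Pi1 Pi _|Pi1 _] := boolP (P (i + 1)); first by exists i.
by rewrite -addn1 PoszD [n%:Z + 1]addrC addrA => /(IH _ Pi1).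
Qed.

(* The case where the new point [x] lies in the component of [F x != x] of a
   point already in the list. *)
Lemma good_extend_same F G s x q i j : good F G s -> q \in s -> F x != x ->
  q.1 < F q.1 -> zit F i q.1 <= x -> x < zit F j q.1 ->
  exists y, good F G ((x, y) :: s).
Proof.
move=> gs qs Fx qF ix xj.
(* If [x] already lies on a listed orbit, its image is forced. *)
have [[[p n] /= [ps px]]|nhit] :=
    pselect (exists pn : R * R * int, pn.1 \in s /\ zit F pn.2 pn.1.1 = x).
  exists (zit G n p.2).
  have xS : F x = zit F (n + 1) p.1 by rewrite zitS px.
  apply: good_cons => //.
  - by rewrite xS -px -zitS (good_zit _ _ gs ps ps).
  - by rewrite xS -px -zitS (good_zit _ _ gs ps ps).
  - by move=> p' n' p's; rewrite -px (good_zit _ _ gs ps p's).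
  - by move=> p' n' p's; rewrite -px (good_zit _ _ gs p's ps).
have {}nhit p n : p \in s -> zit F n p.1 != x.
  by move=> ps; apply/eqP => e; apply: nhit; exists (p, n).
(* [x] lies in a fundamental domain of the orbit of [q], which makes both [L] and [U] below
   nonempty. *)
have [m [qm qm1]] : exists m, ~~ (x < zit F m q.1) /\ x < zit F (m + 1) q.1.
  apply: (@int_crossing (fun m => x < zit F m q.1) `|(j - i)%R| i).
    by rewrite -leNgt.
  have : i < j by rewrite -(zit_up _ _ qF) (le_lt_trans ix).
  by move=> ij; rewrite (_ : i + _ = j)//; lia.
rewrite -leNgt le_eqVlt (negPf (nhit _ _ qs))/= in qm.
pose L := [set l | exists p n, [/\ p \in s, zit F n p.1 < x & l = zit G n p.2]].
pose U := [set l | exists p n, [/\ p \in s, x < zit F n p.1 & l = zit G n p.2]].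
have upn (p : R * R) n : zit F n p.1 < x -> x < zit F (n + 1) p.1 -> p.1 < F p.1.
  by move=> nx xn; rewrite -(ltzit F n) -[F p.1]/(zit F 1 p.1) -zitD (lt_trans nx).
(* [L] has a greatest element: an orbit with a point between [zit F m q.1] and [x] is increasing and
   has a last point before [x], while the points below [x] of any other orbit are all below
   [zit F m q.1]. The least element of [U] is found in the same way. *)
have [l [pl [nl [pls lx ->]]] lP] : exists2 l, L l & forall p z, p \in s ->
    (exists2 n, zit F n p.1 < x & z = zit G n p.2) -> z <= l.
  apply: (@seq_bound _ _ _ <=%R (fun p z => exists2 n, zit F n p.1 < x & z = zit G n p.2)).
  - exact: le_trans.
  - exact: lexx.
  - exact: le_total.
  - by exists (zit G m q.2), q, m.
  move=> p ps.
  have [[n [nx mn]]|hn] := pselect (exists n, zit F n p.1 < x /\ zit F m q.1 <= zit F n p.1).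
    exists (zit G n p.2); first by exists p, n.
    move=> _ [n' n'x ->].
    have xn : x < zit F (n + 1) p.1.
      by rewrite (lt_le_trans qm1)// !zitS leu.
    have pF := upn p n nx xn.
    have : n' < n + 1 by rewrite -(zit_up _ _ pF) (lt_trans n'x).
    rewrite (good_up gs ps) in pF.
    by rewrite ltzD1 zit_up_le.
  exists (zit G m q.2); first by exists q, m.
  move=> _ [n' n'x ->]; rewrite ltW// -(good_zit _ _ gs ps qs) ltNge.
  by apply/negP => mn; apply: hn; exists n'.
have [u [pu [nu [pus xu ->]]] uP] : exists2 l, U l & forall p z, p \in s ->
    (exists2 n, x < zit F n p.1 & z = zit G n p.2) -> l <= z.
  apply: (@seq_bound _ _ _ >=%R (fun p z => exists2 n, x < zit F n p.1 & z = zit G n p.2)).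
  - by move=> a b c /= ba ac; exact: le_trans ba.
  - exact: lexx.
  - by move=> a b /=; exact: le_total.
  - by exists (zit G (m + 1) q.2), q, (m + 1).
  move=> p ps.
  have [[n [nx mn]]|hn] := pselect (exists n, x < zit F n p.1 /\ zit F n p.1 <= zit F (m + 1) q.1).
    exists (zit G n p.2); first by exists p, n.
    move=> _ [n' n'x ->] /=.
    have xn : zit F (n - 1) p.1 < x.
      by rewrite (le_lt_trans _ qm)// -(leu F) -!zitS subrK.
    have pF : p.1 < F p.1 by apply: (upn p _ xn); rewrite subrK.
    have : n - 1 < n' by rewrite -(zit_up _ _ pF) (lt_trans xn).
    rewrite (good_up gs ps) in pF.
    by rewrite ltrBlDr ltzD1 /= zit_up_le.
  exists (zit G (m + 1) q.2); first by exists q, (m + 1).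
  move=> _ [n' n'x ->] /=; rewrite ltW// -(good_zit _ _ gs qs ps) ltNge.
  by apply/negP => mn; apply: hn; exists n'.
have lu : zit G nl pl.2 < zit G nu pu.2.
  by rewrite -(good_zit _ _ gs pls pus) (lt_trans lx).
(* No image of a listed orbit point lies strictly between these two values, so any point of the gap
   would do. *)
pose y := (zit G nl pl.2 + zit G nu pu.2) / 2.
have [ly yu] : zit G nl pl.2 < y /\ y < zit G nu pu.2 by rewrite /y; split; lra.
have xy p n : p \in s -> (x < zit F n p.1) = (y < zit G n p.2).
  move=> ps; have := nhit p n ps; rewrite neq_lt => /orP[nx|nx].
    rewrite ltNge (ltW nx)/=; apply/esym/negbTE; rewrite -leNgt.
    by apply: le_trans (ltW ly); apply: lP ps _; exists n.
  by rewrite nx (lt_le_trans yu)//; apply: uP ps _; exists n.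
have yx p n : p \in s -> (zit F n p.1 < x) = (zit G n p.2 < y).
  move=> ps; have := nhit p n ps; rewrite neq_lt => /orP[nx|nx].
    by rewrite nx (le_lt_trans _ ly)//; apply: lP ps _; exists n.
  rewrite ltNge (ltW nx)/=; apply/esym/negbTE; rewrite -leNgt.
  by apply: le_trans (ltW yu) _; apply: uP ps _; exists n.
have xF : x < F x by rewrite (lt_le_trans qm1)// zitS leu ltW.
have yG : y < G y.
  rewrite (@lt_le_trans _ _ (zit G (m + 1) q.2)) -?xy//.
  by rewrite zitS leu ltW// -yx.
exists y; apply: good_cons => //; first by rewrite xF yG.
by rewrite !ltNge (ltW xF) (ltW yG).
Qed.

(** Outside the range of the listed orbits, each of these lies entirely on one side of [x]. Their
    images leave a gap that contains a fixed point of [G], and the oscillation there offers a place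
    protected from both sides. *)
Lemma good_extend F G s x : osc G -> good F G s -> F x != x ->
  exists y, good F G ((x, y) :: s).
Proof.
move=> oscG gs Fx.
have [[q [i [j [qs ix xj]]]]|nin] := pselect
    (exists q i j, [/\ q \in s, zit F i q.1 <= x & x <= zit F j q.1]).
  have := gs.1 q qs; rewrite neq_lt => /orP[qF|qF].
    have qF' : q.1 < uV F q.1 by rewrite /= ltuV.
    have [y yg] : exists y, good (uV F) (uV G) ((x, y) :: s).
      apply: (@good_extend_same _ _ _ _ q (- i) (- j + 1)) => //.
      - exact: good_V.
      - by rewrite u_neqV.
      - by rewrite zitV opprK.
      - by rewrite (le_lt_trans xj)// -[j in ltLHS]opprK -zitV zit_up ?ltrDl.
    by exists y; exact: (good_V yg).
  apply: (@good_extend_same _ _ _ _ q i (j + 1)) => //.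
  by rewrite (le_lt_trans xj)// zit_up// ltrDl.
have side p n : p \in s -> (zit F n p.1 < x) = (p.1 < x).
  move=> ps; apply/idP/idP => h; rewrite ltNge; apply/negP => h'; apply: nin.
    by exists p, n, 0; split=> //; exact: ltW.
  by exists p, 0, n; split=> //; exact: ltW.
have side' p n : p \in s -> (x < zit F n p.1) = (x < p.1).
  move=> ps; apply/idP/idP => h; rewrite ltNge; apply/negP => h'; apply: nin.
    by exists p, 0, n; split=> //; exact: ltW.
  by exists p, n, 0; split=> //; exact: ltW.
have neq p : p \in s -> p.1 != x.
  by move=> ps; apply/eqP => e; apply: nin; exists p, 0, 0; rewrite /= e; split.
have yin p : p \in s -> 0 < p.2 < 1 by move=> /(good_neq gs)/u_in.
have [a aA aP] : exists2 a, a = 0 \/ exists p, [/\ p \in s, p.1 < x & a = p.2] &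
    forall p z, p \in s -> p.1 < x /\ z = p.2 -> z <= a.
  apply: (@seq_bound _ _ (fun a => a = 0 \/ exists p, [/\ p \in s, p.1 < x & a = p.2])
    <=%R (fun p z => p.1 < x /\ z = p.2)).
  - exact: le_trans.
  - exact: lexx.
  - exact: le_total.
  - by exists 0; left.
  move=> p ps; have [px|xp] := ltP p.1 x.
    by exists p.2; [right; exists p|move=> _ [_ ->]].
  by exists 0; [left|move=> t []].
have [b bA bP] : exists2 a, a = 1 \/ exists p, [/\ p \in s, x < p.1 & a = p.2] &
    forall p z, p \in s -> x < p.1 /\ z = p.2 -> a <= z.
  apply: (@seq_bound _ _ (fun a => a = 1 \/ exists p, [/\ p \in s, x < p.1 & a = p.2])
    >=%R (fun p z => x < p.1 /\ z = p.2)).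
  - by move=> ? ? ? /= ba ac; exact: le_trans ba.
  - exact: lexx.
  - by move=> ? ? /=; exact: le_total.
  - by exists 1; left.
  move=> p ps; have [px|xp] := ltP x p.1.
    by exists p.2; [right; exists p|move=> _ [_ ->]; exact: lexx].
  by exists 1; [left|move=> t []].
(* Without a fixed point in the gap, [reach] would carry the orbit of the left image, forward or
   backward, past the right image, whereas the orbits of the two preimages are separated by [x]. *)
have [c /andP[ac cb] Gc] : exists2 c, a <= c <= b & G c = c.
  case: aA => [->|[p [ps px ->]]].
    exists 0; rewrite ?u0// lexx/=.
    by case: bA => [->//|[p [/yin/andP[/ltW ? _] _ ->]]].
  case: bA => [->|[p' [p's xp' ->]]].
    by exists 1; rewrite ?u1// lexx andbT; have /andP[_ /ltW] := yin _ ps.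
  apply: contrapT => nfix.
  have {}nfix z : p.2 <= z <= p'.2 -> G z != z.
    by move=> zi; apply/eqP => Gz; apply: nfix; exists z.
  have below n : zit G n p.2 <= p'.2.
    rewrite ltW// -[p'.2]/(zit G 0 p'.2) -(good_zit _ _ gs ps p's) /=.
    by rewrite (lt_trans _ xp')// side.
  have := good_neq gs ps; rewrite neq_lt => /orP[pG|pG].
    have [||n] := @reach (uV G) p.2 p'.2; first by rewrite /= ltuV.
      by move=> t /nfix; rewrite u_neqV.
    by rewrite zitV ltNge below.
  have [n] := reach pG nfix.
  by rewrite ltNge below.
(* When [a = 0] or [b = 1] there is no image on that side and [c] may equal the bound. The radius is
   then arbitrary, since the oscillation points lie in (0, 1) anyway. *)
pose eta := Num.min (if a == 0 then 1 else c - a) (if b == 1 then 1 else b - c).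
have eta0 : 0 < eta.
  rewrite /eta lt_min; apply/andP; split.
    case: eqP => // a0; rewrite subr_gt0 lt_neqAle ac andbT.
    case: aA => // -[p [ps _ ap]]; apply/eqP => acE.
    by have := good_neq gs ps; rewrite -ap acE Gc eqxx.
  case: eqP => // b1; rewrite subr_gt0 lt_neqAle cb andbT.
  case: bA => // -[p [ps _ bp]]; apply/eqP => bcE.
  by have := good_neq gs ps; rewrite -bp -bcE Gc eqxx.
have c01 : 0 <= c <= 1.
  apply/andP; split.
    by rewrite (le_trans _ ac)//; case: aA => [->//|[p [/yin/andP[/ltW ? _] _ ->]]].
  by rewrite (le_trans cb)//; case: bA => [->//|[p [/yin/andP[_ /ltW ?] _ ->]]].
have [z1 [z2 [z3 [z4 [[cz1 z12 z23 z34 z4c] [G1 G2 G3 G4]]]]]] :=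
  oscG c c01 Gc eta eta0.
have az1 : a < z1.
  have [a0|a0] := eqVneq a 0.
    by rewrite a0; have /andP[] := u_up_in G1.
  rewrite (le_lt_trans _ cz1)// lerBrDl -lerBrDr.
  by rewrite /eta (negPf a0) ge_min lexx.
have z4b : z4 < b.
  have [b1|b1] := eqVneq b 1.
    by rewrite b1; have /andP[] := u_down_in G4.
  rewrite (lt_le_trans z4c)// -lerBrDl.
  by rewrite /eta (negPf b1) ge_min lexx orbT.
(* Forward iterates are blocked by [z2], which moves down, and backward iterates by [z1], which
   moves up. *)
have low p n : p \in s -> p.1 < x -> zit G n p.2 < z2.
  move=> ps px; have pz1 : p.2 < z1 by apply: le_lt_trans (aP p _ ps _) az1.
  case: n => n.
    elim: n => [|n IH]; first exact: lt_trans pz1 z12.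
    by rewrite /= (lt_trans _ G2)// ltu.
  rewrite (lt_trans _ z12)//; elim: n => [|n IH] /=.
    by rewrite ltVu (lt_trans pz1).
  by rewrite ltVu (lt_trans IH).
have high p n : p \in s -> x < p.1 -> z3 < zit G n p.2.
  move=> ps px; have pz4 : z4 < p.2 by apply: lt_le_trans z4b (bP p _ ps _).
  case: n => n.
    elim: n => [|n IH]; first exact: lt_trans z34 pz4.
    by rewrite /= (lt_trans G3)// ltu.
  rewrite (lt_trans z34)//; elim: n => [|n IH] /=.
    by rewrite ltuV (lt_trans _ pz4).
  by rewrite ltuV (lt_trans _ IH).
(* [z3] moves up and [z2] moves down, so the image can be given the sign of the displacement at
   [x]. *)
exists (if x < F x then z3 else z2).
apply: good_cons => //.
- by case: ifP => xF; rewrite ?G3// (lt_gtF G2).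
- case: ifP => xF; first by rewrite (lt_gtF xF) (lt_gtF G3).
  by move: Fx; rewrite neq_lt xF orbF => ->; rewrite G2.
- move=> p n ps; rewrite side'//; have := neq _ ps; rewrite neq_lt => /orP[px|px].
    rewrite (lt_gtF px); apply/esym/lt_gtF; case: ifP => _; last exact: low.
    by rewrite (lt_trans _ z23)//; exact: low.
  rewrite px; apply/esym; case: ifP => _; first exact: high.
  by rewrite (lt_trans z23)//; exact: high.
- move=> p n ps; rewrite side//; have := neq _ ps; rewrite neq_lt => /orP[px|px].
    rewrite px; apply/esym; case: ifP => _; last exact: low.
    by rewrite (lt_trans _ z23)//; exact: low.
  rewrite (lt_gtF px); apply/esym/lt_gtF; case: ifP => _; first exact: high.
  by rewrite (lt_trans z23)//; exact: high.
Qed.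

End back_and_forth.

(** * Extending a dense order-preserving relation to a conjugacy *)

Section conjugacy.
Context {R : realType}.
Implicit Types (F G H : uhomeo R) (P : R -> R -> Prop).

Section monotone_extension.
Variable P : R -> R -> Prop.
Hypothesis P_mono : forall x y x' y', P x y -> P x' y' -> (x < x') = (y < y').
Hypothesis P_dom : forall a b, a < b -> exists x y, P x y /\ a < x < b.

(** Density of the domain of [P] on both sides of [x] makes this set nonempty and bounded, so [sup]
    never takes its default value. *)
Definition mext x := sup [set y | exists2 x', x' <= x & P x' y].

Lemma mext_has_sup x : has_sup [set y | exists2 x', x' <= x & P x' y].
Proof.
split.
  have [|x' [y [Pxy /andP[_ /ltW x'x]]]] := @P_dom (x - 1) x.
    by rewrite ltrBlDr ltrDl.
  by exists y, x'.
have [|x' [y [Pxy /andP[xx' _]]]] := @P_dom x (x + 1); first by rewrite ltrDl.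
exists y => t [x'' x''x /P_mono/(_ Pxy)].
by rewrite (le_lt_trans x''x xx') => /esym/ltW.
Qed.

Lemma mext_ge x x' y' : P x' y' -> x' <= x -> y' <= mext x.
Proof.
by move=> Pxy x'x; apply: sup_upper_bound; [exact: mext_has_sup|exists x'].
Qed.

Lemma mext_le x x' y' : P x' y' -> x <= x' -> mext x <= y'.
Proof.
move=> Pxy xx'; apply: ge_sup; first exact: (mext_has_sup x).1.
move=> y [x'' x''x Py]; rewrite leNgt -(P_mono Pxy Py) -leNgt.
exact: le_trans xx'.
Qed.

Lemma mextE x y : P x y -> mext x = y.
Proof. by move=> Pxy; apply/le_anti; rewrite (mext_le Pxy)// (mext_ge Pxy). Qed.

Lemma mext_homo : {homo mext : x y / x < y}.
Proof.
move=> x y xy.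
have [a [a' [Pa /andP[xa ay]]]] := P_dom xy.
have [b [b' [Pb /andP[ab bY]]]] := P_dom ay.
rewrite (le_lt_trans (mext_le Pa (ltW xa)))//.
by rewrite (lt_le_trans _ (mext_ge Pb (ltW bY)))// -(P_mono Pa Pb).
Qed.

End monotone_extension.

(** If the composite moved [x], a related pair would have its first component strictly between [x]
    and its image; both extensions are monotone and exact on that pair, a contradiction. Density of
    the range makes the extension of the converse relation well behaved. *)
Lemma mextK P :
  (forall x y x' y', P x y -> P x' y' -> (x < x') = (y < y')) ->
  (forall a b, a < b -> exists x y, P x y /\ a < x < b) ->
  (forall a b, a < b -> exists x y, P x y /\ a < y < b) ->
  cancel (mext P) (mext (fun y x => P x y)).
Proof.
move=> Pm Pd Pr x.
have Pm' y x0 y' x' : P x0 y -> P x' y' -> (y < y') = (x0 < x').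
  by move=> Pxy Pxy'; rewrite (Pm _ _ _ _ Pxy Pxy').
have Pr' a b : a < b -> exists y x, P x y /\ a < y < b.
  by move=> /Pr[x0 [y ?]]; exists y, x0.
apply/le_anti/andP; split; rewrite leNgt; apply/negP => /Pd[a [b [Pab /andP[]]]].
  move=> xa; apply/negP; rewrite -leNgt.
  by apply: (mext_le Pm' Pr' Pab); apply: (mext_le Pm Pd Pab); exact: ltW.
move=> + ax; apply/negP; rewrite -leNgt.
by apply: (mext_ge Pm' Pr' Pab); apply: (mext_ge Pm Pd Pab); exact: ltW.
Qed.

Lemma uhomeo_extension P :
  (forall x y x' y', P x y -> P x' y' -> (x < x') = (y < y')) ->
  (forall a b, a < b -> exists x y, P x y /\ a < x < b) ->
  (forall a b, a < b -> exists x y, P x y /\ a < y < b) ->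
  (forall t, t <= 0 \/ 1 <= t -> P t t) ->
  exists H, forall x y, P x y -> H x = y.
Proof.
move=> Pm Pd Pr Po.
have Pm' y x y' x' : P x y -> P x' y' -> (y < y') = (x < x').
  by move=> Pxy Pxy'; rewrite (Pm _ _ _ _ Pxy Pxy').
have Pr' a b : a < b -> exists y x, P x y /\ a < y < b.
  by move=> /Pr[x [y ?]]; exists y, x.
have Pd' a b : a < b -> exists y x, P x y /\ a < x < b.
  by move=> /Pd[x [y ?]]; exists y, x.
exists (Uhomeo (mextK Pm Pd Pr) (mextK Pm' Pr' Pd') (mext_homo Pm Pd)
  (fun t t01 => mextE Pm Pd (Po t t01))).
exact: mextE.
Qed.

(** Codes that name no rational are read as 0. *)
Definition qenum (n : nat) : R := ratr (odflt 0 (unpickle n : option rat)).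

Lemma qenum_dense (a b : R) : a < b -> exists n, a < qenum n < b.
Proof.
move=> /rat_in_itvoo[q]; rewrite in_itv/= => qab.
by exists (pickle q); rewrite /qenum pickleK.
Qed.

(** Next to a fixed rational in (0, 1) there is a point [z] that moves up, and every point strictly
    between [z] and [F z] moves up too. The moved point is taken among the rationals so that the
    back-and-forth enumerates it. *)
Lemma osc_moved_dense F a b : osc F -> a < b ->
  exists2 x, a < x < b & (x <= 0 \/ 1 <= x) \/ exists2 n, x = qenum n & F x != x.
Proof.
move=> oF ab; have [n /andP[an nb]] := qenum_dense ab.
have [Fn|] := eqVneq (F (qenum n)) (qenum n); last first.
  by move=> Fn; exists (qenum n); rewrite ?an ?nb//; right; exists n.
have [n0|n0] := leP (qenum n) 0; first by exists (qenum n); rewrite ?an ?nb; auto.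
have [n1|n1] := leP 1 (qenum n); first by exists (qenum n); rewrite ?an ?nb; auto.
have e0 : 0 < Num.min (qenum n - a) (b - qenum n) by rewrite lt_min !subr_gt0 an.
have [|z [z2 [z3 [z4 [[cz z12 z23 z34 z4c] [zF _ _ _]]]]]] := oF _ _ Fn _ e0.
  by rewrite !ltW.
have az : a < z.
  by rewrite (le_lt_trans _ cz)// lerBrDl -lerBrDr ge_min lexx.
have zb : z < b.
  rewrite (lt_trans z12)// (lt_trans z23)// (lt_trans z34)// (lt_le_trans z4c)//.
  by rewrite -lerBrDl ge_min lexx orbT.
have [|m] := @qenum_dense z (Num.min (F z) b); first by rewrite lt_min zF.
rewrite lt_min => /and3P[zm mF mb].
exists (qenum m); first by rewrite mb (lt_trans az).
right; exists m => //; rewrite neq_lt; apply/orP; right.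
by rewrite (lt_trans mF)// ltu.
Qed.

(** One round of the back-and-forth. A rational that is fixed is skipped: its image is decided later
    by the monotone extension. *)
Lemma good_step F G s n : osc F -> osc G -> good F G s -> exists s',
  [/\ good F G s', {subset s <= s'},
      F (qenum n) != qenum n -> exists y, (qenum n, y) \in s' &
      G (qenum n) != qenum n -> exists x, (x, qenum n) \in s'].
Proof.
move=> oF oG gs.
have [s1 [gs1 ss1 dom]] : exists s', [/\ good F G s', {subset s <= s'} &
    F (qenum n) != qenum n -> exists y, (qenum n, y) \in s'].
  have [Fn|Fn] := eqVneq (F (qenum n)) (qenum n); first by exists s; split.
  have [y gy] := good_extend oG gs Fn.
  exists ((qenum n, y) :: s); split=> //.
    by move=> p ps; rewrite inE ps orbT.
  by exists y; exact: mem_head.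
have [Gn|Gn] := eqVneq (G (qenum n)) (qenum n); first by exists s1; split.
have [y gy] := good_extend oF (good_swap gs1) Gn.
exists ((y, qenum n) :: s1); split=> //.
- have := good_swap gy; rewrite /= -map_comp map_id_in//.
  by move=> -[].
- by move=> p ps; rewrite inE ss1 ?orbT.
- by move=> /dom[z zs]; exists z; rewrite inE zs orbT.
- by exists y; exact: mem_head.
Qed.

(** The union of the finite stages, completed by the identity outside (0, 1), preserves order and
    has dense domain and range, so it extends to a homeomorphism. The clause of [good] for one
    iterate then gives the intertwining relation. *)
Theorem osc_conjugate F G : osc F -> osc G ->
  exists H, forall t, F (H t) = H (G t).
Proof.
move=> oF oG.
have /choice[st stP] (ns : nat * seq (R * R)) : exists s', good F G ns.2 ->
    [/\ good F G s', {subset ns.2 <= s'},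
      F (qenum ns.1) != qenum ns.1 -> exists y, (qenum ns.1, y) \in s' &
      G (qenum ns.1) != qenum ns.1 -> exists x, (x, qenum ns.1) \in s'].
  have [gs|ngs] := pselect (good F G ns.2); last by exists [::].
  by have [s' ?] := good_step ns.1 oF oG gs; exists s'.
pose S n := iteri n (fun n s => st (n, s)) [::].
have gS n : good F G (S n).
  elim: n => [|n IH]; first by split=> [p|p q]; rewrite in_nil.
  by have [] := stP (n, S n) IH.
have SS m n : (m <= n)%N -> {subset S m <= S n}.
  elim: n => [|n IH]; first by rewrite leqn0 => /eqP->.
  rewrite leq_eqVlt => /predU1P[->//|/IH mn p /mn pn].
  by have [_ + _ _] := stP (n, S n) (gS n); exact.
pose P x y := (exists n, (x, y) \in S n) \/ (x = y /\ (x <= 0 \/ 1 <= x)).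
have P_in x y : (exists n, (x, y) \in S n) -> F x != x /\ G y != y.
  by move=> [n xy]; have := (gS n).1 _ xy; have := good_neq (gS n) xy.
have Pm x y x' y' : P x y -> P x' y' -> (x < x') = (y < y').
  move=> [[n xy]|[<- x01]] [[n' xy']|[<- x01']] //.
  - by have := (gS (maxn n n')).2 _ _ (SS _ _ (leq_maxl _ _) _ xy)
      (SS _ _ (leq_maxr _ _) _ xy') 0.
  - have [/u_in/andP[x0 x1] /u_in/andP[y0 y1]] : F x != x /\ G y != y.
      by apply: P_in; exists n.
    by case: x01' => ?; lra.
  - have [/u_in/andP[x0 x1] /u_in/andP[y0 y1]] : F x' != x' /\ G y' != y'.
      by apply: P_in; exists n'.
    by case: x01 => ?; lra.
have Pd a b : a < b -> exists x y, P x y /\ a < x < b.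
  move=> /(osc_moved_dense oF)[x xab [x01|[n xn]]]; first by exists x, x; split=> //; right.
  rewrite xn => Fn; have [_ _ /(_ Fn)[y yS] _] := stP (n, S n) (gS n).
  by exists x, y; split=> //; left; exists n.+1; rewrite xn.
have Pr a b : a < b -> exists x y, P x y /\ a < y < b.
  move=> /(osc_moved_dense oG)[x xab [x01|[n xn]]]; first by exists x, x; split=> //; right.
  rewrite xn => Gn; have [_ _ _ /(_ Gn)[y yS]] := stP (n, S n) (gS n).
  by exists y, x; split=> //; left; exists n.+1; rewrite xn.
have [H HP] : exists H, forall x y, P x y -> H x = y.
  by apply: uhomeo_extension => // t t01; right.
have PFG x y x' y' : P x y -> P x' y' -> (x < F x') = (y < G y').
  move=> [[n xy]|[<- x01]] [[n' xy']|[<- x01']].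
  - by have := (gS (maxn n n')).2 _ _ (SS _ _ (leq_maxl _ _) _ xy)
      (SS _ _ (leq_maxr _ _) _ xy') 1.
  - rewrite (ufun_out F x01') (ufun_out G x01').
    by apply: Pm; [left; exists n|right].
  - rewrite -[X in (X < _) = _](ufun_out F x01) -[X in _ = (X < _)](ufun_out G x01).
    by rewrite !ltu; apply: Pm; [right|left; exists n'].
  - by rewrite (ufun_out F x01') (ufun_out G x01').
(* The extension carries [F] to [G], whereas the statement asks for the opposite direction, so its
   inverse is the witness. *)
suff HFG x : H (F x) = G (H x).
  exists (uV H) => t; apply: (can_inj (ufunK H)).
  by rewrite HFG /= !uinvK.
(* Both sides of the equation are compared through the cuts they make in the dense range of [P]. *)
have dense_eq a b : (forall c d, P c d -> (d < a) = (d < b)) -> a = b :> R.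
  move=> E; apply/eqP; rewrite eq_le !leNgt; apply/andP; split; apply/negP.
    move=> /Pr[c [d [Pcd /andP[db da]]]].
    by have := E _ _ Pcd; rewrite da => /esym; rewrite ltNge (ltW db).
  move=> /Pr[c [d [Pcd /andP[db da]]]].
  by have := E _ _ Pcd; rewrite da => /esym; rewrite ltNge (ltW db).
apply: dense_eq => c d Pcd; rewrite -(HP _ _ Pcd) ltu (HP _ _ Pcd).
apply/idP/idP.
  rewrite -ltVu => /Pd[a [b [Pab /andP[ca ax]]]].
  rewrite ltVu (PFG _ _ _ _ Pcd Pab) in ca.
  by rewrite (lt_trans ca)// ltu -(HP _ _ Pab) ltu.
rewrite -ltVu => /Pr[a [b [Pab /andP[db bx]]]].
rewrite ltVu -(PFG _ _ _ _ Pcd Pab) in db.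
by rewrite (lt_trans db)// ltu -(ltu H) (HP _ _ Pab).
Qed.

End conjugacy.

(** * Density of oscillating interval homeomorphisms *)

Section compactness.
Context {R : realType}.

(** Locally uniform radii become uniform by the near-covering form of compactness along the filter
    of small positive radii. *)
Lemma compact_uniform (X : pseudoMetricType R) (A : set X) (Q : R -> X -> Prop) :
  compact A -> (forall d d' x, d' <= d -> Q d x -> Q d' x) ->
  (forall x, A x -> exists2 d, 0 < d & forall x', ball x d x' -> Q d x') ->
  exists2 d, 0 < d & forall x, A x -> Q d x.
Proof.
move=> /compact_near_coveringP cA Qm AQ.
have : \forall d \near 0^'+, A `<=` Q d.
  apply: cA => x /AQ[d d0 dQ].
  exists (ball x d, [set e | e < d]) => /=.
    by split; [exact: nbhsx_ballx|exact: nbhs_right_lt].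
  by move=> [x' e] /= [xx' /ltW ed]; apply: Qm ed _; exact: dQ.
move=> H; have H' : \forall d \near 0^'+, 0 < d /\ A `<=` Q d.
  by near=> d; split; near: d => //; exact: nbhs_right_gt.
by have [d [d0 dQ]] := filter_ex H'; exists d.
Unshelve. all: by end_near. Qed.

Lemma ball_cvg (X Z : pseudoMetricType R) (f : X -> Z) x : {for x, continuous f} <->
  forall e, 0 < e -> exists2 d, 0 < d & forall y, ball x d y -> ball (f x) e (f y).
Proof.
split=> [cf e e0|H].
  have /nbhs_ballP[d /= d0 dP] : \forall y \near x, ball (f x) e (f y).
    by apply: cf; exact: nbhsx_ballx.
  by exists d.
apply/cvg_ballP => e e0; have [d d0 dP] := H e e0.
by apply/nbhs_ballP; exists d.
Qed.

(** Only [x] is confined to the compact set; [y] ranges over the whole space, so the estimate also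
    crosses the boundary of [A]. *)
Lemma compact_unif_continuous (X Z : pseudoMetricType R) (A : set X) (f : X -> Z) :
  compact A -> (forall x, A x -> {for x, continuous f}) ->
  forall e, 0 < e ->
  exists2 d, 0 < d & forall x, A x -> forall y, ball x d y -> ball (f x) e (f y).
Proof.
move=> cA cf e e0.
apply: compact_uniform cA _ _ => [d d' x d'd H y xy|x /cf/ball_cvg].
  by apply: H; exact: le_ball xy.
move=> /(_ (e / 2)); rewrite divr_gt0// => /(_ isT)[d d0 dP].
exists (d / 2); first by rewrite divr_gt0.
move=> x' xx' y x'y; apply: (@ball_splitr _ _ (f x)); apply: dP.
  by apply: le_ball xx'; rewrite ler_pdivrMr// ler_peMr ?ler1n// ltW.
exact: ball_split xx' x'y.
Qed.

End compactness.

Section interval_perturbation.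
Context {R : realType}.
Implicit Types (F G H : uhomeo R).

Lemma real_continuousP (f : R -> R) x : {for x, continuous f} <->
  forall e, 0 < e -> exists2 d, 0 < d & forall y, `|x - y| < d -> `|f x - f y| < e.
Proof. exact: (@ball_cvg R R R f x). Qed.

Lemma u_continuous F : continuous F.
Proof.
move=> x; apply/real_continuousP => e e0.
pose d := Num.min (uinv F (F x + e) - x) (x - uinv F (F x - e)).
exists d.
  rewrite lt_min !subr_gt0 ltuV ltVu; apply/andP; split; lra.
move=> y; rewrite lt_min !ltr_norml => /andP[/andP[y1 y2] /andP[y3 y4]].
have : F y < F x + e by rewrite -ltuV; lra.
have : F x - e < F y by rewrite -ltVu; lra.
by move=> *; apply/andP; split; lra.
Qed.

Lemma u_unif F e : 0 < e ->
  exists2 d, 0 < d & forall x y, `|x - y| < d -> `|F x - F y| < e.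
Proof.
move=> e0.
have [d d0 dP] := @compact_unif_continuous R R R _ F (@segment_compact R (-1) 2)
  (fun x _ => @u_continuous F x) e e0.
(* The bound 1 ensures that, if [x] is outside [-1, 2], then [y] is outside (0, 1) as well and [F]
   is the identity at both; the bound [e] then suffices. *)
exists (Num.min d (Num.min e 1)); first by rewrite !lt_min d0 e0 ltr01.
move=> x y; rewrite !lt_min => /and3P[xyd xye xy1].
have [x1|x1] := ltP x (-1).
  by move: xy1; rewrite ltr_norml => /andP[? ?]; rewrite !ufun_out//; left; lra.
have [x2|x2] := ltP 2 x.
  by move: xy1; rewrite ltr_norml => /andP[? ?]; rewrite !ufun_out//; right; lra.
by apply: dP => //; rewrite /= in_itv/= x1.
Qed.

End interval_perturbation.

(** * A Cantor-like sign pattern *)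

Section pattern.
Context {R : realType}.

(* [0, 1] is cut into five equal cells: the second one is marked [true], the
   fourth one [false], and the other three are cut again in the same way. *)
Fixpoint mark (b : bool) (n : nat) (t : R) : Prop :=
  if n is n'.+1 then
    (if b then 1 < 5 * t < 2 else 3 < 5 * t < 4) \/
    exists d, [/\ d \in [:: 0; 2; 4], 0 < 5 * t - d < 1 & mark b n' (5 * t - d)]
  else False.

Definition marked b t := exists n, mark b n t.

Lemma mark_in b n t : mark b n t -> 0 < t < 1.
Proof.
case: n => //= n [|[d []]]; first by case: b => /andP[? ?]; apply/andP; split; lra.
by rewrite !inE => /or3P[]/eqP-> /andP[? ?] _; apply/andP; split; lra.
Qed.

Lemma marked_in b t : marked b t -> 0 < t < 1.
Proof. by move=> [n /mark_in]. Qed.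

Lemma marked_disj t : marked true t -> ~ marked false t.
Proof.
move=> [n +] [m]; elim: n => // n IH in m t *; case: m => // m /=.
move=> [/andP[? ?]|[d [+ /andP[? ?] tn]]] [/andP[? ?]|[d' [+ /andP[? ?] fm]]]; first lra.
- by rewrite !inE => /or3P[]/eqP ?; lra.
- by rewrite !inE => /or3P[]/eqP ?; lra.
rewrite !inE => dd dd'; apply: (IH m (5 * t - d)) => //.
suff -> : d = d' by [].
by case/or3P: dd => /eqP ?; case/or3P: dd' => /eqP ?; lra.
Qed.

Lemma mark_open b n t : mark b n t ->
  exists2 e, 0 < e & forall s, `|t - s| < e -> mark b n s.
Proof.
have inner (u i j : R) : i < 5 * u < j -> exists2 e, 0 < e &
    forall s, `|u - s| < e -> i < 5 * s < j.
  move=> /andP[iu uj].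
  exists (Num.min ((5 * u - i) / 5) ((j - 5 * u) / 5)).
    by rewrite lt_min !divr_gt0// ?subr_gt0.
  move=> s; rewrite lt_min => /andP[].
  rewrite !ltr_pdivlMr// => us1 us2; have := ler_norm (u - s).
  by have := ler_norm (- (u - s)); rewrite normrN => *; apply/andP; split; lra.
elim: n => //= n IH in t *.
move=> [|[d [dd td tn]]].
  by case: b IH => IH /inner[e e0 H]; exists e => // s /H; left.
have [e e0 H] := IH _ tn.
have [|e' e'0 H'] := inner t d (d + 1); first by move: td => /andP[? ?]; apply/andP; split; lra.
exists (Num.min e' (e / 5)); first by rewrite lt_min e'0 divr_gt0.
move=> s; rewrite lt_min ltr_pdivlMr// => /andP[/H'/andP[s1 s2] ts].
right; exists d; split=> //; first by apply/andP; split; lra.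
apply: H; rewrite (_ : _ - _ = (t - s) * 5); last by ring.
by rewrite normrM [`|5|]gtr0_norm.
Qed.

Lemma marked_sub b d t : d \in [:: 0; 2; 4] -> marked b t -> marked b ((t + d) / 5).
Proof.
move=> dd [n tn]; exists n.+1; right; exists d.
have E : 5 * ((t + d) / 5) - d = t by field.
by rewrite E; split => //; exact: mark_in tn.
Qed.

(** At every depth an unmarked point lies in a closed undecided cell, which contains a scaled copy
    of the whole pattern. Cells shrink by the factor 5, which more than suffices for the scale
    [n.+1%:R^-1] used in the induction. *)
Lemma marked_osc t : 0 <= t <= 1 -> ~ marked true t -> ~ marked false t ->
  forall e, 0 < e -> exists z1 z2 z3 z4,
    [/\ t - e < z1, z1 < z2, z2 < z3, z3 < z4 & z4 < t + e] /\
    [/\ marked true z1, marked false z2, marked true z3 & marked false z4].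
Proof.
move=> + + + e e0.
have [n] := ltr_add_invr e0; rewrite add0r => ne t01 tT tF.
suff [z1 [z2 [z3 [z4 [[a1 ? ? ? a5] ?]]]]] : exists z1 z2 z3 z4,
    [/\ t - n.+1%:R^-1 < z1, z1 < z2, z2 < z3, z3 < z4 & z4 < t + n.+1%:R^-1] /\
    [/\ marked true z1, marked false z2, marked true z3 & marked false z4].
  exists z1, z2, z3, z4; split=> //; split=> //.
    by apply: le_lt_trans a1; rewrite lerD2l lerN2 ltW.
  by apply: lt_le_trans a5 _; rewrite lerD2l ltW.
elim: n => [|n IH] in t t01 tT tF {ne} *.
  have m b u : 1 < 5 * u < 2 -> marked true u by move=> ?; exists 1%N; left.
  have m' b u : 3 < 5 * u < 4 -> marked false u by move=> ?; exists 1%N; left.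
  (* 3/10 and 7/10 are the centres of the two marked cells. Their copies are taken in the first,
     third and fifth cells so as to be increasing with alternating marks. *)
  exists ((3/10 + 0) / 5), ((7/10 + 2) / 5), ((3/10 + 4) / 5), ((7/10 + 4) / 5).
  rewrite invr1; split; first by move: t01 => /andP[? ?]; split; lra.
  by split; apply: marked_sub; rewrite ?inE ?eqxx ?orbT//; exists 1%N; left;
    apply/andP; split; lra.
have [d dd td] : exists2 d : R, d \in [:: 0; 2; 4] & 0 <= 5 * t - d <= 1.
  have [t1|t1] := leP (5 * t) 1.
    by exists 0; rewrite ?inE ?eqxx//; apply/andP; split; lra.
  have [t2|t2] := ltP (5 * t) 2.
    by exfalso; apply: tT; exists 1%N; left; apply/andP.
  have [t3|t3] := leP (5 * t) 3.
    by exists 2; rewrite ?inE ?eqxx ?orbT//; apply/andP; split; lra.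
  have [t4|t4] := ltP (5 * t) 4.
    by exfalso; apply: tF; exists 1%N; left; apply/andP.
  by exists 4; rewrite ?inE ?eqxx ?orbT//; apply/andP; split; lra.
have nm b : ~ marked b t -> ~ marked b (5 * t - d).
  by move=> tb /(marked_sub dd); rewrite subrK mulrC mulKf.
have [z1 [z2 [z3 [z4 [[l1 l2 l3 l4 l5] [m1 m2 m3 m4]]]]]] := IH _ td (nm _ tT) (nm _ tF).
exists ((z1 + d) / 5), ((z2 + d) / 5), ((z3 + d) / 5), ((z4 + d) / 5).
split; last by split; exact: marked_sub.
have n5 : n.+1%:R^-1 <= n.+2%:R^-1 * 5 :> R.
  rewrite -ler_pdivrMl ?invr_gt0// invrK ler_pdivrMr// mulrC -[5]/(5%:R) -natrM ler_nat.
  by lia.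
by move: n5 l1 l5; move: (n.+1%:R^-1) (n.+2%:R^-1) => r r' *; split; lra.
Qed.

End pattern.

(** * Extending two separated sets to an oscillating sign pattern *)

Section grid.
Context {R : realType}.

(* The cells of a fine grid that meet [K b] are given to [b], the other ones are
   filled with the pattern [marked]. *)
Lemma grid_fill (K : bool -> set R) (r : R) : 0 < r ->
  (forall b s, K b s -> r <= s <= 1 - r) ->
  (forall s s', K true s -> K false s' -> r <= `|s - s'|) ->
  exists U : bool -> set R, [/\ forall b t, K b t -> U b t,
    forall b t, U b t -> 0 < t < 1,
    forall b t, U b t -> exists2 e, 0 < e & forall s, `|t - s| < e -> U b s,
    forall t, U true t -> ~ U false t &
    forall t, 0 <= t <= 1 -> ~ U true t -> ~ U false t ->
    forall e, 0 < e -> exists z1 z2 z3 z4,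
    [/\ t - e < z1, z1 < z2, z2 < z3, z3 < z4 & z4 < t + e] /\
    [/\ U true z1, U false z2, U true z3 & U false z4] ].
Proof.
move=> r0 Kin Ksep.
(* The mesh is below [r / 2], so two equal or adjacent cells cannot be hit with opposite signs, and
   no hit cell touches 0 or 1. *)
have [n] := @ltr_add_invr R 0 (r / 2) (divr_gt0 r0 (ltr0n _ 2)).
rewrite add0r => nr; pose m : R := n.+1%:R.
have m0 : 0 < m by rewrite ltr0n.
have mr : 2 < m * r.
  by move: nr; rewrite ltr_pdivlMr// mulrC ltr_pdivrMr// mulrC.
pose hit b (i : nat) := exists2 s, K b s & i%:R <= m * s <= i.+1%:R.
have hit_in b i : hit b i -> 1 < i%:R :> R /\ i.+1%:R < m.
  move=> [s /Kin/andP[rs sr] /andP[]]; rewrite -natr1 => is1 is2.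
  have : m * r <= m * s by rewrite ler_pM2l.
  have : m * s <= m * (1 - r) by rewrite ler_pM2l.
  by rewrite mulrBr mulr1 => *; split; lra.
have hit_sep b i j : hit b i -> hit (~~ b) j ->
    i%:R <= j.+1%:R :> R -> j%:R <= i.+1%:R :> R -> False.
  move=> [s Ks /andP[]] + + [s' Ks' /andP[]]; rewrite -!natr1 => *.
  have : m * r <= m * `|s - s'|.
    by rewrite ler_pM2l//; case: b Ks Ks' => /Ksep H /H//; rewrite distrC.
  rewrite -[m in m * `|_|]gtr0_norm// -normrM mulrBr ler_normr => /orP[]; lra.
pose cell b i t := i%:R < m * t < i.+1%:R /\
  (hit b i \/ [/\ ~ hit true i, ~ hit false i & marked b (m * t - i%:R)]).
(* Hits are counted in closed cells, so a point of [K b] on the grid makes both adjacent cells hit.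
   Including the node between them lets [U b] contain this point and remain open. *)
pose node b i t := [/\ m * t = i.+1%:R, hit b i & hit b i.+1].
pose U b t := exists i, (i < n.+1)%N /\ (cell b i t \/ node b i t).
have cell_node b b' i j t : cell b i t -> node b' j t -> False.
  move=> [/andP[a c] _] [tj _ _]; move: a c; rewrite tj !ltr_nat !ltnS.
  by move=> ji ij; have := leq_ltn_trans ji ij; rewrite ltnn.
have cell_disj i j t : cell true i t -> cell false j t -> False.
  move=> [/andP[it ti] ci] [/andP[jt tj] cj].
  have /eqP ij : i == j.
    have := lt_trans it tj; have := lt_trans jt ti.
    by rewrite !ltr_nat !ltnS eqn_leq => -> ->.
  subst j; case: ci cj => [h|[h1 h2 h3]] [h'|[h1' h2' h3']] //.
    by apply: hit_sep h h' _ _; rewrite ler_nat.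
  exact: marked_disj h3 h3'.
have node_disj i j t : node true i t -> node false j t -> False.
  move=> [ti hi _] [tj hj _].
  have ij : i = j by apply: succn_inj; apply/eqP; rewrite -(eqr_nat R) -ti -tj.
  subst j.
  by apply: hit_sep hi hj _ _; rewrite ler_nat.
have near_scale t e : 0 < e -> exists2 d, 0 < d & forall s, `|t - s| < d ->
    m * t - e < m * s < m * t + e.
  move=> e0; exists (e / m); first exact: divr_gt0.
  move=> s; rewrite ltr_pdivlMr// -[in _ * m](gtr0_norm m0) -normrM mulrBl.
  by rewrite ltr_norml ![_ * m]mulrC => /andP[? ?]; apply/andP; split; lra.
have cellE t : 0 <= t <= 1 -> exists2 i, (i < n.+1)%N & i%:R <= m * t <= i.+1%:R.
  move=> /andP[t0 t1].
  have mt0 : 0 <= m * t by rewrite mulr_ge0// ltW.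
  have [lt|ge] := ltP t 1.
    have := truncn_itv mt0; set i := Num.truncn _ => /andP[it ti].
    exists i; last by rewrite it ltW.
    by rewrite -(ltr_nat R) (le_lt_trans it)// gtr_pMr.
  exists n => //; have -> : t = 1 by lra.
  by rewrite mulr1 lexx ler_nat leqnSn.
have bnd t : (0 < m * t < m) = (0 < t < 1) by rewrite pmulr_rgt0// gtr_pMr.
exists U; split.
- move=> b t Kt; have /Kin/andP[rt tr] := Kt.
  have [|i iM it] := cellE t; first by apply/andP; split; lra.
  have hi : hit b i by exists t.
  move: it => /andP[]; rewrite le_eqVlt => /predU1P[it|it].
    case: i => [|i] in iM hi it *; first by have [] := hit_in _ _ hi; rewrite ltr10.
    move=> _; exists i; split; first exact: ltnW.
    right; split=> //; exists t => //; rewrite -it lexx andbT ler_nat.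
    exact: leqnSn.
  rewrite le_eqVlt => /predU1P[ti|ti]; last first.
    by exists i; split=> //; left; split; [rewrite it|left].
  exists i; split=> //; right; split=> //; exists t => //.
  by rewrite ti lexx ler_nat leqnSn.
- move=> b t [i [iM [[/andP[it ti] _]|[ti hi hi']]]].
    have : i.+1%:R <= m by rewrite ler_nat.
    have : 0 <= i%:R :> R by rewrite ler0n.
    by move=> *; rewrite -bnd; apply/andP; split; lra.
  have [_ im] := hit_in _ _ hi.
  by rewrite -bnd ti ltr0n.
- move=> b t [i [iM [[/andP[it ti] ci]|[ti hi hi']]]].
    have [|d d0 dP] := near_scale t (Num.min (m * t - i%:R) (i.+1%:R - m * t)).
      by rewrite lt_min !subr_gt0 it.
    have {}dP s : `|t - s| < d -> i%:R < m * s < i.+1%:R.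
      move=> /dP; set e := Num.min _ _ => /andP[e1 e2].
      have : e <= m * t - i%:R by rewrite ge_min lexx.
      have : e <= i.+1%:R - m * t by rewrite ge_min lexx orbT.
      by move=> *; apply/andP; split; lra.
    case: ci => [hi|[h1 h2 [k /mark_open[e e0 eP]]]].
      by exists d => // s /dP ms; exists i; split=> //; left; split=> //; left.
    exists (Num.min d (e / m)); first by rewrite lt_min d0 divr_gt0.
    move=> s; rewrite lt_min => /andP[/dP ms ts].
    exists i; split=> //; left; split=> //; right; split=> //; exists k; apply: eP.
    rewrite opprB addrA subrK -mulrBr normrM (gtr0_norm m0).
    by rewrite mulrC -ltr_pdivlMr.
  have [d d0 dP] := near_scale t 1 ltr01.
  have iM1 : (i.+1 < n.+1)%N.
    have [_] := hit_in _ _ hi'; rewrite ltr_nat; lia.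
  exists d => // s /dP; rewrite ti => /andP[]; rewrite natr1.
  rewrite -[in X in X -> _]natr1 addrK => is1 is2.
  have [lt|gt|eq] := ltgtP (m * s) i.+1%:R.
  + by exists i; split=> //; left; split; [rewrite is1|left].
  + by exists i.+1; split=> //; left; split; [rewrite gt|left].
  + by exists i; split=> //; right.
- move=> t [i [_ [ci|ni]]] [j [_ [cj|nj]]].
  + exact: cell_disj ci cj.
  + exact: cell_node ci nj.
  + exact: cell_node cj ni.
  + exact: node_disj ni nj.
move=> t t01 nT nF.
(* An unassigned point lies in a closed cell that is not hit: inside a hit cell, or at a node
   between two hit cells, which necessarily have the same sign, it would be assigned. *)
have [i [iM it [hT hF]]] : exists i, [/\ (i < n.+1)%N, i%:R <= m * t <= i.+1%:R &
    ~ hit true i /\ ~ hit false i].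
  have [i iM /andP[it ti]] := cellE t t01.
  have U_False b : ~ U b t by case: b.
  have twohit b b' j : (j < n.+1)%N -> hit b j -> hit b' j.+1 ->
      m * t = j.+1%:R -> False.
    move=> jM hj; have [<- hj' tj|bb'] := eqVneq b b'.
      by apply: (U_False b); exists j; split=> //; right.
    rewrite (_ : b' = ~~ b); last by case: b b' bb' {hj} => -[].
    by move=> hj' _; apply: hit_sep hj hj' _ _; rewrite ler_nat// leqW.
  have [[b hi]|nh] := pselect (exists b, hit b i); last first.
    by exists i; split; rewrite ?it//; split=> h; apply: nh; eexists; exact: h.
  have [i1 im] := hit_in _ _ hi.
  move: it; rewrite le_eqVlt => /predU1P[it|it].
    case: i => [|i] in iM ti hi it i1 im *; first by rewrite ltr10 in i1.
    have [[b' hi']|nh] := pselect (exists b, hit b i).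
      by have := twohit _ _ _ (ltnW iM) hi' hi (esym it).
    exists i; split; first exact: ltnW.
      by rewrite -it lexx andbT ler_nat leqnSn.
    by split=> h; apply: nh; eexists; exact: h.
  move: ti; rewrite le_eqVlt => /predU1P[ti|ti]; last first.
    exfalso; apply: (U_False b); exists i; split=> //; left; split; last by left.
    by rewrite it.
  have [[b' hi']|nh] := pselect (exists b, hit b i.+1).
    by have := twohit _ _ _ iM hi hi' ti.
  exists i.+1; split; first by move: im; rewrite ltr_nat.
    by rewrite ti lexx ler_nat leqnSn.
  by split=> h; apply: nh; eexists; exact: h.
move=> e e0.
have it01 : 0 <= m * t - i%:R <= 1.
  by move: it; rewrite -natr1 => /andP[? ?]; apply/andP; split; lra.
have nm b : ~ U b t -> ~ marked b (m * t - i%:R).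
  move=> Ub mb; apply: Ub; exists i; split=> //; left; split; last by right.
  by move: (marked_in mb); rewrite -natr1 => /andP[? ?]; apply/andP; split; lra.
have em : 0 < m * e by rewrite mulr_gt0.
have [z1 [z2 [z3 [z4 [[l1 l2 l3 l4 l5] [m1 m2 m3 m4]]]]]] :=
  marked_osc it01 (nm _ nT) (nm _ nF) em.
have zU b z : marked b z -> U b ((z + i%:R) / m).
  move=> mz; exists i; split=> //; left.
  have E : m * ((z + i%:R) / m) = z + i%:R by field; rewrite gt_eqF.
  split; last by right; split => //; rewrite E addrK.
  by rewrite E; move: (marked_in mz); rewrite -natr1 => /andP[? ?]; apply/andP; split; lra.
exists ((z1 + i%:R) / m), ((z2 + i%:R) / m), ((z3 + i%:R) / m), ((z4 + i%:R) / m).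
split; last by split; exact: zU.
split; rewrite ?ltr_pdivlMr ?ltr_pdivrMr// ?divfK ?gt_eqF//; lra.
Qed.

End grid.

(** * Clamping the sign pattern around a given map *)

Section perturbation.
Context {R : realType}.
Implicit Types (F G H : uhomeo R) (U : R -> Prop).

Lemma uhomeo_of (f : R -> R) : {homo f : x y / x < y} -> continuous f ->
  (forall t, t <= 0 \/ 1 <= t -> f t = t) -> exists F, forall t, F t = f t.
Proof.
move=> fh fc fo.
have /choice[g gP] y : exists x, f x = y.
  have [y0|y0] := leP y 0; first by exists y; apply: fo; left.
  have [y1|y1] := leP 1 y; first by exists y; apply: fo; right.
  have [||x _ fx] := @IVT R f 0 1 y ler01; last by exists x.
    by apply: continuous_subspaceT.
  by rewrite !fo ?lexx; [rewrite minEle maxEle ler01 !ltW|auto|auto].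
have fg : cancel g f by [].
have fm : {mono f : x y / x < y} by apply: leW_mono; apply: le_mono.
have gf : cancel f g.
  by move=> x; apply: (inc_inj (le_mono fh)); rewrite fg.
by exists (Uhomeo gf fg fh fo).
Qed.

(** The distance from [t] to the complement of [U], truncated at 1. It is 1-Lipschitz, vanishes off
    [U] and is positive on an open [U]. The truncation keeps the supremum finite, and [r = 0] always
    qualifies. *)
Definition depth U (t : R) : R :=
  sup [set r | 0 <= r <= 1 /\ forall s, `|t - s| < r -> U s].

Lemma depth_has_sup U t :
  has_sup [set r | 0 <= r <= 1 /\ forall s, `|t - s| < r -> U s].
Proof.
split; last by exists 1 => r [/andP[]].
by exists 0; split=> [|s]; rewrite ?lexx ?ler01// ltNge normr_ge0.
Qed.

Lemma depth_ge0 U t : 0 <= depth U t.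
Proof.
apply: sup_upper_bound; first exact: depth_has_sup.
by split=> [|s]; rewrite ?lexx ?ler01// ltNge normr_ge0.
Qed.

Lemma depth_gt0 U t : (forall s, U s -> exists2 e, 0 < e & forall u, `|s - u| < e -> U u) ->
  U t -> 0 < depth U t.
Proof.
move=> oU /oU[e e0 eP].
apply: (@lt_le_trans _ _ (Num.min e 1)); first by rewrite lt_min e0 ltr01.
apply: sup_upper_bound; first exact: depth_has_sup.
split; first by rewrite ge_min lexx orbT le_min (ltW e0) ler01.
by move=> s ts; apply: eP; rewrite (lt_le_trans ts)// ge_min lexx.
Qed.

Lemma depth_eq0 U t : ~ U t -> depth U t = 0.
Proof.
move=> nU; apply/eqP; rewrite eq_le depth_ge0 andbT.
apply: ge_sup; first exact: (depth_has_sup U t).1.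
move=> r [_ rP]; rewrite leNgt; apply/negP => r0; apply: nU; apply: rP.
by rewrite subrr normr0.
Qed.

Lemma depth_lip U s t : depth U s <= depth U t + `|s - t|.
Proof.
apply: ge_sup; first exact: (depth_has_sup U s).1.
move=> r [/andP[r0 r1] rP]; rewrite -lerBlDr.
have [rst|rst] := leP (r - `|s - t|) 0; first exact: le_trans rst (depth_ge0 _ _).
apply: sup_upper_bound; first exact: depth_has_sup.
split; first by rewrite (ltW rst) (le_trans _ r1)// gerBl.
move=> u tu; apply: rP; rewrite (le_lt_trans (ler_distD t _ _))//.
by rewrite addrC -ltrBrDr.
Qed.

Lemma osc_dense F (eta : R) : 0 < eta ->
  exists2 G, osc G & forall t, `|F t - G t| <= eta.
Proof.
move=> eta0.
(* Where the displacement is at least [eta] in size, the clamp can be active at a fixed point of the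
   new map unless the pattern has the sign of [F - id], so that sign is prescribed there. *)
pose K (b : bool) := [set t | if b then eta <= F t - t else eta <= t - F t].
have [d d0 dP] := u_unif F eta0.
pose r := Num.min d eta.
have r0 : 0 < r by rewrite lt_min d0.
have rd : r <= d by rewrite ge_min lexx.
have re : r <= eta by rewrite ge_min lexx orbT.
have [|s s' /= Ks Ks'|U [KU U_in U_open U_disj U_osc]] := grid_fill r0 (K := K).
- move=> b s Ks.
  have Fs : F s != s.
    apply/eqP => Fs; move: Ks; rewrite /K/= Fs subrr; case: b => /= ?; lra.
  have /andP[s0 s1] := u_in Fs.
  have /andP[Fs0 Fs1] : 0 < F s < 1 by rewrite -{1}(u0 F) -(u1 F) !ltu s0.
  apply/andP; split; rewrite leNgt; apply/negP => sr.
    have := dP 0 s; rewrite u0 !sub0r !normrN !gtr0_norm// => /(_ (lt_le_trans sr rd)).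
    by move: Ks; rewrite /K /=; case: b => /= ? ?; lra.
  have := dP 1 s; rewrite u1 !gtr0_norm ?subr_gt0// => H.
  have {}H : 1 - F s < eta by apply: H; lra.
  by move: Ks; rewrite /K /=; case: b => /= ?; lra.
- rewrite leNgt; apply/negP => ss; rewrite /K /= in Ks Ks'.
  have := dP s s' (lt_le_trans ss rd); have := lt_le_trans ss re.
  by rewrite !ltr_norml => /andP[? ?] /andP[? ?]; lra.
(* The difference of the two depths is 2-Lipschitz; after division by 4 the displacement is
   1/2-Lipschitz and [phi] is strictly increasing. *)
pose phi t := t + (depth (U true) t - depth (U false) t) / 4.
have U_depth b t : U b t -> 0 < depth (U b) t.
  by move=> Ut; apply: depth_gt0 => // s; exact: U_open.
have phi_up t : U true t -> t < phi t.
  move=> Ut; rewrite ltrDl divr_gt0// (depth_eq0 (U_disj _ Ut)) subr0; exact: U_depth.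
have phi_down t : U false t -> phi t < t.
  move=> Ut; rewrite gtrDl -oppr_gt0 -mulNr divr_gt0// opprB.
  by rewrite (@depth_eq0 (U true)) ?subr0 ?U_depth// => /U_disj.
have phi_fix t : ~ U true t -> ~ U false t -> phi t = t.
  by move=> nT nF; rewrite /phi !depth_eq0// subrr mul0r addr0.
have phi_homo : {homo phi : x y / x < y}.
  move=> x y xy; rewrite /phi.
  have := depth_lip (U true) x y; have := depth_lip (U false) y x.
  have -> : `|x - y| = y - x by rewrite distrC gtr0_norm ?subr_gt0.
  have -> : `|y - x| = y - x by rewrite gtr0_norm ?subr_gt0.
  lra.
have phi_lip x y : `|phi x - phi y| <= 2 * `|x - y|.
  have := depth_lip (U true) x y; have := depth_lip (U false) y x.
  have := depth_lip (U true) y x; have := depth_lip (U false) x y.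
  rewrite [`|y - x|]distrC /phi => *; rewrite ler_norml.
  have := ler_norm (x - y); have := ler_norm (y - x); rewrite [`|y - x|]distrC => *.
  by apply/andP; split; lra.
have phi_cont : continuous phi.
  move=> x; apply/real_continuousP => e e0; exists (e / 2); first by rewrite divr_gt0.
  move=> y xy; rewrite (le_lt_trans (phi_lip _ _))// mulrC -ltr_pdivlMr//.
(* Clamping creates no fixed points: [F t + eta = t] forces [phi t < t], and
   [F t - eta = t] forces [t < phi t]. *)
pose g t := Num.max (F t - eta) (Num.min (phi t) (F t + eta)).
have g_homo : {homo g : x y / x < y}.
  move=> x y xy; rewrite /g gt_max !lt_max !lt_min !gt_min.
  by rewrite ltrD2r ltu xy/= phi_homo//= ltrD2r ltu xy !orbT.
have g_cont : continuous g.
  move=> x.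
  apply: (@continuous_max R R (fun t => F t - eta) (fun t => Num.min (phi t) (F t + eta)) x).
    by apply: continuousB; [exact: u_continuous|exact: cvg_cst].
  apply: (@continuous_min R R phi (fun t => F t + eta) x); first exact: phi_cont.
  by apply: continuousD; [exact: u_continuous|exact: cvg_cst].
have g_le t : g t <= F t + eta by rewrite ge_max ge_min lexx orbT andbT; lra.
have g_ge t : F t - eta <= g t by rewrite le_max lexx.
have g_phi t : F t - eta <= phi t <= F t + eta -> g t = phi t.
  by move=> /andP[? ?]; rewrite /g min_l// max_r.
have g_up t : U true t -> F t - t > - eta -> t < g t.
  by move=> /phi_up tp Ft; rewrite lt_max lt_min tp/=; apply/orP; right; lra.
have g_down t : U false t -> F t - t < eta -> g t < t.
  by move=> /phi_down tp Ft; rewrite gt_max gt_min tp andbT; lra.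
have g_out t : t <= 0 \/ 1 <= t -> g t = t.
  move=> t01; have Ft := ufun_out F t01.
  have nU b : ~ U b t by move=> /U_in/andP[]; case: t01; lra.
  by rewrite g_phi phi_fix ?Ft//; apply/andP; split; lra.
have [G GE] := uhomeo_of g_homo g_cont g_out.
exists G; last first.
  by move=> t; rewrite GE ler_norml; have := g_le t; have := g_ge t; move=> *;
    apply/andP; split; lra.
move=> p p01; rewrite GE => gp e e0.
(* At a fixed point [p] of the clamped map the displacement of [F] is strictly below [eta] in size.
   Hence the clamp is inactive near [p], where the map is [phi] and inherits the oscillation of the
   pattern. *)
have Fp_lt : F p - p < eta.
  rewrite ltNge; apply/negP => H; have /KU Up : K true p by [].
  have : p < g p by apply: g_up Up _; lra.
  by rewrite gp ltxx.
have Fp_gt : - eta < F p - p.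
  rewrite ltNge; apply/negP => H; have /KU Up : K false p by rewrite /K/=; lra.
  have : g p < p by apply: g_down Up _; lra.
  by rewrite gp ltxx.
have nT : ~ U true p by move=> /g_up/(_ Fp_gt); rewrite gp ltxx.
have nF : ~ U false p by move=> /g_down/(_ Fp_lt); rewrite gp ltxx.
(* Half of the margin at [p]: [phi] and [F] may each vary by less than [c] without activating the
   clamp. *)
pose c := Num.min (eta - (F p - p)) (F p - p + eta) / 2.
have c0 : 0 < c by rewrite divr_gt0// lt_min; apply/andP; split; lra.
have [d1 d10 d1P] := (real_continuousP phi p).1 (phi_cont p) c c0.
have [d2 d20 d2P] := (real_continuousP F p).1 (u_continuous (x := p)) c c0.
have Gphi z : p - Num.min d1 d2 < z < p + Num.min d1 d2 -> G z = phi z.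
  move=> /andP[z1 z2]; rewrite GE; apply: g_phi.
  have : `|p - z| < Num.min d1 d2 by rewrite ltr_norml; apply/andP; split; lra.
  rewrite lt_min => /andP[/d1P + /d2P]; rewrite (phi_fix _ nT nF) !ltr_norml.
  have : c * 2 <= eta - (F p - p) by rewrite divfK// ge_min lexx.
  have : c * 2 <= F p - p + eta by rewrite divfK// ge_min lexx orbT.
  by move=> ? ? /andP[? ?] /andP[? ?]; apply/andP; split; lra.
pose e' := Num.min e (Num.min d1 d2).
have e'0 : 0 < e' by rewrite !lt_min e0 d10.
have e'e : e' <= e by rewrite ge_min lexx.
have e'd : e' <= Num.min d1 d2 by rewrite ge_min lexx orbT.
have [z1 [z2 [z3 [z4 [[l1 l2 l3 l4 l5] [m1 m2 m3 m4]]]]]] := U_osc p p01 nT nF e' e'0.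
exists z1, z2, z3, z4; split; first by split; lra.
by rewrite !Gphi; [split; [exact: phi_up|exact: phi_down|exact: phi_up|exact: phi_down]|..];
  apply/andP; split; lra.
Qed.

End perturbation.

(** * A shadowing criterion *)

Lemma int_leP (i j : int) : i <= j -> exists n : nat, j = i + n%:Z.
Proof. by move=> ij; exists `|(j - i)%R|%N; lia. Qed.

(** The near-covering form of compactness is applied to the filter of finite lists ordered by
    inclusion: a neighbourhood of [x] is covered as soon as the list contains [x]. *)
Lemma compact_finite_cover (T : topologicalType)
    (O : T -> set T) :
  compact [set: T] -> (forall x, open (O x) /\ O x x) ->
  exists s : seq T, forall x, exists2 c, c \in s & O c x.
Proof.
move=> /compact_near_coveringP cT OO.
pose F : set_system (seq T) :=
  [set S : set (seq T) | exists s0 : seq T, forall s, {subset s0 <= s} -> S s].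
have FF : Filter F.
  split=> [|P Q [s sP] [s' s'Q]|P Q PQ [s sP]].
  - by exists [::].
  - exists (s ++ s') => r ssr; split; [apply: sP|apply: s'Q] => c cs; apply: ssr;
      by rewrite mem_cat cs ?orbT.
  - by exists s => r /sP/PQ.
have [|s sP] := cT _ F (fun s x => exists2 c, c \in s & O c x) FF.
  move=> x _; have [Ox Oxx] := OO x.
  exists (O x, [set s : seq T | x \in s]) => /=.
    split; first exact: open_nbhs_nbhs.
    by exists [:: x] => s; apply; exact: mem_head.
  by move=> [y s] /= [Oxy xs]; exists x.
by exists s => x; exact: sP.
Qed.

Section shadowing_criterion.
Context {R : realType} {X : compactMetricType R}.
Implicit Types (f : homeo X) (a : set X) (x y z : X).

Definition homeoV f : homeo X :=
  Homeo (homeo_invK f) (homeo_funK f) (@homeo_inv_continuous _ _ f)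
    (@homeo_fun_continuous _ _ f).

Lemma ball_mdist x (d : R) y : ball x d y = (mdist x y < d) :> Prop.
Proof. by rewrite ballEmdist. Qed.

Lemma homeo_iterS f i y : homeo_iter f (i + 1) y = f (homeo_iter f i y).
Proof.
case: i => n; first by rewrite -PoszD addn1.
case: n => [|n]; first by rewrite /= homeo_invK.
by rewrite (_ : Negz n.+1 + 1 = Negz n) ?NegzE//= ?homeo_invK//; lia.
Qed.

Lemma iter_cancel (T : Type) (g h : T -> T) n :
  cancel g h -> cancel (iter n g) (iter n h).
Proof. by move=> gh; elim: n => // n IH x; rewrite iterSr /= gh IH. Qed.

Lemma homeo_iter_surj f k x : exists y, homeo_iter f k y = x.
Proof.
case: k => n; first by exists (iter n (homeo_inv f) x); exact/iter_cancel/homeo_invK.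
by exists (iter n.+1 f x); exact/(@iter_cancel _ _ _ n.+1)/homeo_funK.
Qed.

Lemma homeo_iter_fix f p i : f p = p -> homeo_iter f i p = p.
Proof.
move=> fp; have ip : homeo_inv f p = p by rewrite -{1}fp homeo_funK.
by case: i => n /=; [|rewrite -iterS]; elim: n => //= n ->.
Qed.

Lemma metric_unif (g : X -> X) : continuous g -> forall e : R, 0 < e ->
  exists2 d, 0 < d & forall x y, mdist x y < d -> mdist (g x) (g y) < e.
Proof.
move=> cg e e0; have [d d0 dP] :=
  compact_unif_continuous (@compact_setT R X) (fun x _ => cg x) e0.
by exists d => // x y; have := dP x I y; rewrite !ball_mdist.
Qed.

(** The image of the compact set [a] keeps a positive distance from the complement of [a], so small
    jumps do not leave [a]. *)
Lemma trapping (g : X -> X) a : continuous g -> closed a ->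
  (forall x, a x -> a^° (g x)) ->
  exists2 d : R, 0 < d & forall x y, a x -> mdist (g x) y < d -> a y.
Proof.
move=> cg ca ga.
have cpa : compact a := subclosed_compact ca compact_setT (@subsetT _ a).
have [||d d0 dP] := @compact_uniform R X a
    (fun d x => forall y, mdist (g x) y < d -> a y) cpa.
- by move=> d d' x d'd H y xy; apply: H; exact: lt_le_trans d'd.
- move=> x /ga /nbhs_ballP[r /= r0 rP].
  have [d d0 dP] := (ball_cvg g x).1 (cg x) (r / 2) (divr_gt0 r0 (ltr0n _ 2)).
  exists (Num.min d (r / 2)); first by rewrite lt_min d0 divr_gt0.
  move=> x' xx' y x'y; apply: rP; apply: ball_split (dP _ (le_ball _ xx')) _.
    by rewrite ge_min lexx.
  by rewrite ball_mdist (lt_le_trans x'y)// ge_min lexx orbT.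
by exists d => // x y /dP; exact.
Qed.

Lemma finite_uniform (T : eqType) (s : seq T) (P : T -> R -> Prop) :
  (forall c d d', d' <= d -> P c d -> P c d') ->
  (forall c, c \in s -> exists2 d, 0 < d & P c d) ->
  exists2 d, 0 < d & forall c, c \in s -> P c d.
Proof.
move=> Pm; elim: s => [|c s IH] H; first by exists 1.
have [|d d0 dP] := IH; first by move=> c' c's; apply: H; rewrite inE c's orbT.
have [d' d'0 d'P] := H c (mem_head _ _).
exists (Num.min d d'); first by rewrite lt_min d0.
move=> c'; rewrite inE => /predU1P[->|c's].
  by apply: Pm d'P; rewrite ge_min lexx orbT.
by apply: Pm (dP _ c's); rewrite ge_min lexx.
Qed.

Lemma finite_far (T : eqType) (s : seq T) (P : T -> int -> Prop) :
  (forall c, c \in s -> exists i, forall j, i <= j -> P c j) ->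
  exists i, forall c, c \in s -> P c i.
Proof.
move=> H; suff [i iP] : exists i, forall c, c \in s -> forall j, i <= j -> P c j.
  by exists i => c /iP; exact.
elim: s H => [|c s IH] H; first by exists 0.
have [|i iP] := IH; first by move=> c' c's; apply: H; rewrite inE c's orbT.
have [i' i'P] := H c (mem_head _ _).
exists (Num.max i i') => c'; rewrite inE => /predU1P[->|c's] j.
  by rewrite ge_max => /andP[_ /i'P].
by rewrite ge_max => /andP[ij _]; exact: iP ij.
Qed.

(** Both sequences may have jumps, so that true orbits and pseudo-orbits are compared in either
    order by the same statement. *)
Lemma orbits_close f (M : nat) (e : R) : 0 < e -> exists2 d, 0 < d &
  forall u v : nat -> X, mdist (u 0%N) (v 0%N) < d ->
    (forall j, mdist (f (u j)) (u j.+1) < d) ->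
    (forall j, mdist (f (v j)) (v j.+1) < d) ->
    forall j, (j <= M)%N -> mdist (u j) (v j) < e.
Proof.
elim: M => [|M IH] in e *; first by move=> e0; exists e => // u v uv _ _ [].
move=> e0; have e3 : 0 < e / 3 by rewrite divr_gt0.
have [w w0 wP] := metric_unif (@homeo_fun_continuous _ _ f) e3.
have [|d d0 dP] := IH (Num.min w e); first by rewrite lt_min w0.
exists (Num.min d (e / 3)); first by rewrite lt_min d0.
move=> u v; rewrite lt_min => /andP[uv0 _] fu fv j.
have {}dP k : (k <= M)%N -> mdist (u k) (v k) < Num.min w e.
  by apply: dP => // k'; [have := fu k'|have := fv k']; rewrite lt_min => /andP[].
rewrite leq_eqVlt => /predU1P[->|]; last first.
  by move=> /dP; rewrite lt_min => /andP[].
have := dP M (leqnn _); rewrite lt_min => /andP[/wP fuv _].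
have := fu M; have := fv M; rewrite !lt_min => /andP[_ fvM] /andP[_ fuM].
have := metric_triangle (u M.+1) (f (u M)) (v M.+1).
have := metric_triangle (f (u M)) (f (v M)) (v M.+1).
by rewrite [mdist (u M.+1) (f _)]metric_sym; lra.
Qed.

(** Compactness leaves finitely many attracting and repelling sets and a common bound [N] for the
    time to reach an attracting one. A repelling set that is left is never entered again, and an
    attracting one is never left, for pseudo-orbits as well. *)
Theorem shadowing_criterion f :
  (forall p, f p = p -> forall e : R, 0 < e -> exists a, [/\ closed a, a^° p,
    forall x y, a x -> a y -> mdist x y < e &
    (forall x, a x -> a^° (f x)) \/ (forall x, a x -> a^° (homeo_inv f x))]) ->
  (forall x, exists2 p, f p = p &
    forall U : set X, nbhs p U -> exists n, U (iter n f x)) ->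
  shadowing f.
Proof.
move=> loc conv e e0.
have /choice[t tP] x : exists t : X * set X * nat * bool, [/\ closed t.1.1.2,
    f t.1.1.1 = t.1.1.1 /\ t.1.1.2 t.1.1.1,
    forall y z, t.1.1.2 y -> t.1.1.2 z -> mdist y z < e,
    (forall y, t.1.1.2 y -> t.1.1.2^° (if t.2 then f y else homeo_inv f y)) &
    t.1.1.2^° (if t.2 then iter t.1.2 f x else x)].
  have [p fp xp] := conv x; have [a [ca ap ae fa]] := loc p fp e e0.
  have [n nP] := xp _ (nbhs_interior ap).
  case: fa => fa; first by exists (p, a, n, true); split=> //=; split=> //; exact: interior_subset.
  exists (p, a, n, false); split => //=; first by split=> //; exact: interior_subset.
  (* Backward invariance brings the repelling set from an iterate back to [x] itself, so only
     attracting sets involve a waiting time. *)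
  elim: n nP => // n IH fnx; apply: IH.
  by rewrite -[iter n f x](homeo_funK f); apply: fa; exact: interior_subset.
pose A x := (t x).1.1.2; pose att x := (t x).2; pose p x := (t x).1.1.1.
pose O x := if att x then iter (t x).1.2 f @^-1` (A x)^° else (A x)^°.
have iter_cont n : continuous (iter n f).
  elim: n => [|n IH] x; first exact: cvg_id.
  by apply: continuous_comp; [exact: IH|exact: homeo_fun_continuous].
have [s sP] : exists s : seq X, forall x, exists2 c, c \in s & O c x.
  apply: compact_finite_cover (@compact_setT R X) _ => x; split.
    rewrite /O; case: ifP => _; last exact: open_interior.
    by apply: open_comp => [y _|]; [exact: iter_cont|exact: open_interior].
  by rewrite /O /att; have [_ _ _ _] := tP x; case: ((t x).2).
have Ain x : (A x)^° `<=` A x := @interior_subset _ _.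
have [d1 d10 d1P] : exists2 d : R, 0 < d & forall c, c \in s ->
    forall y z, A c y -> mdist (if att c then f y else homeo_inv f y) z < d -> A c z.
  apply: (@finite_uniform _ s (fun c d => forall y z, A c y ->
    mdist (if att c then f y else homeo_inv f y) z < d -> A c z)) => [c d d' d'd H y z Ay yz|c cs].
    by apply: H Ay _; exact: lt_le_trans d'd.
  have [cA _ _ fA _] := tP c; move: fA; rewrite -/(A c) -/(att c).
  by case: (att c) => fA; apply: trapping fA => //;
    [exact: homeo_fun_continuous|exact: homeo_inv_continuous].
have [d2 d20 d2P] := metric_unif (@homeo_inv_continuous _ _ f) d10.
pose N := \max_(c <- s) (t c).1.2.
(* One step from the last repelling time to a point outside all repelling sets, [N] steps to an
   attracting set and one more to have room inside it: [N.+2] in all. *)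
have [|d3 d30 d3P] := @orbits_close f N.+2 (Num.min e d1).
  by rewrite lt_min e0.
exists (Num.min d1 (Num.min d2 d3)); first by rewrite !lt_min d10 d20.
move=> x xP.
have {xP} [xP1 xP2 xP3] : [/\ forall i, mdist (f (x i)) (x (i + 1)) < d1,
    forall i, mdist (homeo_inv f (x (i + 1))) (x i) < d1 &
    forall i, mdist (f (x i)) (x (i + 1)) < d3].
  split=> i; have := xP i; rewrite !lt_min => /and3P[] // _ + _.
  by move=> /d2P; rewrite homeo_funK metric_sym.
have fwd c i (k : nat) : c \in s -> att c -> A c (x i) -> A c (x (i + k%:Z)).
  move=> cs ac Ai; elim: k => [|k IH]; first by rewrite addr0.
  by apply: d1P cs _ _ IH _; rewrite ac -addn1 PoszD addrA.
have bwd c i (k : nat) : c \in s -> ~~ att c -> A c (x i) -> A c (x (i - k%:Z)).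
  move=> cs ac Ai; elim: k => [|k IH]; first by rewrite subr0.
  apply: d1P cs _ _ IH _; rewrite (negPf ac) -addn1 PoszD opprD addrA.
  by have := xP2 (i - k%:Z - 1); rewrite subrK.
have fixed_shadow c : c \in s -> (forall i, A c (x i)) ->
    exists y, forall i, mdist (homeo_iter f i y) (x i) < e.
  move=> cs Ax; have [_ [fp Ap] Ae _ _] := tP c.
  by exists (p c) => i; rewrite homeo_iter_fix //; exact: Ae Ap (Ax i).
pose Rep z := exists c, [/\ c \in s, ~~ att c & A c z].
have settle z : ~ Rep z -> exists c, [/\ c \in s, att c & A c (iter N f z)].
  move=> nz; have [c cs Oc] := sP z.
  have [ac|ac] := boolP (att c); last first.
    by exfalso; apply: nz; exists c; split=> //; apply: Ain; move: Oc; rewrite /O (negPf ac).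
  exists c; split=> //; move: Oc; rewrite /O ac => /Ain Oc.
  have nN : ((t c).1.2 <= N)%N by exact: leq_bigmax_seq.
  rewrite -(subnK nN) iterD; elim: (N - _)%N => //= k IH.
  apply: d1P cs _ _ IH _; rewrite ac mdistxx//.
(* After [N] iterates the true orbit is in the attracting set; after one more, the whole [d1]-ball
   around it is, which absorbs the error of the pseudo-orbit. *)
have land k : ~ Rep (x k) -> exists c, [/\ c \in s, att c & A c (x (k + N.+1%:Z))
    /\ forall w, mdist (iter N.+1 f (x k)) w < d1 -> A c w].
  move=> /settle[c [cs ac Ac]].
  have Aw w : mdist (iter N.+1 f (x k)) w < d1 -> A c w.
    by move=> fw; apply: d1P cs _ _ Ac _; rewrite ac.
  exists c; split=> //; split=> //; apply: Aw.
  have := d3P (fun j => iter j f (x k)) (fun j => x (k + j%:Z)).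
  rewrite addr0 mdistxx => /(_ d30) H.
  have : mdist (iter N.+1 f (x k)) (x (k + N.+1%:Z)) < Num.min e d1.
    apply: H => // [j|j]; first by rewrite mdistxx.
    by rewrite -addn1 PoszD addrA.
  by rewrite lt_min => /andP[].
(* If each of the finitely many repelling sets missed some point of the pseudo-orbit, none would
   contain its late points. So one of them contains all points, and its fixed point shadows. *)
have [allR|] := pselect (forall i, Rep (x i)).
  have [[c [cs Ac]]|nc] := pselect (exists c, c \in s /\ forall i, A c (x i)).
    exact: fixed_shadow cs Ac.
  have [c cs|i iP] := @finite_far _ s (fun c i => ~~ att c -> ~ A c (x i)).
    have [ac|ac] := boolP (att c); first by exists 0.
    have [i iP] : exists i, ~ A c (x i).
      by apply/existsNP => Ac; apply: nc; exists c.
    exists i => j ij _ Ac; apply: iP.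
    have [k jE] := int_leP ij.
    have -> : i = j - k%:Z by rewrite jE addrK.
    exact: bwd.
  by exfalso; have [c [cs ac Ac]] := allR i; exact: iP cs ac Ac.
move=> /existsNP[k0 nRk0].
have Rdown i (k : nat) : Rep (x i) -> Rep (x (i - k%:Z)).
  by move=> [c [cs ac Ac]]; exists c; split=> //; exact: bwd.
(* The mirror argument in the past: an attracting set that misses one point misses all earlier ones,
   whereas [land] started early enough puts every point in some attracting set. *)
have [allN|] := pselect (forall i, ~ Rep (x i)).
  have [[c [cs Ac]]|nc] := pselect (exists c, c \in s /\ forall i, A c (x i)).
    exact: fixed_shadow cs Ac.
  have [c cs|i iP] := @finite_far _ s (fun c i => att c -> ~ A c (x (- i))).
    have [ac|ac] := boolP (att c); last by exists 0.
    have [i iP] : exists i, ~ A c (x i).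
      by apply/existsNP => Ac; apply: nc; exists c.
    exists (- i) => j ij _ Ac; apply: iP.
    have [k jE] := int_leP ij; rewrite (_ : i = - j + k%:Z).
      exact: fwd.
    by rewrite jE opprD opprK subrK.
  exfalso; have [c [cs ac [Ac _]]] := land (- i - N.+1%:Z) (allN _).
  by apply: (iP c cs ac); rewrite subrK in Ac.
move=> /existsNP[k1 /contrapT Rk1].
have k10 : k1 <= k0.
  rewrite leNgt; apply/negP => /ltW k01; apply: nRk0.
  have [k kE] := int_leP k01; rewrite (_ : k0 = k1 - k%:Z).
    exact: Rdown.
  by rewrite kE addrK.
(* [Rep] is inherited by the past, so this is its last time. The true orbit through [x k] shares the
   repelling set in the past and, after a bounded transition, an attracting set in the future. *)
have [k []] : exists k, ~~ ~~ `[< Rep (x k) >] /\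
    ~~ `[< Rep (x (k + 1)) >].
  have [n nE] := int_leP k10.
  apply: (@int_crossing (fun k => ~~ `[< Rep (x k) >]) n k1).
    by rewrite negbK; apply/asboolP.
  by rewrite -nE; apply/asboolP.
rewrite negbK => /asboolP Rk /asboolP nRk.
have [y yk] := homeo_iter_surj f k (x k).
exists y; pose o (i : int) := homeo_iter f i y.
have oS i : o (i + 1) = f (o i) by exact: homeo_iterS.
have o_fwd c i (j : nat) : c \in s -> att c -> A c (o i) -> A c (o (i + j%:Z)).
  move=> cs ac Ai; elim: j => [|j IH]; first by rewrite addr0.
  by apply: d1P cs _ _ IH _; rewrite ac -addn1 PoszD addrA oS mdistxx.
have o_bwd c i (j : nat) : c \in s -> ~~ att c -> A c (o i) -> A c (o (i - j%:Z)).
  move=> cs ac Ai; elim: j => [|j IH]; first by rewrite subr0.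
  apply: d1P cs _ _ IH _; rewrite (negPf ac) -addn1 PoszD opprD addrA.
  by rewrite -[in o (i - _)](subrK 1 (i - _)) oS homeo_funK mdistxx.
have close (j : nat) : (j <= N.+2)%N -> mdist (o (k + j%:Z)) (x (k + j%:Z)) < Num.min e d1.
  apply: (d3P (fun j : nat => o (k + j%:Z)) (fun j : nat => x (k + j%:Z))).
  - by rewrite !addr0 /o yk mdistxx.
  - by move=> i; rewrite -addn1 PoszD addrA oS mdistxx.
  - by move=> i; rewrite -addn1 PoszD addrA.
move=> i; rewrite -/(o i).
have [ik|/ltW ki] := leP i k.
  have [c [cs ac Ac]] := Rk; have [_ _ Ae _ _] := tP c.
  have [j jE] := int_leP ik; have -> : i = k - j%:Z by rewrite jE addrK.
  by apply: Ae; [apply: o_bwd => //; rewrite /o yk|exact: bwd].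
have [j ->] := int_leP ki.
have [jN|Nj] := leqP j N.+2; first by have := close j jN; rewrite lt_min => /andP[].
have [c [cs ac [Ax Aw]]] := land _ nRk; have [_ _ Ae _ _] := tP c.
have kN : k + 1 + N.+1%:Z = k + N.+2%:Z by rewrite -addrA -PoszD.
rewrite kN in Ax.
have -> : k + j%:Z = k + N.+2%:Z + (j - N.+2)%N%:Z.
  by rewrite -addrA -PoszD subnKC// ltnW.
apply: Ae; last exact: fwd.
apply: o_fwd => //; apply: Aw; rewrite -kN.
have := d3P (fun j => iter j f (x (k + 1))) (fun j : nat => o (k + 1 + j%:Z)).
rewrite addr0 => H.
have : mdist (iter N.+1 f (x (k + 1))) (o (k + 1 + N.+1%:Z)) < Num.min e d1.
  apply: H => // [|i'|i'].
  - by rewrite /= oS /o yk metric_sym.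
  - by rewrite mdistxx.
  - by rewrite -addn1 PoszD addrA oS mdistxx.
by rewrite lt_min => /andP[].
Qed.

End shadowing_criterion.

(** * The edges of Y *)

Section geometry.
Context {R : realType}.
Implicit Types (n : nat) (t s : R) (e : bool * nat) (p q : plane R).

(** Indices are shifted to start at 0. [px 0 = 1], so the first tooth stands at the common end of
    the arc and the segment. *)
Definition px n : R := -1 + 2 / n.+1%:R.

(* Edges of Y: [(true, n)] is the tooth at [px n], [(false, 0)] is the arc from
   (1, 0) to (-1, 0) and [(false, n.+1)] is the segment from [px n.+1] to
   [px n]. *)
Definition edge_pt e t : plane R :=
  match e with
  | (true, n) => (px n, t / n.+1%:R)
  | (false, 0%N) => (1 - 2 * t, - Num.sqrt (1 - (1 - 2 * t) ^+ 2))
  | (false, n.+1) => (px n.+1 + t * (px n - px n.+1), 0)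
  end.

(** A left inverse of [edge_pt e] that is affine on the whole plane, which makes it continuous on
    all of Y. *)
Definition coord e p : R :=
  match e with
  | (true, n) => p.2 * n.+1%:R
  | (false, 0%N) => (1 - p.1) / 2
  | (false, n.+1) => (p.1 - px n.+1) / (px n - px n.+1)
  end.

Lemma ltpx m n : (px m < px n) = (n < m)%N.
Proof.
by rewrite /px ltrD2l ltr_pM2l// ltf_pV2 ?posrE// ltr_nat ltnS.
Qed.

Lemma lepx m n : (px m <= px n) = (n <= m)%N.
Proof. by rewrite leNgt ltpx -leqNgt. Qed.

Lemma px_inj : injective px.
Proof.
by move=> m n /eqP; rewrite eq_le !lepx => ?; apply/eqP; rewrite eqn_leq andbC.
Qed.

Lemma px_gt n : -1 < px n.
Proof. by rewrite ltrDl divr_gt0. Qed.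

Lemma px0 : px 0 = 1.
Proof. by rewrite /px divr1; lra. Qed.

Lemma px_le1 n : px n <= 1.
Proof. by rewrite -px0 lepx. Qed.

Lemma coordK e t : coord e (edge_pt e t) = t.
Proof.
case: e => -[n|[|n]] /=.
- by rewrite divfK.
- by field.
- by rewrite addrAC subrr add0r mulfK// subr_eq0 gt_eqF// ltpx.
Qed.

Lemma edge_pt_Yset e t : 0 <= t <= 1 -> Yset (edge_pt e t).
Proof.
move=> /andP[t0 t1]; case: e => -[n|[|n]] /=.
- right; exists n.+1 => //=; split; first by [].
  by rewrite /= in_itv/= mul1r divr_ge0//= ler_pdivrMr// mulVf.
- left; left; split => /=; last by rewrite oppr_le0 sqrtr_ge0.
  rewrite sqrrN sqr_sqrtr; first by rewrite addrCA subrr addr0.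
  by rewrite subr_ge0; nra.
- left; right; split=> //=; rewrite in_itv/=.
  have := px_gt n.+1; have := px_le1 n; have : px n.+1 <= px n by rewrite lepx.
  by move=> *; apply/andP; split; nra.
Qed.

Definition clamp t : R := Num.max 0 (Num.min t 1).

Lemma clamp_itv t : 0 <= clamp t <= 1.
Proof. by rewrite le_max lexx/= ge_max ler01 ge_min lexx orbT. Qed.

Lemma clampE t : 0 <= t <= 1 -> clamp t = t.
Proof. by move=> /andP[t0 t1]; rewrite /clamp min_l// max_r. Qed.

(** Clamping makes each edge a continuous path defined on the whole line. *)
Definition gam e t : Y R :=
  exist _ (edge_pt e (clamp t)) (mem_set (edge_pt_Yset e (clamp_itv t))).

Definition coo e (y : Y R) : R := coord e (\val y).

Lemma cooK e t : coo e (gam e t) = clamp t.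
Proof. exact: coordK. Qed.

Lemma gam_clamp e t : gam e (clamp t) = gam e t.
Proof. by apply: val_inj; rewrite /= (clampE (clamp_itv t)). Qed.

Lemma gam_inj e s t : 0 <= s <= 1 -> 0 <= t <= 1 -> gam e s = gam e t -> s = t.
Proof. by move=> s01 t01 /(congr1 (coo e)); rewrite !cooK !clampE. Qed.

Lemma mdist1 (y z : Y R) : `|(\val y).1 - (\val z).1| <= mdist y z.
Proof.
change (`|(\val y).1 - (\val z).1| <= dist2 (\val y) (\val z)).
by rewrite -sqrtr_sqr ler_wsqrtr// lerDl sqr_ge0.
Qed.

Lemma mdist2 (y z : Y R) : `|(\val y).2 - (\val z).2| <= mdist y z.
Proof.
change (`|(\val y).2 - (\val z).2| <= dist2 (\val y) (\val z)).
by rewrite -sqrtr_sqr ler_wsqrtr// lerDr sqr_ge0.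
Qed.

Lemma mdist_le12 (y z : Y R) :
  mdist y z <= `|(\val y).1 - (\val z).1| + `|(\val y).2 - (\val z).2|.
Proof.
change (dist2 (\val y) (\val z) <= `|(\val y).1 - (\val z).1| + `|(\val y).2 - (\val z).2|).
rewrite /dist2 -[leRHS]ger0_norm ?addr_ge0// -sqrtr_sqr ler_wsqrtr//.
rewrite -[X in X + _ <= _]real_normK ?num_real// -[X in _ + X <= _]real_normK ?num_real//.
have := normr_ge0 ((\val y).1 - (\val z).1).
have := normr_ge0 ((\val y).2 - (\val z).2).
by nra.
Qed.

Lemma coo_continuous e : continuous (coo e).
Proof.
have lip (C : R) (f : Y R -> R) : 0 < C ->
    (forall y z, `|f y - f z| <= C * mdist y z) -> continuous f.
  move=> C0 fC x; apply/(@ball_cvg R (Y R) R) => r r0; exists (r / C).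
    exact: divr_gt0.
  move=> y; rewrite ball_mdist ltr_pdivlMr// => xy.
  by rewrite /ball/= (le_lt_trans (fC _ _))// mulrC.
case: e => -[n|[|n]].
- apply: (lip n.+1%:R) => // y z; rewrite /coo/= -mulrBl normrM [`|_.+1%:R|]gtr0_norm//.
  by rewrite mulrC ler_pM2l//; exact: mdist2.
- apply: (lip 1) => // y z; rewrite /coo/= -mulrBl normrM [`|2^-1|]gtr0_norm// mul1r.
  rewrite (_ : _ - _ = - ((\val y).1 - (\val z).1)); last by ring.
  by rewrite normrN; have := mdist1 y z; have := normr_ge0 ((\val y).1 - (\val z).1); lra.
- have d0 : 0 < px n - px n.+1 by rewrite subr_gt0 ltpx.
  apply: (lip (px n - px n.+1)^-1); first by rewrite invr_gt0.
  move=> y z; rewrite /coo/= -mulrBl normrM [`|_^-1|]gtr0_norm ?invr_gt0//.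
  rewrite mulrC ler_pM2l ?invr_gt0// (_ : _ - _ = (\val y).1 - (\val z).1); last by ring.
  exact: mdist1.
Qed.

Lemma clamp_continuous : continuous clamp.
Proof.
move=> x; apply: (@continuous_max R R (fun=> 0) (fun t => Num.min t 1) x).
  exact: cvg_cst.
by apply: (@continuous_min R R id (fun=> 1) x); [exact: cvg_id|exact: cvg_cst].
Qed.

Lemma gam_continuous e : continuous (gam e).
Proof.
have H1 : continuous (fun t => (edge_pt e t).1 : R).
  case: e => -[n|[|n]] x /=; first exact: cvg_cst.
    by apply: cvgB; [exact: cvg_cst|apply: cvgM; [exact: cvg_cst|exact: cvg_id]].
  by apply: cvgD; [exact: cvg_cst|apply: cvgM; [exact: cvg_id|exact: cvg_cst]].
have H2 : continuous (fun t => (edge_pt e t).2 : R).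
  case: e {H1} => -[n|[|n]] x /=; last exact: cvg_cst.
    by apply: cvgM; [exact: cvg_id|exact: cvg_cst].
  apply: cvgN; apply: (@continuous_comp R R R (fun t => 1 - (1 - 2 * t) ^+ 2) Num.sqrt).
    apply: cvgB; first exact: cvg_cst.
    by apply: cvgM; apply: cvgB; try exact: cvg_cst; apply: cvgM; [exact: cvg_cst|exact: cvg_id|exact: cvg_cst|exact: cvg_id].
  exact: sqrt_continuous.
move=> x; apply/(@ball_cvg R R (Y R)) => r r0.
have r2 : 0 < r / 2 by rewrite divr_gt0.
have C1 : continuous (fun t => (edge_pt e (clamp t)).1 : R).
  by move=> y; apply: (@continuous_comp R R R clamp (fun t => (edge_pt e t).1));
    [exact: clamp_continuous|exact: H1].
have C2 : continuous (fun t => (edge_pt e (clamp t)).2 : R).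
  by move=> y; apply: (@continuous_comp R R R clamp (fun t => (edge_pt e t).2));
    [exact: clamp_continuous|exact: H2].
have [d1 d10 d1P] := (real_continuousP _ x).1 (C1 x) _ r2.
have [d2 d20 d2P] := (real_continuousP _ x).1 (C2 x) _ r2.
exists (Num.min d1 d2); first by rewrite lt_min d10.
move=> y; rewrite /ball/= lt_min => /andP[/d1P y1 /d2P y2].
change (mdist (gam e x) (gam e y) < r).
by rewrite (le_lt_trans (mdist_le12 _ _))// [ltRHS]splitr ltrD.
Qed.

End geometry.

(** * Vertices, overlaps and tails of Y *)

Section vertices.
Context {R : realType}.
Implicit Types (m n : nat) (t s : R) (e : bool * nat) (y z : Y R).

Lemma gam_cover y : exists e t, 0 <= t <= 1 /\ y = gam e t.
Proof.
suff [e [t [t01 yE]]] : exists e t, 0 <= t <= 1 /\ \val y = edge_pt e t.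
  by exists e, t; split => //; apply: val_inj; rewrite yE /= clampE.
have Yy : Yset (\val y) := set_mem (valP y).
case: (\val y) Yy => a b [[[/= ab b0]|[/= a1 ->]]|[n n1 [/= ->]]].
- exists (false, 0%N), ((1 - a) / 2); split; first by apply/andP; split; nra.
  rewrite /= (_ : 1 - 2 * ((1 - a) / 2) = a); last by field.
  by rewrite (_ : 1 - a ^+ 2 = (- b) ^+ 2) ?sqrtr_sqr ?ger0_norm ?opprK ?oppr_ge0//; rewrite -ab; ring.
- move: a1; rewrite in_itv/= le_eqVlt => /andP[/predU1P[<- _|a0 a1]].
    exists (false, 0%N), 1; split; first by rewrite lexx ler01.
    by rewrite /= mulr1 (_ : 1 - 2 = -1) ?sqrrN ?expr1n ?subrr ?sqrtr0 ?oppr0//; ring.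
  have ap : 0 < a + 1 by lra.
  (* With [k] the integer part of [2 / (a + 1)], [a] lies between [px k] and [px k.-1], hence on the
     edge [(false, k)]. *)
  have := truncn_itv (divr_ge0 (ler0n R 2) (ltW ap)).
  set k := Num.truncn _ => /andP[ka ak].
  have k0 : (0 < k)%N.
    case: (k) ak => // ak; move: ak; rewrite ltr_pdivrMr// mul1r; lra.
  exists (false, k), ((a - px k) / (px k.-1 - px k)).
  case: k k0 ka ak => // k _ ka ak.
  have d0 : 0 < px k - px k.+1 :> R by rewrite subr_gt0 ltpx.
  split; last by rewrite /= divfK ?gt_eqF// addrC subrK.
  rewrite /= ler_pdivlMr// ler_pdivrMr// mul0r mul1r.
  move: ka ak; rewrite ler_pdivlMr// ltr_pdivrMr// => ka ak.
  apply/andP; split.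
    rewrite subr_ge0 /px -lerBrDl ler_pdivrMr// (le_trans (ltW ak))//.
    by rewrite mulrC; lra.
  rewrite lerD2r /px -lerBlDl ler_pdivlMr// (le_trans _ ka)//.
  by rewrite mulrC; lra.
- rewrite in_itv/= => /andP[b0 bn]; case: n n1 bn => // n _ bn.
  exists (true, n), (b * n.+1%:R); split; last by rewrite /= mulfK.
  by rewrite mulr_ge0//= -ler_pdivlMr.
Qed.

(** Three edges meet here: [(true, n)] and [(false, n)] at parameter 0, and [(false, n.+1)] at
    parameter 1. Numbering the arc as [(false, 0)] makes this hold at (1, 0) too. *)
Definition vtx n : Y R := gam (true, n) 0.

Definition vinf : Y R := gam (false, 0%N) 1.

Lemma val_vtx n : \val (vtx n) = (px n, 0) :> plane R.
Proof. by rewrite /= clampE ?lexx ?ler01// mul0r. Qed.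

Lemma val_vinf : \val vinf = (-1, 0) :> plane R.
Proof.
rewrite /= clampE ?lexx ?ler01// mulr1 (_ : 1 - 2 = -1); last by ring.
by rewrite sqrrN expr1n subrr sqrtr0 oppr0.
Qed.

Lemma gam0 n : gam (false, n) 0 = vtx n.
Proof.
apply: val_inj; rewrite val_vtx; case: n => [|n] /=; rewrite clampE ?lexx ?ler01//.
  by rewrite px0 mulr0 subr0 expr1n subrr sqrtr0 oppr0.
by rewrite mul0r addr0.
Qed.

Lemma gam1 n : gam (false, n.+1) 1 = vtx n.
Proof.
apply: val_inj; rewrite val_vtx /= clampE ?lexx ?ler01//.
by rewrite mul1r addrC subrK.
Qed.

Lemma vtx_inj : injective vtx.
Proof.
by move=> m n /(congr1 (fun y : Y R => (\val y).1)); rewrite !val_vtx => /px_inj.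
Qed.

Lemma vtx_neq_inf n : vtx n <> vinf.
Proof.
move=> /(congr1 (fun y : Y R => (\val y).1)); rewrite val_vtx val_vinf /=.
by have := @px_gt R n; lra.
Qed.

Lemma gam_eq_vtx e t n : 0 <= t <= 1 -> gam e t = vtx n ->
  [\/ e = (true, n) /\ t = 0, e = (false, n) /\ t = 0 |
      e = (false, n.+1) /\ t = 1].
Proof.
move=> t01 /(congr1 (fun y : Y R => \val y)); rewrite val_vtx /= clampE//.
move: t01 => /andP[t0 t1]; case: e => -[m|[|m]] /= [].
- move=> /px_inj -> /eqP; rewrite mulf_eq0 invr_eq0 pnatr_eq0 orbF => /eqP ->.
  by apply: Or31.
- move=> tn /eqP; rewrite oppr_eq0 sqrtr_eq0 => h.
  have t0E : t = 0 by have := @px_gt R n; nra.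
  have -> : n = 0%N by apply: (@px_inj R); rewrite -tn px0 t0E; ring.
  by apply: Or32.
move=> E.
have dm : px m.+1 < px m :> R by rewrite ltpx.
have h1 : px m.+1 <= px n :> R by rewrite -E; nra.
have h2 : px n <= px m :> R by rewrite -E; nra.
move: h1 h2; rewrite !lepx => nm; rewrite leq_eqVlt => /predU1P[mE|mn].
  by apply: Or33; rewrite -mE in E *; split=> //; nra.
have nE : n = m.+1 by apply/eqP; rewrite eqn_leq nm.
by apply: Or32; rewrite nE in E *; split=> //; nra.
Qed.

Lemma gam_eq_vinf e t : 0 <= t <= 1 -> gam e t = vinf -> e = (false, 0%N) /\ t = 1.
Proof.
move=> t01 /(congr1 (fun y : Y R => (\val y).1)); rewrite val_vinf /= clampE//.
move: t01 => /andP[t0 t1]; case: e => -[m|[|m]] /=.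
- by have := @px_gt R m; lra.
- by move=> h; split=> //; lra.
- have := @px_gt R m.+1; have : px m.+1 <= px m :> R by rewrite lepx.
  by move=> *; nra.
Qed.

Lemma gam_level e s : 0 <= s <= 1 -> let p := \val (gam e s) : plane R in
  [\/ 0 < p.2 /\ exists n, e = (true, n) /\ p.1 = px n,
      p.2 < 0 /\ e = (false, 0%N) |
      p.2 = 0 /\ [\/ exists n, gam e s = vtx n, gam e s = vinf |
                    exists n, e = (false, n.+1)]].
Proof.
move=> s01 /=; rewrite clampE//; move: (s01) => /andP[s0 s1].
case: e => -[n|[|n]] /=.
- move: s0; rewrite le_eqVlt => /predU1P[<-|s0].
    by apply: Or33; rewrite mul0r; split=> //; apply: Or31; exists n.
  by apply: Or31; split; [rewrite divr_gt0|exists n].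
- have := sqrtr_ge0 (1 - (1 - 2 * s) ^+ 2); rewrite le_eqVlt => /predU1P[h|h].
    apply: Or33; rewrite -h oppr0; split=> //.
    have : 1 - (1 - 2 * s) ^+ 2 <= 0 by rewrite -sqrtr_eq0 -h.
    have [->|sn0] := eqVneq s 0; first by move=> _; apply: Or31; exists 0%N; rewrite gam0.
    have {}s0 : 0 < s by rewrite lt_neqAle eq_sym sn0.
    by move=> hs; have -> : s = 1; [nra|apply: Or32].
  by apply: Or32; rewrite oppr_lt0.
- by apply: Or33; split=> //; apply: Or33; exists n.
Qed.

(** The sign of the ordinate separates teeth, arc and base, and base edges are ordered by abscissa.
    [vinf] does not occur in the conclusion because the arc is the only edge through it. *)
Lemma gam_overlap e e' s t : 0 <= s <= 1 -> 0 <= t <= 1 -> gam e s = gam e' t ->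
  e = e' \/ exists n, gam e s = vtx n.
Proof.
move=> s01 t01 E.
have := gam_level e s01; have := gam_level e' t01; rewrite -E /=.
set p := edge_pt _ _.
case=> [[p2 [n [-> pn]]]|[p2 ->]|[p2 h]] [[p2' [n' [-> pn']]]|[p2' ->]|[p2' h']].
- by left; congr pair; apply: (@px_inj R); rewrite -pn.
- by exfalso; lra.
- by exfalso; lra.
- by exfalso; lra.
- by left.
- by exfalso; lra.
- by exfalso; lra.
- by exfalso; lra.
case: h' => [h'|h'|[m me]]; first by right.
  left; have [-> _] := gam_eq_vinf s01 h'.
  by have [-> _] := gam_eq_vinf t01 (esym (etrans (esym h') E)).
case: h => [h|h|[n ne]]; first by right.
  left; have [-> _] := gam_eq_vinf s01 h.
  by have [-> _] := gam_eq_vinf t01 (esym (etrans (esym h) E)).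
have [mn|mn] := eqVneq m n; [by left; rewrite me ne mn|right].
have px1 : p.1 = px m.+1 + s * (px m - px m.+1) by rewrite /p me /= clampE.
have px2 : p.1 = px n.+1 + t * (px n - px n.+1).
  by move: (congr1 (fun y : Y R => (\val y).1) E); rewrite /= -/p ne /= clampE.
have vE k : p.1 = px k -> gam e s = vtx k.
  move=> pk; apply: val_inj; rewrite val_vtx -pk [LHS]/= -/p.
  by rewrite -p2'; case: (p).
have lo k (u : R) : 0 <= u <= 1 -> (px k.+1 : R) <= px k.+1 + u * (px k - px k.+1) <= px k.
  move=> /andP[u0 u1]; have : px k.+1 <= px k :> R by rewrite lepx.
  by move=> *; apply/andP; split; nra.
have := lo m s s01; have := lo n t t01; rewrite -px1 -px2 => /andP[a1 a2] /andP[b1 b2].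
move: mn; rewrite neq_ltn => /orP[mn|nm].
  exists m.+1; apply: vE; apply/eqP; rewrite eq_le b1 andbT (le_trans a2)//.
  by rewrite lepx.
exists n.+1; apply: vE; apply/eqP; rewrite eq_le a1 andbT (le_trans b2)//.
by rewrite lepx.
Qed.

(** The tail of the comb. It is not a neighbourhood of [vinf], because the arc ends there too.
    [vtx N] belongs to it as the end of [(false, N.+1)]. *)
Definition small (N : nat) : set (Y R) :=
  [set y | y = vinf \/ exists e t, [/\ (N < e.2)%N, 0 <= t <= 1 & y = gam e t]].

(** Closedness becomes visible in this form. There are two pieces because the base of the tail
    starts at [px N] but its teeth only at [px N.+1]. *)
Lemma smallE N : small N = [set y | 0 <= (\val y).2 /\ (\val y).1 <= px N.+1] `|`
  [set y | (\val y).2 = 0 /\ (\val y).1 <= px N].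
Proof.
apply/seteqP; split=> [y [->|[e [t [Ne t01 ->]]]]|y].
- by left; split; rewrite val_vinf /= ?lexx// ltW// px_gt.
- move: t01 => /andP[t0 t1]; case: e Ne => -[n|[|n]] //= Ne.
    left; rewrite /= clampE ?t0//; split; first exact: divr_ge0.
    by rewrite lepx.
  right; rewrite /= clampE ?t0//; split=> //.
  have : px n.+1 <= px n :> R by rewrite lepx.
  have : px n <= px N :> R by rewrite lepx -ltnS.
  by move=> *; nra.
have [e [t [t01 ->]]] := gam_cover y.
have vN n : px n <= px N :> R -> small N (vtx n).
  rewrite lepx => Nn; right; exists (false, n.+1), 1.
  by rewrite lexx ler01 gam1; split.
move=> yN; have {yN} [y2 yN yn] : [/\ 0 <= (\val (gam e t)).2, (\val (gam e t)).1 <= px N &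
    0 < (\val (gam e t)).2 -> (\val (gam e t)).1 <= px N.+1].
  case: yN => -[h1 h2]; split=> //; last by rewrite h1 ltxx.
    by rewrite (le_trans h2)// lepx.
  by rewrite h1.
have [[p2 [n [eE pn]]]|[p2 _]|[p2 h]] := gam_level e t01.
- right; exists e, t; split=> //; rewrite eE /=.
  by have := yn p2; rewrite pn lepx.
- by move: p2; rewrite ltNge y2.
case: h => [[n h]|h|[n eE]]; [|by left|].
  by rewrite h; apply: vN; rewrite h val_vtx in yN.
have [Nn|nN] := leqP N n; first by right; exists e, t; split=> //; rewrite eE.
move: yN; rewrite eE /= clampE// => yN.
have [t0|t0] := eqVneq t 0.
  by rewrite t0 gam0; apply: vN; rewrite t0 mul0r addr0 in yN.
have : px n.+1 < px n.+1 + t * (px n - px n.+1) :> R.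
  rewrite ltrDl mulr_gt0 ?subr_gt0 ?ltpx// lt_neqAle eq_sym t0.
  by case/andP: t01.
move=> /lt_le_trans/(_ yN); rewrite ltpx.
by rewrite ltnNge nN.
Qed.

Lemma small_closed N : closed (small N).
Proof.
have c1 : continuous (fun y : Y R => (\val y).1 : R).
  move=> x; apply/(@ball_cvg R (Y R) R) => r r0; exists r => // y.
  by rewrite ball_mdist; exact: le_lt_trans (mdist1 _ _).
have c2 : continuous (fun y : Y R => (\val y).2 : R).
  move=> x; apply/(@ball_cvg R (Y R) R) => r r0; exists r => // y.
  by rewrite ball_mdist; exact: le_lt_trans (mdist2 _ _).
have cP (f : Y R -> R) (D : set R) : continuous f -> closed D -> closed (f @^-1` D).
  by move=> cf cD; apply: preimage_closed cD => y _; exact: cf.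
rewrite smallE; apply: closedU; apply: closedI.
- exact: (cP _ _ c2 (@closed_ge R 0)).
- exact: (cP _ _ c1 (@closed_le R (px N.+1))).
- exact: (cP _ _ c2 (@closed_eq R 0)).
- exact: (cP _ _ c1 (@closed_le R (px N))).
Qed.

Lemma small_diam (r : R) : 0 < r -> exists N, forall y z, small N y -> small N z ->
  mdist y z < r.
Proof.
(* The tail then has width at most [r / 2] and height at most [r / 4]. *)
move=> r0; have [N] := ltr_add_invr (divr_gt0 r0 (ltr0n R 4)); rewrite add0r => Nr.
have b1 y : small N y -> -1 <= (\val y).1 <= -1 + r / 2.
  move=> sy; apply/andP; split.
    have [e [t [/andP[t0 t1] ->]]] := gam_cover y.
    rewrite /= clampE ?t0//; case: e => -[n|[|n]] /=; first exact: ltW (px_gt _).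
      by lra.
    rewrite (le_trans (ltW (px_gt n.+1)))// lerDl mulr_ge0// subr_ge0 lepx.
    exact: leqnSn.
  apply: (@le_trans _ _ (px N)).
    move: sy; rewrite smallE => -[[_ h]|[_ //]].
    by rewrite (le_trans h)// lepx.
  by move: Nr; rewrite /px; move: (N.+1%:R^-1) => i; lra.
have b2 y : small N y -> 0 <= (\val y).2 <= r / 4.
  move=> [->|[e [t [Ne t01 ->]]]]; first by rewrite val_vinf lexx/= ltW// divr_gt0.
  rewrite /= clampE//; move: t01 => /andP[t0 t1].
  case: e Ne => -[n|[//|n]] /= Ne; last by rewrite lexx ltW// divr_gt0.
  rewrite divr_ge0//= (le_trans _ (ltW Nr))// (@le_trans _ _ n.+1%:R^-1)//.
    by rewrite ler_pdivrMr// mulVf.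
  by rewrite lef_pV2 ?posrE// ler_nat ltnW.
exists N => y z sy sz; rewrite (le_lt_trans (mdist_le12 _ _))//.
have := b1 y sy; have := b1 z sz; have := b2 y sy; have := b2 z sz.
move=> /andP[? ?] /andP[? ?] /andP[? ?] /andP[? ?].
have h1 : `|(\val y).1 - (\val z).1| <= r / 2 by rewrite ler_norml; apply/andP; split; lra.
have h2 : `|(\val y).2 - (\val z).2| <= r / 4 by rewrite ler_norml; apply/andP; split; lra.
by lra.
Qed.

Lemma vtx_small n N : small N (vtx n) <-> (N <= n)%N.
Proof.
have E1 : (\val (vtx n)).1 = px n by rewrite val_vtx.
have E2 : (\val (vtx n)).2 = 0 by rewrite val_vtx.
rewrite smallE; split=> [[[_]|[_]]|Nn]; rewrite ?E1 ?lepx//; first exact: ltnW.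
by right; rewrite /mkset E1 E2 lepx.
Qed.

End vertices.

(** * Closed and open sets made of pieces of edges *)

Section edges_topology.
Context {R : realType}.
Implicit Types (m n N : nat) (t s : R) (e : bool * nat) (y z : Y R).

Lemma closed_edge_image e (D : set R) : closed D ->
  closed [set y | exists t, [/\ 0 <= t <= 1, D t & y = gam e t]].
Proof.
move=> cD.
have -> : [set y | exists t, [/\ 0 <= t <= 1, D t & y = gam e t]] =
    gam e @` (`[0, 1] `&` D).
  apply/seteqP; split=> [y [t [t01 Dt ->]]|_ [t [t01 Dt] <-]].
    by exists t => //; split => //; rewrite /= in_itv.
  by exists t; split => //; rewrite /= in_itv in t01.
apply: compact_closed; first exact: metric_hausdorff.
apply: continuous_compact; last exact: compact_closedI (@segment_compact R 0 1) cD.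
by apply: continuous_subspaceT => x; exact: gam_continuous.
Qed.

(** A tail together with closed pieces of finitely many edges is closed; the open sets used below
    are complements of such sets. *)
Lemma closed_edges N (D : bool * nat -> set R) : (forall e, closed (D e)) ->
  closed [set y | exists e t, [/\ (e.2 <= N)%N, 0 <= t <= 1, D e t & y = gam e t]].
Proof.
move=> cD.
rewrite (_ : [set y | _] = \bigcup_(e in [set e : bool * nat | (e.2 <= N)%N])
    [set y | exists t, [/\ 0 <= t <= 1, D e t & y = gam e t]]).
  apply: closed_bigcup => [|e _]; last exact: closed_edge_image.
  apply: (sub_finite_set _ (finite_setX (@finite_finset bool setT) (finite_II N.+1))).
  by move=> -[b n] /= nN; split => //=; rewrite inE.
apply/seteqP; split=> [y [e [t [eN t01 Dt ->]]]|y [e eN [t [t01 Dt ->]]]].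
  by exists e => //; exists t.
by exists e, t.
Qed.

Lemma small_or_edge N y : small N y \/
  exists e t, [/\ (e.2 <= N)%N, 0 <= t <= 1 & y = gam e t].
Proof.
have [e [t [t01 ->]]] := gam_cover y.
have [eN|Ne] := leqP e.2 N; first by right; exists e, t.
by left; right; exists e, t.
Qed.

(* The parameters of the ends of [e] that are vertices of Y; the free tip of a
   tooth is not one of them. *)
Definition at_end e t := t = 0 \/ (e.1 = false /\ t = 1).

Lemma vtx_at_end e t n : 0 <= t <= 1 -> gam e t = vtx n -> at_end e t.
Proof.
by move=> t01 /(gam_eq_vtx t01)[] [-> ->]; [left|left|right].
Qed.

Lemma vinf_at_end e t : 0 <= t <= 1 -> gam e t = vinf -> at_end e t.
Proof. by move=> t01 /(gam_eq_vinf t01)[-> ->]; right. Qed.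

Lemma overlap_at_end e e' s t : 0 <= s <= 1 -> 0 <= t <= 1 ->
  gam e s = gam e' t -> e = e' \/ at_end e s.
Proof.
move=> s01 t01 /(gam_overlap s01 t01)[]; first by left.
by move=> [n /(vtx_at_end s01)]; right.
Qed.

Lemma open_edge_part e (D : set R) : closed D -> (forall t, at_end e t -> D t) ->
  open [set y | exists t, [/\ 0 <= t <= 1, ~ D t & y = gam e t]].
Proof.
move=> cD De; rewrite -[X in open X]setCK; apply: closed_openC.
rewrite (_ : ~` _ = small e.2 `|` [set y | exists e' t,
    [/\ (e'.2 <= e.2)%N, 0 <= t <= 1, (if e' == e then D else setT) t & y = gam e' t]]).
  apply: closedU; first exact: small_closed.
  by apply: closed_edges => e'; case: eqP => // _; exact: closedT.
apply/seteqP; split=> y.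
  move=> nO; have [e' [t [t01 yE]]] := gam_cover y.
  have [ee'|ee'] := leqP e'.2 e.2; last by left; right; exists e', t.
  right; exists e', t; split=> //; case: eqP => // e'e.
  by apply: contrapT => nD; apply: nO; exists t; rewrite -e'e.
move=> yE [t [t01 nD yt]]; have {}De : ~ at_end e t by move=> /De.
rewrite yt in yE.
case: yE => [[/(vinf_at_end t01)/De//|[e' [s [ee' s01 E]]]]|[e' [s [ee' s01 Ds E]]]].
  have [h|/De//] := overlap_at_end t01 s01 E.
  by rewrite h ltnn in ee'.
have [h|/De//] := overlap_at_end t01 s01 E.
rewrite -h in E; rewrite -h eqxx in Ds.
by case: nD; rewrite (gam_inj t01 s01 E).
Qed.

End edges_topology.

(** * Homeomorphisms of Y preserve the edges *)

Section rigidity.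
Context {R : realType}.
Implicit Types (m n N : nat) (t s : R) (e : bool * nat) (y z : Y R)
  (h : homeo (Y R)).

Lemma paths_meet (u v : R -> R) (r : R) : continuous v -> 0 < r ->
  u 0 = v 0 -> u 0 < u r -> u r <= v r -> exists2 s, 0 < s <= r & u r = v s.
Proof.
move=> cv r0 uv ur urvr.
have [||s /[!in_itv]/= /andP[s0 sr] vs] := @IVT R v 0 r (u r) (ltW r0).
- exact: continuous_subspaceT.
- by rewrite minEle maxEle -uv (le_trans (ltW ur) urvr) (ltW ur) urvr.
exists s => //; rewrite sr andbT lt_neqAle s0 andbT; apply/eqP => s_0.
by move: ur; rewrite -vs -s_0 -uv ltxx.
Qed.

(** Two of the three paths end on the same side of the common starting value. By the intermediate
    value theorem, the one that goes farther passes through the end of the other. *)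
Lemma no_triod (u : 'I_3 -> R -> R) (r : R) : (forall i, continuous (u i)) ->
  0 < r -> (forall i j, u i 0 = u j 0) ->
  (forall i j s t, i != j -> 0 <= s <= r -> 0 <= t <= r -> u i s = u j t ->
    s = 0 /\ t = 0) -> False.
Proof.
move=> cu r0 u0 u_inj.
have r0r : 0 <= r <= r by rewrite lexx ltW.
have up i j : i != j -> u i 0 < u i r -> u j 0 < u j r -> False.
  wlog le : i j / u i r <= u j r => [H ij ui uj|ij ui uj].
    have [le|/ltW le] := leP (u i r) (u j r); first exact: H le ij ui uj.
    by apply: H le _ uj ui; rewrite eq_sym.
  have [s /andP[s0 sr] E] := paths_meet (cu j) r0 (u0 i j) ui le.
  have [|r_0 _] := u_inj i j r s ij r0r _ E; first by rewrite ltW.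
  by rewrite r_0 ltxx in r0.
have down i j : i != j -> u i r < u i 0 -> u j r < u j 0 -> False.
  wlog le : i j / u j r <= u i r => [H ij ui uj|ij ui uj].
    have [le|/ltW le] := leP (u j r) (u i r); first exact: H le ij ui uj.
    by apply: H le _ uj ui; rewrite eq_sym.
  have cN : continuous (- u j) by move=> x; apply: cvgN; exact: cu.
  have [|||s /andP[s0 sr] /oppr_inj E] := @paths_meet (- u i) (- u j) r cN r0.
  - by rewrite /GRing.opp/= (u0 i j).
  - by rewrite ltrN2.
  - by rewrite lerN2.
  have [|r_0 _] := u_inj i j r s ij r0r _ E; first by rewrite ltW.
  by rewrite r_0 ltxx in r0.
have neq i : u i r != u i 0.
  have [j ij] : exists j : 'I_3, i != j.
    by have [->|i0] := eqVneq i ord0; [exists ord_max|exists ord0].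
  apply/eqP => E; have [||r_0 _] := u_inj i j r 0 ij r0r.
  - by rewrite lexx ltW.
  - by rewrite E; exact: u0.
  by rewrite r_0 ltxx in r0.
pose a : 'I_3 := ord0; pose b : 'I_3 := inord 1; pose c : 'I_3 := ord_max.
have ab : a != b by rewrite -val_eqE /= inordK.
have ac : a != c by [].
have bc : b != c by rewrite -val_eqE /= inordK.
have := neq a; have := neq b; have := neq c; rewrite !neq_lt.
move=> /orP[hc|hc] /orP[hb|hb] /orP[ha|ha];
  by [exact: down ab ha hb | exact: down ac ha hc | exact: down bc hb hc
     | exact: up ab ha hb | exact: up ac ha hc | exact: up bc hb hc].
Qed.

(** The free tip of a tooth is included: all that matters is that the set is open, contains no
    vertex and embeds in the line. *)
Definition inner_edge e :=
  [set y | exists t, [/\ 0 <= t <= 1, ~ at_end e t & y = gam e t]].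

Lemma open_inner_edge e : open (inner_edge e).
Proof.
apply: open_edge_part; last by [].
rewrite (_ : at_end e = [set 0] `|` (if e.1 then set0 else [set 1])).
  by apply: closedU; [exact: closed_eq|case: (e.1); [exact: closed0|exact: closed_eq]].
apply/seteqP; split=> t; first by case=> [->|[-> ->]]; [left|right].
by case=> [->|]; [left|case: e => -[] n //= ->; right].
Qed.

Definition is_vtx y := y = vinf \/ exists n, y = vtx n.

Lemma gamE0 e : gam e 0 = vtx e.2 :> Y R.
Proof. by case: e => -[] n; rewrite ?gam0. Qed.

Lemma at_end_vtx e t : at_end e t -> is_vtx (gam e t).
Proof.
case=> [->|[e1 ->]]; first by right; exists e.2; rewrite gamE0.
case: e e1 => b [|n] /= ->; first by left.
by right; exists n; rewrite gam1.
Qed.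

Lemma vtx_atend e t : 0 <= t <= 1 -> is_vtx (gam e t) -> at_end e t.
Proof.
by move=> t01 [/(vinf_at_end t01)|[n /(vtx_at_end t01)]].
Qed.

Lemma inner_edge_vtx e y : inner_edge e y -> ~ is_vtx y.
Proof. by move=> [t [t01 nt ->]] /(vtx_atend t01). Qed.

Lemma vtx_or_inner y : is_vtx y \/ exists e, inner_edge e y.
Proof.
have [e [t [t01 ->]]] := gam_cover y.
have [/at_end_vtx|nt] := pselect (at_end e t); first by left.
by right; exists e, t.
Qed.

Lemma inner_edge_uniq e e' y : inner_edge e y -> inner_edge e' y -> e = e'.
Proof.
move=> [t [t01 nt ->]] [s [s01 ns E]].
by have [] := overlap_at_end t01 s01 E.
Qed.

Lemma homeo_inj h : injective h.
Proof. exact: can_inj (homeo_funK h). Qed.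

(** Otherwise the inverse homeomorphism would carry the beginnings of the three edges at [vtx n]
    into [inner_edge e], where [coo e] turns them into a triod in the line. *)
Lemma vtx_preimage h e y n : inner_edge e y -> h y <> vtx n.
Proof.
move=> Oy hy; pose k := homeo_inv h.
have kv : k (vtx n) = y by rewrite -hy /k homeo_funK.
(* The third edge arrives at the vertex with parameter 1, so [pa] reverses it. *)
pose ed (i : 'I_3) := if val i == 0%N then (true, n) else
  if val i == 1%N then (false, n) else (false, n.+1).
pose pa (i : 'I_3) s := if val i == 2%N then 1 - s else s.
have ed_inj i j : i != j -> ed i != ed j.
  case: i j => -[|[|[|//]]] ? [[|[|[|//]]] ?] //=; rewrite /ed /=.
  - by move=> _; apply/eqP => -[]; lia.
  - by move=> _; apply/eqP => -[]; lia.
pose w i s := gam (ed i) (pa i s).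
have w0 i : w i 0 = vtx n.
  rewrite /w /ed /pa; case: i => -[|[|[|//]]] ? //=; first exact: gam0.
  by rewrite subr0 gam1.
have cw i : continuous (w i).
  move=> x; apply: (@continuous_comp R R (Y R) (pa i) (gam (ed i))); last exact: gam_continuous.
  rewrite /pa; case: (val i == 2%N); last exact: cvg_id.
  by apply: (@continuousB R R R (fun=> 1) id); [exact: cvg_cst|exact: cvg_id].
have ck i : continuous (k \o w i).
  move=> x; apply: continuous_comp; first exact: cw.
  exact: homeo_inv_continuous.
have w_inj i j s t : i != j -> 0 <= s < 1 -> 0 <= t < 1 -> w i s = w j t ->
    s = 0 /\ t = 0.
  have wv l r m : 0 <= r < 1 -> w l r = vtx m -> r = 0.
    move=> /andP[r0 r1]; rewrite /w => E.
    have r01 : 0 <= pa l r <= 1 by rewrite /pa; case: ifP => _; apply/andP; split; lra.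
    have := gam_eq_vtx r01 E; rewrite /ed /pa; case: l {E r01} => -[|[|[|//]]] ? /=.
    - by case=> -[].
    - by case=> -[_] // => r_1; lra.
    - by case=> -[_] // => r_1; lra.
  move=> ij s01 t01 E.
  have s01' : 0 <= pa i s <= 1.
    by move: s01 => /andP[? ?]; rewrite /pa; case: ifP => _; apply/andP; split; lra.
  have t01' : 0 <= pa j t <= 1.
    by move: t01 => /andP[? ?]; rewrite /pa; case: ifP => _; apply/andP; split; lra.
  have [eij|[m wm]] := gam_overlap s01' t01' E.
    by have := ed_inj i j ij; rewrite eij eqxx.
  split; first exact: wv s01 wm.
  by apply: (wv j t m t01); rewrite -E; exact: wm.
have near0 i : exists2 d, 0 < d & forall s, 0 <= s < d -> inner_edge e (k (w i s)).
  have : nbhs (k (w i 0)) (inner_edge e).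
    by rewrite w0 kv; apply: open_nbhs_nbhs; split; [exact: open_inner_edge|].
  move=> /(ck i 0) /nbhs_ballP[d /= d0 dP]; exists d => // s /andP[s0 sd].
  by apply: dP; rewrite /ball/= sub0r normrN ger0_norm.
have [r [r0 r1 rP]] : exists r, [/\ 0 < r, r < 1 &
    forall i s, 0 <= s <= r -> inner_edge e (k (w i s))].
  have [d0 d00 d0P] := near0 ord0.
  have [d1 d10 d1P] := near0 (inord 1).
  have [d2 d20 d2P] := near0 ord_max.
  pose d := Num.min 1 (Num.min d0 (Num.min d1 d2)).
  have dpos : 0 < d by rewrite !lt_min ltr01 d00 d10.
  have d_1 : d <= 1 by rewrite ge_min lexx.
  have d_0 : d <= d0 by rewrite !ge_min lexx orbT.
  have d_1' : d <= d1 by rewrite !ge_min lexx !orbT.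
  have d_2 : d <= d2 by rewrite !ge_min lexx !orbT.
  exists (d / 2); split; [lra|lra|] => i s /andP[s0 sd].
  have : [\/ i = ord0, i = inord 1 | i = ord_max].
    case: i => -[|[|[|//]]] ?; [apply: Or31|apply: Or32|apply: Or33];
      by apply: val_inj; rewrite //= inordK.
  by case=> ->; [apply: d0P|apply: d1P|apply: d2P]; apply/andP; split; lra.
have uE i s : 0 <= s <= r -> k (w i s) = gam e (coo e (k (w i s))).
  by move=> /(rP i) [t [t01 _ ->]]; rewrite cooK clampE.
apply: (@no_triod (fun i s => coo e (k (w i s))) r) => //.
- move=> i x; apply: (@continuous_comp R (Y R) R (k \o w i) (coo e)).
    exact: ck.
  exact: coo_continuous.
- by move=> i j; rewrite !w0.
move=> i j s t ij sr tr E.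
have := congr1 (gam e) E; rewrite -uE// -uE// => /(can_inj (homeo_invK h)).
move: sr tr => /andP[? ?] /andP[? ?].
by apply: w_inj => //; apply/andP; split => //; exact: le_lt_trans r1.
Qed.

Lemma homeo_vtx h n : is_vtx (h (vtx n)).
Proof.
have [//|[e /(@vtx_preimage (homeoV h) _ _ n)]] := vtx_or_inner (h (vtx n)).
by rewrite /= homeo_funK.
Qed.

End rigidity.

(** * Vertices are fixed and edges are invariant *)

Section edges_preserved.
Context {R : realType}.
Implicit Types (m n N : nat) (t s : R) (e : bool * nat) (y z : Y R)
  (h : homeo (Y R)).

Lemma vtx_cvg : vtx n @[n --> \oo] --> (vinf : Y R).
Proof.
apply/cvg_ballP => r r0; have [N NP] := small_diam r0.
exists N => // n /= Nn; rewrite ball_mdist; apply: NP; first by left.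
exact/vtx_small.
Qed.

(** The image is a limit of the pairwise distinct vertices [h (vtx n)], while points of inner edges
    and vertices other than [vinf] have neighbourhoods with at most one vertex. *)
Lemma homeo_vinf h : h vinf = vinf.
Proof.
have hv U : nbhs (h vinf) U -> exists N, forall n, (N <= n)%N -> U (h (vtx n)).
  by move=> /(@homeo_fun_continuous _ _ h vinf)/vtx_cvg[N _ NP]; exists N.
have [[//|[m hm]]|[e Oe]] := vtx_or_inner (h vinf); last first.
  have : nbhs (h vinf) (inner_edge e).
    by apply: open_nbhs_nbhs; split; [exact: open_inner_edge|].
  move=> /hv[N NP]; have := NP N (leqnn N).
  by move=> /inner_edge_vtx; case; exact: homeo_vtx.
(* The feet of the teeth of index at most [m], other than the one at [vtx m], are removed; the tail
   beyond removes all later vertices. *)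
pose D (e : bool * nat) : set R := if e.1 && (e.2 != m) then [set 0] else set0.
pose O := ~` (small m.+1 `|`
  [set y | exists e t, [/\ (e.2 <= m)%N, 0 <= t <= 1, D e t & y = gam e t]]).
have oO : open O.
  apply: closed_openC; apply: closedU; first exact: small_closed.
  apply: closed_edges => e; rewrite /D; case: ifP => _; first exact: closed_eq.
  exact: closed0.
have OE y : O y -> is_vtx y -> y = vtx m.
  move=> Oy [yE|[n yE]]; first by exfalso; apply: Oy; left; left.
  have [nm|nm] := eqVneq n m; first by rewrite yE nm.
  have [mn|mn] := leqP m.+1 n.
    by exfalso; apply: Oy; left; rewrite yE; exact/vtx_small.
  exfalso; apply: Oy; right; exists (true, n), 0; rewrite /D /= nm lexx ler01.
  by split.
have Om : O (vtx m).
  case=> [/vtx_small|[[b n] [t [em t01]]]]; first by rewrite ltnn.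
  rewrite /D; case: ifP => // /andP[b1 nm] ->; rewrite gamE0 => /vtx_inj mn.
  by rewrite mn eqxx in nm.
have [|N NP] := hv O; first by apply: open_nbhs_nbhs; rewrite hm.
have := OE _ (NP _ (leqnn N)) (homeo_vtx h N).
rewrite -(OE _ (NP _ (leqnSn N)) (homeo_vtx h N.+1)) => /(@homeo_inj _ h) /vtx_inj.
by move/eqP; rewrite ltn_eqF.
Qed.

Lemma homeo_inner h e t : 0 <= t <= 1 -> ~ at_end e t -> ~ is_vtx (h (gam e t)).
Proof.
move=> t01 te; have Ot : inner_edge e (gam e t : Y R) by exists t.
move=> [|[n]]; last exact: vtx_preimage Ot.
rewrite -{1}(homeo_vinf h) => /(@homeo_inj _ h) E.
by apply: te; exact: vinf_at_end E.
Qed.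

(** The image of the open edge is connected and is covered by the inner edges, which are open and
    disjoint, so it lies in one of them. The ends follow because a closed edge is closed. *)
Lemma homeo_edge h e : exists e', forall t, 0 <= t <= 1 ->
  exists2 s, 0 <= s <= 1 & h (gam e t) = gam e' s.
Proof.
pose C := (h \o gam e) @` `]0, 1[.
have chg : continuous (h \o gam e : R -> Y R).
  move=> x; apply: continuous_comp; first exact: gam_continuous.
  exact: homeo_fun_continuous.
have cC : connected C.
  apply: connected_continuous_connected; last exact: continuous_subspaceT.
  by apply/connected_intervalP; exact: interval_is_interval.
have Cin y : C y -> exists e', inner_edge e' y.
  move=> [t /= /[!in_itv]/= /andP[t0 t1] <-].
  have [|//] := vtx_or_inner (h (gam e t)).
  move=> /homeo_inner; case; first by rewrite !ltW.
  by case=> [t_0|[_ t_1]]; lra.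
have C0 : C (h (gam e (1 / 2))).
  by exists (1 / 2) => //; rewrite /= in_itv/=; apply/andP; split; lra.
have [e' Oe'] := Cin _ C0.
have CO : C `&` inner_edge e' = C.
  apply: cC; first by exists (h (gam e (1 / 2))).
    by exists (inner_edge e') => //; exact: open_inner_edge.
  exists (~` \bigcup_(e'' in [set e'' | e'' != e']) inner_edge e'').
    by apply: open_closedC; apply: bigcup_open => e'' _; exact: open_inner_edge.
  apply/seteqP; split=> y [Cy Oy]; split=> //.
    by move=> [e'' /= /eqP ee] /(inner_edge_uniq Oy)/esym.
  have [e'' Oe''] := Cin _ Cy; have [<-//|ee] := eqVneq e'' e'.
  by exfalso; apply: Oy; exists e''.
pose E : set (Y R) := [set y | exists t, [/\ 0 <= t <= 1, setT t & y = gam e' t]].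
have cE : closed ((h \o gam e) @^-1` E).
  apply: preimage_closed => [x _|]; first exact: chg.
  exact: closed_edge_image closedT.
exists e' => t /andP[t0 t1].
suff [s [s01 _ ->]] : E (h (gam e t)) by exists s.
apply: cE => B /nbhs_ballP[r /= r0 rB].
pose q := Num.min (1 / 3) (r / 3).
have q0 : 0 < q by rewrite lt_min !divr_gt0.
have q1 : q <= 1 / 3 by rewrite ge_min lexx.
have qr : q <= r / 3 by rewrite ge_min lexx orbT.
(* [t] is pushed towards 1/2 by at most [q], which puts it in the open interval even if it is an
   end. *)
exists (t + q * (1 - 2 * t)); split; last first.
  by apply: rB; rewrite /ball/= ltr_norml; apply/andP; split; nra.
have : C (h (gam e (t + q * (1 - 2 * t)))).
  by exists (t + q * (1 - 2 * t)) => //; rewrite /= in_itv/=; apply/andP; split; nra.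
by rewrite -CO => -[_ [s [s01 _ sE]]]; exists s.
Qed.

(** Adjacency propagates along the chain of base edges. The arc is preserved because [vinf] is
    fixed, so its other end [vtx 0] is fixed; then [vtx n.+1] goes to a neighbour of [vtx n], and
    injectivity leaves only the one with the larger index. *)
Lemma homeo_vtx_fix h n : h (vtx n) = vtx n.
Proof.
elim/ltn_ind: n => n IH.
have vtxN m : h (vtx m) <> vinf.
  by rewrite -(homeo_vinf h) => /(@homeo_inj _ h)/vtx_neq_inf.
case: n IH => [_|n IH].
  have [e' e'P] := homeo_edge h (false, 0%N).
  have [|s s01 hs] := e'P 1; first by rewrite lexx ler01.
  rewrite -/(@vinf R) homeo_vinf in hs.
  have [e'E _] := gam_eq_vinf s01 (esym hs).
  have [|s' s'01] := e'P 0; first by rewrite lexx ler01.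
  rewrite gamE0 /= e'E => hs'.
  have [/vtxN//|[m hm]] := homeo_vtx h 0.
  rewrite hs' in hm *.
  have := gam_eq_vtx s'01 hm.
  by case=> -[// [mE] s'E]; rewrite s'E gamE0.
have [e' e'P] := homeo_edge h (false, n.+1).
have [|s s01 hs] := e'P 1; first by rewrite lexx ler01.
rewrite gam1 IH// in hs.
have [|s' s'01 hs'] := e'P 0; first by rewrite lexx ler01.
rewrite gamE0 /= in hs'.
have [/vtxN//|[m hm]] := homeo_vtx h n.+1.
have nm : (n < m)%N.
  rewrite ltnNge; apply/negP => mn.
  have : h (vtx m) = h (vtx n.+1) by rewrite IH.
  move=> /(@homeo_inj _ h)/vtx_inj mE.
  by rewrite mE ltnn in mn.
rewrite hm; congr vtx.
have := gam_eq_vtx s01 (esym hs); rewrite hm in hs'.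
have := gam_eq_vtx s'01 (esym hs').
by case=> -[-> _] [] [[]]; lia.
Qed.

(** A base edge is determined by its two ends, which are fixed. The image of a tooth contains its
    foot; if it were inside a base edge, the inverse, which preserves that edge, would bring points
    of the tooth into it. *)
Lemma homeo_edge_same h e t : 0 <= t <= 1 ->
  exists2 s, 0 <= s <= 1 & h (gam e t) = gam e s.
Proof.
have base k n u : 0 <= u <= 1 -> exists2 s, 0 <= s <= 1 &
    (k : homeo (Y R)) (gam (false, n) u) = gam (false, n) s.
  have [e' e'P] := homeo_edge k (false, n).
  move=> u01; suff e'E : e' = (false, n) by move: (e'P u u01); rewrite e'E.
  have [|s s01 ks] := e'P 0; first by rewrite lexx ler01.
  have [|s' s'01 ks'] := e'P 1; first by rewrite lexx ler01.
  case: n ks ks' {e'P} => [|n] ks ks'.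
    rewrite -/(@vinf R) homeo_vinf in ks'.
    by have [-> _] := gam_eq_vinf s'01 (esym ks').
  rewrite gamE0 homeo_vtx_fix /= in ks; rewrite gam1 homeo_vtx_fix in ks'.
  have := gam_eq_vtx s01 (esym ks); have := gam_eq_vtx s'01 (esym ks').
  by case=> -[-> _] [] [/eqP + _]; rewrite xpair_eqE //= => ?; exfalso; lia.
case: e => -[] n; last exact: base.
have [e' e'P] := homeo_edge h (true, n).
move=> t01; suff e'E : e' = (true, n) by move: (e'P t t01); rewrite e'E.
have [|s s01 hs] := e'P 0; first by rewrite lexx ler01.
rewrite gamE0 homeo_vtx_fix /= in hs.
have e'n : e' = (true, n) \/ exists k, e' = (false, k).
  by have := gam_eq_vtx s01 (esym hs) => -[] [-> _]; [left|right; exists n|right; exists n.+1].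
case: e'n => // -[k ek].
have [|s' s'01 hs'] := e'P (1 / 2); first by apply/andP; split; lra.
have := base (homeoV h) k s' s'01; rewrite -ek -hs' /= homeo_funK => -[r r01].
move=> /overlap_at_end []//; first by apply/andP; split; lra.
by case=> [h0|[//]]; exfalso; lra.
Qed.

Theorem homeo_on_edges h : exists F : bool * nat -> uhomeo R,
  forall e t, h (gam e t) = gam e (F e t).
Proof.
suff /choice[F FP] e : exists F : uhomeo R, forall t, h (gam e t) = gam e (F t).
  by exists F.
pose f k t := if 0 <= t <= 1 then coo e ((k : homeo (Y R)) (gam e t)) else t.
have fin k t : 0 <= t <= 1 -> 0 <= f k t <= 1 /\ k (gam e t) = gam e (f k t).
  move=> t01; have [s s01 ks] := homeo_edge_same k e t01.
  by rewrite /f t01 ks cooK clampE.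
have fout k t : ~~ (0 <= t <= 1) -> f k t = t by rewrite /f => /negPf ->.
have fK (k l : homeo (Y R)) : cancel k l -> cancel (f k) (f l).
  move=> kl t; have [t01|t01] := boolP (0 <= t <= 1); last by rewrite (fout k)// fout.
  have [kt01 kt] := fin k t t01; have [lt01 lt] := fin l _ kt01.
  by apply: (@gam_inj _ e) => //; rewrite -lt -kt kl.
have f0 k : f k 0 = 0.
  have [|k0 kE] := fin k 0; first by rewrite lexx ler01.
  apply: (@gam_inj _ e) => //; first by rewrite lexx ler01.
  by rewrite -kE gamE0 homeo_vtx_fix.
have fc (k : homeo (Y R)) : continuous (coo e \o (k \o gam e) : R -> R).
  move=> x; apply: (@continuous_comp R (Y R) R); last exact: coo_continuous.
  apply: (@continuous_comp R (Y R) (Y R) (gam e) k); first exact: gam_continuous.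
  exact: (@homeo_fun_continuous _ _ k).
(* The map starts at 0; if it were not larger at [t] than at [s], its value at [t] would already be
   taken on [0, s], against injectivity. *)
have fh01 k s t : 0 <= s <= 1 -> 0 <= t <= 1 -> s < t -> f k s < f k t.
  move=> s01 t01 st; rewrite ltNge; apply/negP => ts.
  have [ks01 _] := fin k s s01; have [kt01 _] := fin k t t01.
  case/andP: (s01) => s0 s1.
  have [||c /[!in_itv]/= /andP[c0 cs] fcE] :=
      @IVT R (coo e \o (k \o gam e)) 0 s (f k t) s0.
  - exact: continuous_subspaceT.
  - have E u : 0 <= u <= 1 -> (coo e \o (k \o gam e)) u = f k u by rewrite /f => ->.
    rewrite !E ?lexx ?ler01// f0 minEle maxEle; case/andP: ks01 => -> _.
    by case/andP: kt01 => ->.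
  have c01 : 0 <= c <= 1 by rewrite c0 (le_trans cs).
  have cE : f k c = f k t by rewrite -fcE /f c01.
  have := can_inj (fK k (homeoV k) (homeo_funK k)) cE => ct.
  by move: st; rewrite -ct ltNge cs.
have fh k : {homo f k : s t / s < t}.
  move=> s t st.
  have [s01|s01] := boolP (0 <= s <= 1); have [t01|t01] := boolP (0 <= t <= 1).
  - exact: fh01.
  - rewrite (fout k t)//; have [/andP[_ ?] _] := fin k s s01.
    by move: t01 s01; rewrite negb_and -!ltNge => /orP[?|?] /andP[? ?]; lra.
  - rewrite (fout k s)//; have [/andP[? _] _] := fin k t t01.
    by move: t01 s01; rewrite negb_and -!ltNge => /andP[? ?] /orP[?|?]; lra.
  - by rewrite !fout.
have fo k t : t <= 0 \/ 1 <= t -> f k t = t.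
  case=> [t0|t1].
    have [/andP[t0' _]|/fout//] := boolP (0 <= t <= 1).
    by have -> : t = 0 by lra.
  have [/andP[_ t1']|/fout//] := boolP (0 <= t <= 1).
  have -> : t = 1 by lra.
  (* The tip of a tooth is not a vertex, so it is fixed for another reason: if 1 were sent below 1,
     the increasing inverse would send 1 above 1. *)
  have [|k1 _] := fin k 1; first by rewrite lexx ler01.
  have [|l1 _] := fin (homeoV k) 1; first by rewrite lexx ler01.
  apply/eqP; rewrite eq_le (andP k1).2 leNgt; apply/negP => k1'.
  have := fh (homeoV k) _ _ k1'; rewrite (fK k (homeoV k) (homeo_funK k)).
  by case/andP: l1; lra.
exists (Uhomeo (fK h (homeoV h) (homeo_funK h)) (fK (homeoV h) h (homeo_invK h))
  (fh h) (fo h)) => t /=.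
rewrite -gam_clamp; have [c01 ->] := fin h _ (clamp_itv t).
have [t01|t01] := boolP (0 <= t <= 1); first by rewrite clampE.
rewrite (fout h t)// (fo h) ?gam_clamp//.
move: t01; rewrite /clamp negb_and -!ltNge => /orP[t0|t1].
  by left; rewrite max_l// ge_min ltW.
by right; rewrite le_max le_min lexx (ltW t1) orbT.
Qed.

End edges_preserved.

(** * Gluing homeomorphisms of the edges *)

Section gluing.
Context {R : realType}.
Implicit Types (m n N : nat) (t s : R) (e : bool * nat) (y z : Y R).

Definition edges_upto N : seq (bool * nat) :=
  [seq (b, n) | b <- [:: true; false], n <- iota 0 N.+1].

Lemma mem_edges_upto N e : (e \in edges_upto N) = (e.2 <= N)%N.
Proof.
case: e => b n; apply/allpairsP/idP => [[[c k] [_ kN [_ ->]]]|nN].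
  by move: kN; rewrite mem_iota add0n ltnS.
by exists (b, n); rewrite mem_iota add0n ltnS !inE; case: b nN.
Qed.

Lemma uhomeo_clamp (F : uhomeo R) t : F (clamp t) = clamp (F t).
Proof.
have [t01|t01] := boolP (0 <= t <= 1); first by rewrite !clampE// u_itv.
have out : t <= 0 \/ 1 <= t.
  by move: t01; rewrite negb_and -!ltNge => /orP[/ltW|/ltW]; auto.
rewrite (ufun_out F out); apply: ufun_out.
case: out => ?; [left|right]; rewrite /clamp.
  by rewrite max_l// ge_min; apply/orP; left.
by rewrite le_max le_min lexx andbT; apply/orP; right.
Qed.

Definition edge_map (F : bool * nat -> uhomeo R) (g : Y R -> Y R) :=
  forall e t, g (gam e t) = gam e (F e t).

(** Near [y] only the finitely many edges through [y] of index at most [N], and possibly the tail,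
    are met. The tail is mapped into itself and has small diameter, so no uniformity over all [F e]
    comes in. *)
Lemma edge_map_continuous F g : edge_map F g -> continuous g.
Proof.
move=> gF y; apply/(@ball_cvg R (Y R) (Y R)) => r r0.
have [N NP] := small_diam r0.
have gsmall z : small N z -> small N (g z).
  move=> [->|[e [t [eN t01 ->]]]].
    by left; rewrite gF u1.
  by right; exists e, (F e t); rewrite u_itv.
pose ed e : set (Y R) := [set z | exists2 t, 0 <= t <= 1 & z = gam e t].
pose D e : set R := if `[< ed e y >] then set0 else setT.
(* The closed union of those among the tail and the first edges that do not contain [y]. *)
pose Bad := (if `[< small N y >] then set0 else small N) `|`
  [set z | exists e t, [/\ (e.2 <= N)%N, 0 <= t <= 1, D e t & z = gam e t]].
have : nbhs y (~` Bad).
  apply: open_nbhs_nbhs; split.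
    apply: closed_openC; apply: closedU.
      by case: ifP => _; [exact: closed0|exact: small_closed].
    by apply: closed_edges => e; rewrite /D; case: ifP => _; [exact: closed0|exact: closedT].
  case; first by case: ifPn => // /asboolPn.
  move=> [e [t [_ t01 + yE]]]; rewrite /D; case: ifPn => // /asboolPn + _.
  by apply; exists t.
move=> /nbhs_ballP[d /= d0 dP].
have [||d' d'0 d'P] := @finite_uniform R _ (edges_upto N) (fun e d => forall z, ball y d z ->
    ball (gam e (F e (coo e y))) r (gam e (F e (coo e z)))).
- move=> e d1 d2 d21 H z yz; apply: H; exact: le_ball yz.
- move=> e _; have := @ball_cvg R (Y R) (Y R) (gam e \o (F e \o coo e)) y.
  move=> [+ _]; apply=> //; apply: (@continuous_comp (Y R) R (Y R)); last exact: gam_continuous.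
  apply: (@continuous_comp (Y R) R R); first exact: coo_continuous.
  exact: u_continuous.
exists (Num.min d d'); first by rewrite lt_min d0.
move=> z yz.
have yzd : ball y d z by apply: le_ball yz; rewrite ge_min lexx.
have yzd' : ball y d' z by apply: le_ball yz; rewrite ge_min lexx orbT.
have nBad := dP z yzd.
have [sz|[e [t [eN t01 zE]]]] := small_or_edge N z.
  have sy : small N y.
    by apply: contrapT => sy; apply: nBad; left; case: ifPn => // /asboolP.
  by rewrite ball_mdist; apply: NP; exact: gsmall.
have [s s01 yE] : ed e y.
  apply: contrapT => sy; apply: nBad; right; exists e, t; split=> //.
  by rewrite /D; case: ifPn => // /asboolP.
have := d'P e; rewrite mem_edges_upto => /(_ eN z yzd').
by rewrite zE yE !cooK !clampE// !gF.
Qed.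

(** Two edges overlap only at vertices, where the parameter is 0 or 1 and is fixed, so the values
    agree. *)
Lemma edge_map_exists F : exists g, edge_map F g.
Proof.
have /choice[g gP] y : exists z, forall e t, 0 <= t <= 1 -> y = gam e t ->
    z = gam e (F e t).
  have [e [t [t01 ->]]] := gam_cover y; exists (gam e (F e t)) => e' t' t'01 E.
  have [ee'|[n en]] := gam_overlap t01 t'01 E.
    by rewrite -ee' in E *; rewrite (gam_inj t01 t'01 E).
  have fix_vtx k u : 0 <= u <= 1 -> gam k u = vtx n -> gam k (F k u) = vtx n.
    by move=> u01 ku; rewrite -ku; case: (gam_eq_vtx u01 ku) => -[_ ->]; rewrite ?u0 ?u1.
  by rewrite (fix_vtx e)// (fix_vtx e')// -E.
exists g => e t; rewrite -gam_clamp (gP (gam e (clamp t)) e (clamp t) (clamp_itv t) erefl).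
by rewrite uhomeo_clamp gam_clamp.
Qed.

Lemma edge_map_inv F (h : homeo (Y R)) : edge_map F h ->
  edge_map (fun e => uV (F e)) (homeo_inv h).
Proof.
move=> hF e t; apply: (can_inj (homeo_funK h)).
by rewrite homeo_invK hF /= uinvK.
Qed.

Theorem glue F : exists h : homeo (Y R), edge_map F h.
Proof.
have [g gF] := edge_map_exists F.
have [k kF] := edge_map_exists (fun e => uV (F e)).
have gk : cancel g k.
  by move=> y; have [e [t [_ ->]]] := gam_cover y; rewrite gF kF /= ufunK.
have kg : cancel k g.
  by move=> y; have [e [t [_ ->]]] := gam_cover y; rewrite kF gF /= uinvK.
by exists (Homeo gk kg (edge_map_continuous gF) (edge_map_continuous kF)).
Qed.

End gluing.

(** * Shadowing in Y *)

Section interval_attractors.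
Context {R : realType}.
Implicit Types (F : uhomeo R) (t s : R).

Lemma orbit_limit F t : exists2 s, F s = s &
  forall d, 0 < d -> exists n, `|s - iter n F t| < d.
Proof.
have [Ft|Ft] := eqVneq (F t) t.
  by exists t => // d d0; exists 0%N; rewrite subrr normr0.
pose u n := iter n F t.
have /andP[t0 t1] := u_in Ft.
have u01 n : 0 <= u n <= 1.
  by elim: n => [|n IH] /=; [rewrite /u/= !ltW|rewrite u_itv].
have cu : cvgn u.
  move: Ft; rewrite neq_lt => /orP[Ft|Ft].
    apply: nonincreasing_is_cvgn.
      by apply/nonincreasing_seqP; elim=> [|n IH]; rewrite /u /= ?leu// ltW.
    by exists 0 => _ [n _ <-]; have /andP[] := u01 n.
  apply: nondecreasing_is_cvgn.
    by apply/nondecreasing_seqP; elim=> [|n IH]; rewrite /u /= ?leu// ltW.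
  by exists 1 => _ [n _ <-]; have /andP[] := u01 n.
exists (limn u).
  have Fu : (F \o u) @ \oo --> F (limn u).
    by apply: cvg_comp cu _; exact: u_continuous.
  have uS : (F \o u) @ \oo --> limn u by move: cu; rewrite -cvg_shiftS.
  exact: (cvg_unique (@Rhausdorff R) Fu uS).
move=> d d0; have /cvg_ballP/(_ d d0)[N _ NP] := cu.
by exists N; apply: NP => /=.
Qed.

(** The signs are chosen to make both ends attracting: collars with these boundary points are mapped
    strictly inside themselves. *)
Lemma osc_ends F (eta : R) : osc F -> 0 < eta ->
  (exists2 a, 0 < a < eta & F a < a) /\ (exists2 c, 1 - eta < c < 1 & c < F c).
Proof.
move=> oF eta0; split.
  have [|z1 [z2 [z3 [z4 [[_ _ z23 z34 z4e] [_ z2F _ _]]]]]] := oF 0 _ (u0 F) eta eta0.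
    by rewrite lexx ler01.
  exists z2 => //; have /andP[-> _] := u_down_in z2F; lra.
have [|z1 [z2 [z3 [z4 [[z1e _ _ _ _] [z1F _ _ _]]]]]] := oF 1 _ (u1 F) eta eta0.
  by rewrite ler01 lexx.
by exists z1 => //; have /andP[_ ->] := u_up_in z1F; rewrite andbT; lra.
Qed.

(** Moved points exist on both sides of [t]. If the two chosen ones have the same sign, the
    oscillation supplies a point of the other sign, which replaces the one on its side. *)
Lemma osc_opposite F t (eta : R) : osc F -> 0 < t < 1 -> F t = t -> 0 < eta ->
  exists u d, [/\ t - eta < u, u < t, t < d, d < t + eta &
    (u < F u /\ F d < d) \/ (F u < u /\ d < F d)].
Proof.
move=> oF /andP[t0 t1] Ft eta0.
pose r := Num.min eta (Num.min t (1 - t)).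
have r0 : 0 < r by rewrite !lt_min eta0 t0 subr_gt0.
have re : r <= eta by rewrite ge_min lexx.
have rt : r <= t by rewrite !ge_min lexx orbT.
have rt1 : r <= 1 - t by rewrite !ge_min lexx !orbT.
have moved x : t - r < x < t + r -> (x <= 0 \/ 1 <= x) \/
    (exists2 n, x = qenum n & F x != x) -> F x != x.
  by move=> /andP[? ?] [[?|?]|[n _ //]]; exfalso; lra.
have [|x /andP[x1 x2] xE] := @osc_moved_dense _ F (t - r) t oF; first by lra.
have {xE} Fx : F x != x by apply: moved xE; apply/andP; split; lra.
have [|y /andP[y1 y2] yE] := @osc_moved_dense _ F t (t + r) oF; first by lra.
have {yE} Fy : F y != y by apply: moved yE; apply/andP; split; lra.
have [|z1 [z2 [z3 [z4 [[l1 l2 l3 l4 l5] [m1 m2 _ _]]]]]] := oF t _ Ft r r0.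
  by rewrite !ltW.
have z1t : z1 != t by apply/eqP => E; rewrite E Ft ltxx in m1.
have z2t : z2 != t by apply/eqP => E; rewrite E Ft ltxx in m2.
have w : exists u d, [/\ t - r < u, u < t, t < d, d < t + r &
    (u < F u /\ F d < d) \/ (F u < u /\ d < F d)].
  move: Fx Fy; rewrite !neq_lt => /orP[Fx|Fx] /orP[Fy|Fy].
  - move: z1t; rewrite neq_lt => /orP[z1t|z1t].
      by exists z1, y; split=> //; left.
    by exists x, z1; split=> //; [lra|right].
  - by exists x, y; split=> //; right.
  - by exists x, y; split=> //; left.
  - move: z2t; rewrite neq_lt => /orP[z2t|z2t].
      by exists z2, y; split=> //; [lra|right].
    by exists x, z2; split=> //; [lra|left].
by have [u [d [? ? ? ? ?]]] := w; exists u, d; split=> //; lra.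
Qed.

End interval_attractors.

(** * Attracting and repelling neighbourhoods in Y *)

Section attractors.
Context {R : realType}.
Implicit Types (m n N : nat) (t s : R) (e : bool * nat) (y z : Y R).
Variables (f : homeo (Y R)) (F : bool * nat -> uhomeo R).
Hypotheses (fF : edge_map F f) (oscF : forall e, osc (F e)).

Lemma gam_near e t (r : R) : 0 < r -> exists2 d, 0 < d & forall s, `|t - s| < d ->
  mdist (gam e t) (gam e s) < r.
Proof.
move=> r0; have [d d0 dP] := (@ball_cvg R R (Y R) (gam e) t).1 (@gam_continuous R e t) r r0.
by exists d => // s ts; rewrite -ball_mdist; exact: dP.
Qed.

Lemma edge_ends e (r : R) : 0 < r -> exists ac : R * R,
  [/\ 0 < ac.1 < 1, F e ac.1 < ac.1,
      forall t, 0 <= t <= ac.1 -> mdist (gam e 0) (gam e t) < r &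
      [/\ 0 < ac.2 < 1, ac.2 < F e ac.2 &
      forall t, ac.2 <= t <= 1 -> mdist (gam e 1) (gam e t) < r]].
Proof.
move=> r0; have [d d0 dP] := @gam_near e 0 r r0; have [d' d'0 d'P] := @gam_near e 1 r r0.
have [[a /andP[a0 ad] Fa] _] := osc_ends (@oscF e) d0.
have [_ [c /andP[cd c1] Fc]] := osc_ends (@oscF e) d'0.
exists (a, c); split=> //=.
- exact: u_down_in Fa.
- by move=> t /andP[t0 ta]; apply: dP; rewrite sub0r normrN ger0_norm ?(le_lt_trans ta).
split=> //; first exact: u_up_in Fc.
by move=> t /andP[ct t1]; apply: d'P; rewrite ger0_norm ?subr_ge0//; lra.
Qed.

(* [C] is either a vertex outside [small N] or all of [small N]. *)
Lemma core_attractor N (C : set (Y R)) (big : bool) (r : R) : 0 < r ->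
  (forall e t, (e.2 <= N)%N -> 0 <= t <= 1 -> C (gam e t) -> t = 0 \/ t = 1) ->
  (if big then forall y, C y -> ~ small N y else C = small N) ->
  (forall y z, C y -> C z -> mdist y z < r / 3) ->
  (forall y, C y -> C (f y)) ->
  exists a : set (Y R), [/\ closed a, C `<=` a^°,
    forall y z, a y -> a z -> mdist y z < r & forall y, a y -> a^° (f y)].
Proof.
move=> r0 Cend CN Cdiam Cf.
have r3 : 0 < r / 3 by rewrite divr_gt0.
have /choice[ac acP] := fun e => edge_ends e r3.
(* [J e] consists of the collars at the ends of [e] that lie in [C], and [K e] is the complement of
   their interiors. Both are closed, so the first gives a closed set [a] and the second an open set
   [O] inside it. *)
pose J e : set R := (if `[< C (gam e 0) >] then [set t | t <= (ac e).1] else set0) `|`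
  (if `[< C (gam e 1) >] then [set t | (ac e).2 <= t] else set0).
pose K e : set R := (if `[< C (gam e 0) >] then [set t | (ac e).1 <= t] else setT) `&`
  (if `[< C (gam e 1) >] then [set t | t <= (ac e).2] else setT).
have JP e t : J e t <-> (C (gam e 0) /\ t <= (ac e).1) \/ (C (gam e 1) /\ (ac e).2 <= t).
  by rewrite /J; case: asboolP => h0; case: asboolP => h1;
    rewrite /setU /set0 /mkset /=; tauto.
have KP e t : K e t <-> (C (gam e 0) -> (ac e).1 <= t) /\ (C (gam e 1) -> t <= (ac e).2).
  by rewrite /K; case: asboolP => h0; case: asboolP => h1;
    rewrite /setI /setT /mkset /=; tauto.
have cJ e : closed (J e).
  apply: closedU; case: ifP => _; try exact: closed0;
    [exact: closed_le|exact: closed_ge].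
have cK e : closed (K e).
  apply: closedI; case: ifP => _; try exact: closedT;
    [exact: closed_ge|exact: closed_le].
pose a := (if big then set0 else small N) `|`
  [set y | exists e t, [/\ (e.2 <= N)%N, 0 <= t <= 1, J e t & y = gam e t]].
pose O := ~` ((if big then small N else set0) `|`
  [set y | exists e t, [/\ (e.2 <= N)%N, 0 <= t <= 1, K e t & y = gam e t]]).
have ca : closed a.
  apply: closedU; last exact: closed_edges.
  by case: (big); [exact: closed0|exact: small_closed].
have oO : open O.
  apply: closed_openC; apply: closedU; last exact: closed_edges.
  by case: (big); [exact: small_closed|exact: closed0].
have KC e t : 0 <= t <= 1 -> (e.2 <= N)%N -> C (gam e t) -> K e t -> False.
  move=> t01 eN Ct /KP[K0 K1]; have [/andP[a0 _] _ _ [/andP[_ c1] _ _]] := acP e.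
  case: (Cend e t eN t01 Ct) => tE; rewrite tE in Ct.
    by have := K0 Ct; lra.
  by have := K1 Ct; lra.
have CO y : C y -> O y.
  move=> Cy [|[e [t [eN t01 Kt yE]]]].
    by case: (big) CN => // CN; exact: CN.
  by rewrite yE in Cy; exact: (KC e t).
have Jo_O e t : (e.2 <= N)%N -> 0 <= t <= 1 ->
    (C (gam e 0) /\ t < (ac e).1) \/ (C (gam e 1) /\ (ac e).2 < t) -> O (gam e t).
  move=> eN t01 Jt.
  have [/andP[a0 a1] _ _ [/andP[c0 c1] _ _]] := acP e.
  have [te|te] := pselect (at_end e t).
    apply: CO; case: te Jt => [->|[_ ->]] [[Ct tc]|[Ct tc]] //; exfalso; lra.
  case.
    case: (big) => //; case=> [/(vinf_at_end t01)//|[e' [s [e's s01 E]]]].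
    have [ee|//] := overlap_at_end t01 s01 E.
    by rewrite -ee ltnNge eN in e's.
  move=> [e' [s [e's s01 /KP[K0 K1] E]]].
  have [ee|//] := overlap_at_end t01 s01 E.
  rewrite -ee in E K0 K1; rewrite (gam_inj t01 s01 E) in Jt.
  by case: Jt => -[h h']; [have := K0 h|have := K1 h]; lra.
have Oa : O `<=` a.
  move=> y Oy; have [sy|[e [t [eN t01 yE]]]] := small_or_edge N y.
    by left; case: ifP => // b; apply: Oy; left; rewrite b.
  right; exists e, t; split=> //; apply: contrapT => nJ; apply: Oy; right.
  exists e, t; split=> //; apply/KP; split=> h; rewrite leNgt; apply/negP => h';
    apply: nJ; apply/JP; [left|right]; split=> //; exact: ltW.
have Oint : O `<=` a^° by rewrite -open_subsetE.
have near_core y : a y -> exists2 c, C c & mdist c y < r / 3.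
  case=> [sy|[e [t [eN /andP[t0 t1] /JP Jt ->]]]].
    exists y; last by rewrite mdistxx.
    by case: (big) sy CN => // sy ->.
  have [_ _ A [_ _ B]] := acP e.
  case: Jt => -[Ce te]; [exists (gam e 0) => //|exists (gam e 1) => //].
    by apply: A; rewrite t0.
  by apply: B; rewrite te.
exists a; split=> //.
- by move=> y /CO/Oint.
- move=> y z /near_core[c Cc cy] /near_core[d Cd dz].
  have := Cdiam c d Cc Cd; have := metric_triangle y c z; have := metric_triangle c d z.
  by rewrite [mdist y c]metric_sym; lra.
move=> y ay; apply: Oint; case: ay => [sy|[e [t [eN t01 /JP Jt ->]]]].
  by apply: CO; apply: Cf; case: (big) sy CN => // sy ->.
rewrite fF; apply: Jo_O => //; first by rewrite u_itv.
have [_ Fa _ [_ Fc _]] := acP e.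
case: Jt => -[h ht]; [left|right]; split=> //.
  by rewrite (le_lt_trans _ Fa)// leu.
by rewrite (lt_le_trans Fc)// leu.
Qed.

(** At [vinf] the core is a whole tail, which is invariant; elsewhere it is a single point. The case
    [t = 1] includes the free tips of teeth. *)
Lemma vertex_attractor e t (r : R) : 0 < r -> t = 0 \/ t = 1 ->
  exists a : set (Y R), [/\ closed a, a^° (gam e t),
    forall y z, a y -> a z -> mdist y z < r & forall y, a y -> a^° (f y)].
Proof.
move=> r0 tE.
have t01 : 0 <= t <= 1 by case: tE => ->; rewrite lexx ler01.
have r3 : 0 < r / 3 by rewrite divr_gt0.
have ft : f (gam e t) = gam e t by rewrite fF; case: tE => ->; rewrite ?u0 ?u1.
have [tinf|tinf] := pselect (gam e t = vinf).
  have [N NP] := small_diam r3.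
  have [e' t' e'N t'01 [/(gam_eq_vinf t'01)[_]|[e2 [s [Ns s01 E]]]]||||a [ca Ca da fa]] :=
    @core_attractor N (small N) false r r0.
  - by right.
  - have [ee|] := overlap_at_end t'01 s01 E; first by rewrite -ee ltnNge e'N in Ns.
    by case=> [|[_]]; [left|right].
  - by [].
  - exact: NP.
  - move=> y [->|[e' [s [Ns s01 ->]]]]; first by left; rewrite fF u1.
    by right; exists e', (F e' s); rewrite fF u_itv.
  by exists a; split=> //; apply: Ca; left.
have [N Nt] : exists N, ~ small N (gam e t).
  have [[//|[n ->]]|te] := pselect (is_vtx (gam e t)).
    by exists n.+1 => /vtx_small; rewrite ltnn.
  exists e.2; case=> // -[e' [s [Ns s01 E]]]; apply: te.
  have [ee|/at_end_vtx//] := overlap_at_end t01 s01 E.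
  by rewrite ee ltnn in Ns.
have [e' s _ s01 E|y ->|y z -> ->|y ->|a [ca Ca da fa]] :=
    @core_attractor N [set gam e t] true r r0 => //.
- have [ee|[|[_]]] := overlap_at_end s01 t01 E; [|by left|by right].
  by rewrite ee in E; rewrite (gam_inj s01 t01 E).
- by rewrite mdistxx.
by exists a; split=> //; exact: Ca.
Qed.

Lemma inner_attractor e t (r : R) : 0 < r -> 0 < t < 1 -> F e t = t ->
  exists a : set (Y R), [/\ closed a, a^° (gam e t),
    forall y z, a y -> a z -> mdist y z < r &
    (forall y, a y -> a^° (f y)) \/ (forall y, a y -> a^° (homeo_inv f y))].
Proof.
move=> r0 t01 Ft.
have [q q0 qP] := @gam_near e t _ (divr_gt0 r0 (ltr0n R 2)).
have [u [d [qu ut td dq sgn]]] := osc_opposite (@oscF e) t01 Ft q0.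
have u01 : 0 < u < 1 by case: sgn => [[/u_up_in]|[/u_down_in]].
have d01 : 0 < d < 1 by case: sgn => [[_ /u_down_in]|[_ /u_up_in]].
case/andP: (u01) => u_0 u_1; case/andP: (d01) => d_0 d_1.
pose D : set R := [set s | s <= u] `|` [set s | d <= s].
pose O : set (Y R) := [set y | exists s, [/\ 0 <= s <= 1, ~ D s & y = gam e s]].
pose a : set (Y R) := [set y | exists s, [/\ 0 <= s <= 1, `[u, d]%classic s & y = gam e s]].
have Os s : u < s < d -> O (gam e s).
  move=> /andP[us sd]; exists s; split=> //; first by apply/andP; split; lra.
  by case=> /=; rewrite leNgt ?us ?sd.
have Oint : O `<=` a^°.
  rewrite -open_subsetE.
    move=> y [s [s01 /not_orP[/negP us /negP sd] ->]]; rewrite -!ltNge in us sd.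
    by exists s; split=> //; rewrite /= in_itv/= !ltW.
  apply: open_edge_part; first exact: closedU (@closed_le R u) (@closed_ge R d).
  by move=> s [->|[_ ->]]; [left|right]; exact: ltW.
exists a; split.
- by apply: closed_edge_image; exact: itv_closed.
- by apply/Oint/Os; rewrite ut.
- have nt s : u <= s <= d -> mdist (gam e t) (gam e s) < r / 2.
    by move=> /andP[us sd]; apply: qP; rewrite ltr_norml; apply/andP; split; lra.
  move=> y z [s [_ us ->]] [s' [_ us' ->]].
  rewrite /= !in_itv/= in us us'.
  have := metric_triangle (gam e s) (gam e t) (gam e s').
  by have := nt s us; have := nt s' us'; rewrite [mdist (gam e s) (gam e t)]metric_sym; lra.
case: sgn => -[Fu Fd]; [left|right] => y [s [_ usd ->]];
  rewrite /= in_itv/= in usd; case/andP: usd => us sd.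
  rewrite fF; apply/Oint/Os; rewrite (lt_le_trans Fu) ?leu//=.
  by rewrite (le_lt_trans _ Fd) ?leu.
rewrite (edge_map_inv fF); apply/Oint/Os => /=.
by rewrite ltuV ltVu (lt_le_trans Fu)//= (le_lt_trans sd).
Qed.

Theorem osc_shadowing : shadowing f.
Proof.
apply: shadowing_criterion => [p fp r r0|y].
  have [e [t [t01 pE]]] := gam_cover p.
  have Ft : F e t = t.
    by apply: (@gam_inj _ e); rewrite ?u_itv// -fF -pE fp.
  rewrite pE; case/andP: (t01); rewrite !le_eqVlt => /predU1P[t0|t0].
    have [a [ca at_ da fa]] := @vertex_attractor e t r r0 (or_introl (esym t0)).
    by move=> _; exists a; split=> //; left.
  move=> /predU1P[t1|t1]; last by apply: inner_attractor => //; rewrite t0.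
  have [a [ca at_ da fa]] := @vertex_attractor e t r r0 (or_intror t1).
  by exists a; split=> //; left.
have [e [t [t01 ->]]] := gam_cover y.
have [s Fs sP] := orbit_limit (F e) t.
have it n : iter n f (gam e t) = gam e (iter n (F e) t).
  by elim: n => //= n ->; rewrite fF.
exists (gam e s); first by rewrite fF Fs.
move=> U /(@gam_continuous R e s)/nbhs_ballP[d /= d0 dU].
by have [n nd] := sP d d0; exists n; rewrite it; exact: dU.
Qed.

End attractors.

(** * The generic conjugacy class *)

Section generic_class.
Context {R : realType}.
Implicit Types (e : bool * nat) (f g h : homeo (Y R)) (F G H : uhomeo R).

Lemma osc_near_le F p (d d' : R) : d <= d' -> osc_near F p d -> osc_near F p d'.
Proof.
move=> dd' [z1 [z2 [z3 [z4 [[? ? ? ? ?] ?]]]]].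
by exists z1, z2, z3, z4; split=> //; split=> //; lra.
Qed.

Lemma osc_eq F G : F =1 G -> osc F -> osc G.
Proof.
move=> FG oF p p01 Gp d d0; have Fp : F p = p by rewrite FG.
have [z1 [z2 [z3 [z4 [zz [s1 s2 s3 s4]]]]]] := oF p p01 Fp d d0.
by exists z1, z2, z3, z4; split=> //; rewrite -!FG.
Qed.

(** An increasing conjugacy preserves order and the sign of the displacement; continuity of its
    inverse controls the scale. *)
Lemma osc_conj F G H : (forall t, F (H t) = H (G t)) -> osc F -> osc G.
Proof.
move=> FH oF p p01 Gp d d0.
have [d' d'0 d'P] := (real_continuousP _ _).1 (@u_continuous R (uV H) (H p)) d d0.
have FHp : F (H p) = H p by rewrite FH Gp.
have Hp01 : 0 <= H p <= 1 by rewrite u_itv.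
have [z1 [z2 [z3 [z4 [[l1 l2 l3 l4 l5] [s1 s2 s3 s4]]]]]] := oF _ Hp01 FHp d' d'0.
have nearH z : H p - d' < z < H p + d' -> p - d < uV H z < p + d.
  move=> /andP[? ?]; have := d'P z; rewrite ltr_norml => H0.
  have : `|uV H (H p) - uV H z| < d by apply: H0; apply/andP; split; lra.
  rewrite [uV H (H p)]/= ufunK ltr_norml => /andP[? ?].
  by apply/andP; split; lra.
have GE z : G (uV H z) = uV H (F z).
  by apply: (can_inj (ufunK H)); rewrite -FH /= !uinvK.
exists (uV H z1), (uV H z2), (uV H z3), (uV H z4).
rewrite !GE !ltu; split=> //; split=> //.
  by have /andP[] : p - d < uV H z1 < p + d by apply: nearH; apply/andP; split; lra.
by have /andP[] : p - d < uV H z4 < p + d by apply: nearH; apply/andP; split; lra.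
Qed.

Definition fam f : bool * nat -> uhomeo R := sval (cid (homeo_on_edges f)).

Lemma famP f : edge_map (fam f) f.
Proof. by rewrite /fam; case: cid. Qed.

Lemma edge_map_uniq (F G : bool * nat -> uhomeo R) g :
  edge_map F g -> edge_map G g -> forall e, F e =1 G e.
Proof.
move=> gF gG e t; have [t01|t01] := boolP (0 <= t <= 1).
  by apply: (@gam_inj _ e); rewrite ?u_itv// -gF gG.
have out : t <= 0 \/ 1 <= t.
  by move: t01; rewrite negb_and -!ltNge => /orP[/ltW|/ltW]; auto.
by rewrite !(ufun_out _ out).
Qed.

Definition generic : set (homeo (Y R)) := [set f | forall e, osc (fam f e)].

Lemma generic_shadowing f : generic f -> shadowing f.
Proof. by move=> gf; apply: osc_shadowing (@famP f) gf. Qed.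

(** A conjugating homeomorphism also acts edge by edge, so both inclusions reduce to the
    interval. *)
Lemma generic_conjugate f : generic f -> conjugacy_class f = generic.
Proof.
move=> gf; apply/seteqP; split=> g.
  move=> [h fh] e; apply: (@osc_conj (fam f e) (fam g e) (fam h e)) (gf e) => t.
  have [t01|t01] := boolP (0 <= t <= 1).
    apply: (@gam_inj _ e); rewrite ?u_itv// -!famP.
    exact: (congr1 (fun k => k (gam e t)) fh).
  have out : t <= 0 \/ 1 <= t.
    by move: t01; rewrite negb_and -!ltNge => /orP[/ltW|/ltW]; auto.
  by rewrite !(ufun_out _ out).
move=> gg.
have /choice[H HP] e : exists H : uhomeo R, forall t, fam f e (H t) = H (fam g e t).
  exact: osc_conjugate.
have [h hH] := glue H; exists h; apply/funext => y /=.
have [e [t [_ ->]]] := gam_cover y.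
by rewrite hH (famP f) (famP g) hH HP.
Qed.

Lemma fam_coo f e t : 0 <= t <= 1 -> fam f e t = coo e (f (gam e t)).
Proof. by move=> t01; rewrite famP cooK clampE// u_itv. Qed.

Lemma fam_close f e (r : R) : 0 < r -> exists2 d, 0 < d & forall g, mdist f g < d ->
  forall t, `|fam f e t - fam g e t| < r.
Proof.
move=> r0.
have [d d0 dP] := compact_unif_continuous (@compact_setT R (Y R))
  (fun x _ => @coo_continuous R e x) r0.
exists d => // g fg t; have [t01|t01] := boolP (0 <= t <= 1).
  rewrite !fam_coo//; apply: dP => //; rewrite ball_mdist.
  exact: le_lt_trans (dist_C0_fun f g _) fg.
have out : t <= 0 \/ 1 <= t.
  by move: t01; rewrite negb_and -!ltNge => /orP[/ltW|/ltW]; auto.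
by rewrite !(ufun_out _ out) subrr normr0.
Qed.

(** Oscillation of the map of one edge at a fixed scale. Generic maps are those that satisfy this
    for every [e] and every scale [k.+1%:R^-1], a countable family. *)
Definition osc_scale e (r : R) : set (homeo (Y R)) :=
  [set f | forall t, 0 <= t <= 1 -> fam f e t <> t \/ osc_near (fam f e) t r].

(** Both alternatives, being moved and oscillating at scale [r], persist for nearby points and
    nearby maps, so compactness of [0, 1] makes the radius uniform in [t]. *)
Lemma open_osc_scale e (r : R) : open (osc_scale e r).
Proof.
rewrite openE => f fW.
have [||d d0 dP] := @compact_uniform R R `[0, 1] (fun d t => forall g, mdist f g < d ->
    fam g e t <> t \/ osc_near (fam g e) t r) (@segment_compact R 0 1).
- by move=> d d' t d'd H g fg; apply: H; exact: lt_le_trans d'd.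
- move=> t; rewrite /= in_itv/= => /fW[ft|].
    (* Three errors are each below [c]: changing the point in [fam f e], changing the map, and
       changing the point in the identity. A fixed point nearby would make the displacement less
       than [3 * c]. *)
    pose c := `|fam f e t - t| / 4.
    have c0 : 0 < c by rewrite divr_gt0// normr_gt0 subr_eq0; exact/eqP.
    have [d1 d10 d1P] := (real_continuousP _ _).1 (@u_continuous R (fam f e) t) c c0.
    have [d2 d20 d2P] := fam_close f e c0.
    exists (Num.min d1 (Num.min d2 c)); first by rewrite !lt_min d10 d20.
    move=> t' tt' g; rewrite !lt_min => /and3P[_ fg _]; left => gt'.
    move: tt'; rewrite /ball/= !lt_min => /and3P[/d1P h1 _ h3].
    have h2 := d2P g fg t'; rewrite gt' in h2.
    have : `|fam f e t - t| = c * 4 by rewrite divfK.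
    have := ler_normD (fam f e t - fam f e t') (fam f e t' - t).
    have := ler_normD (fam f e t' - t') (t' - t).
    by rewrite [`|t' - t|]distrC !addrA !subrK; lra.
  move=> [z1 [z2 [z3 [z4 [[l1 l2 l3 l4 l5] [s1 s2 s3 s4]]]]]].
  pose c := Num.min (Num.min (fam f e z1 - z1) (z2 - fam f e z2))
    (Num.min (fam f e z3 - z3) (z4 - fam f e z4)).
  have c0 : 0 < c by rewrite !lt_min !subr_gt0 s1 s2 s3.
  have c1 : c <= fam f e z1 - z1 by rewrite !ge_min lexx.
  have c2 : c <= z2 - fam f e z2 by rewrite !ge_min lexx ?orbT.
  have c3 : c <= fam f e z3 - z3 by rewrite !ge_min lexx ?orbT.
  have c4 : c <= z4 - fam f e z4 by rewrite !ge_min lexx ?orbT.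
  have [d2 d20 d2P] := fam_close f e c0.
  pose d1 := Num.min (z1 - (t - r)) (t + r - z4).
  have d1a : d1 <= z1 - (t - r) by rewrite ge_min lexx.
  have d1b : d1 <= t + r - z4 by rewrite ge_min lexx orbT.
  have d10 : 0 < d1 by rewrite lt_min !subr_gt0 l1.
  exists (Num.min d1 d2); first by rewrite lt_min d10.
  move=> t' tt' g; rewrite lt_min => /andP[_ /d2P fg]; right.
  move: tt'; rewrite /ball/= lt_min => /andP[+ _].
  rewrite ltr_norml => /andP[? ?].
  exists z1, z2, z3, z4; split; first by split=> //; lra.
  have gz z : fam f e z - c < fam g e z < fam f e z + c.
    by have := fg z; rewrite ltr_norml => /andP[? ?]; apply/andP; split; lra.
  by split; [have /andP[? ?] := gz z1|have /andP[? ?] := gz z2|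
    have /andP[? ?] := gz z3|have /andP[? ?] := gz z4]; lra.
apply/nbhs_ballP; exists d => // g; rewrite ballEmdist => fg t t01.
by apply: dP => //; rewrite /= in_itv.
Qed.

Lemma generic_Gdelta : Gdelta generic.
Proof.
pose W (n : nat) : set (homeo (Y R)) :=
  if (unpickle n : option ((bool * nat) * nat)) is Some (e, k)
  then osc_scale e k.+1%:R^-1 else setT.
exists W => [n|].
  by rewrite /W; case: unpickle => [[e k]|]; [exact: open_osc_scale|exact: openT].
apply/seteqP; split=> [f gf n _|f Wf e].
  rewrite /W; case: unpickle => [[e k]|//] t t01.
  have [ft|/eqP ft] := eqVneq (fam f e t) t; last by left.
  by right; apply: gf => //; rewrite invr_gt0.
move=> p p01 fp r r0; have [k] := ltr_add_invr r0; rewrite add0r => kr.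
have := Wf (pickle (e, k)) I; rewrite /W pickleK => /(_ p p01)[//|].
exact/osc_near_le/ltW.
Qed.

(** Each edge is perturbed separately, with its own tolerance, so that maps and inverses move by at
    most [r / 2] in Y; this bound is common to all edges. *)
Lemma generic_dense : dense generic.
Proof.
move=> O [f Of] oO.
have /nbhs_ballP[r /= r0 rO] : nbhs f O by exact: open_nbhs_nbhs.
have r2 : 0 < r / 2 by rewrite divr_gt0.
have /choice[G GP] e : exists G : uhomeo R, osc G /\ forall t, 0 <= t <= 1 ->
    mdist (gam e (fam f e t)) (gam e (G t)) <= r / 2 /\
    mdist (gam e (uV (fam f e) t)) (gam e (uV G t)) <= r / 2.
  have [eta eta0 etaP] := compact_unif_continuous (@segment_compact R 0 1)
    (fun x _ => @gam_continuous R e x) r2.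
  have [d d0 dP] := u_unif (uV (fam f e)) eta0.
  pose q := Num.min eta d / 2.
  have q0 : 0 < q by rewrite divr_gt0// lt_min eta0.
  have qe : q < eta.
    by rewrite ltr_pdivrMr// (@le_lt_trans _ _ eta) ?ge_min ?lexx//; lra.
  have qd : q < d.
    by rewrite ltr_pdivrMr// (@le_lt_trans _ _ d) ?ge_min ?lexx ?orbT//; lra.
  have [G oG GF] := osc_dense (fam f e) q0.
  have close s s' : 0 <= s <= 1 -> `|s - s'| < eta -> mdist (gam e s) (gam e s') <= r / 2.
    move=> s01 ss'; rewrite ltW// -ball_mdist; apply: etaP ss'.
    by rewrite /= in_itv.
  exists G; split=> // t t01; split; apply: close; rewrite ?u_itv//.
    exact: le_lt_trans (GF t) qe.
  (* The inverses at [t] are compared through [uinv G t]: its images under [fam f e] and [G] are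
     close, and the inverse of [fam f e] is uniformly continuous. *)
  rewrite -[X in _ - X](ufunK (fam f e)); apply: dP.
  rewrite -[X in `|X - _|](uinvK G) distrC.
  exact: le_lt_trans (GF _) qd.
have [g gG] := glue G.
exists g; split; last first.
  by move=> e; apply: (osc_eq _ (GP e).1) => t; exact: (edge_map_uniq gG (@famP g) e t).
apply: rO; rewrite ballEmdist; change (dist_C0 f g < r).
apply: (@le_lt_trans _ _ (r / 2)); last by lra.
apply: dist_C0_le; first exact: ltW.
  move=> y; have [e [t [t01 ->]]] := gam_cover y.
  by rewrite (famP f) gG; exact: ((GP e).2 t t01).1.
move=> y; have [e [t [t01 ->]]] := gam_cover y.
rewrite (edge_map_inv (famP f)) (edge_map_inv gG).
exact: ((GP e).2 t t01).2.
Qed.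

End generic_class.

Theorem theorem3p5 (R : realType) :
  (exists f : homeo (Y R),
     [/\ Gdelta (conjugacy_class f),
         dense (conjugacy_class f) &
         forall g : homeo (Y R), conjugacy_class f g -> shadowing g]) /\
  residual [set g : homeo (Y R) | shadowing g].
Proof.
(* Density yields a generic member only once the space of homeomorphisms is known to be
   inhabited. *)
have [h _] := @glue R (fun=> uid).
have [f [_ gf]] : [set: homeo (Y R)] `&` generic !=set0.
  by apply: generic_dense; [exists h|exact: openT].
split.
  exists f; rewrite generic_conjugate//; split; first exact: generic_Gdelta.
    exact: generic_dense.
  exact: generic_shadowing.
exists generic; split; [exact: generic_Gdelta|exact: generic_dense|].
exact: generic_shadowing.
Qed.
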